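(* Let $\Sigma \subset \mathbb{C}$ be compact and symmetric about the real axis with $0 < c(\Sigma) < 1$. Then there exists a sequence $\{\alpha_n\}$ of distinct algebraic integers such that: (i) $h_{\Sigma}(\alpha_n) \to -\log c(\Sigma)$ as $n \to \infty$; (ii) for every neighborhood $U$ of $\Sigma$, $\ \sharp\{\mathrm{Conj}(\alpha_n) \cap U\}/\deg \alpha_n \to 1$ as $n\to\infty$, where $\sharp\{\mathrm{Conj}(\alpha_n)\cap U\}$ is the number of conjugates of $\alpha_n$ contained in $U$; (iii) the probability measures $\mu_n := \frac{1}{\deg\alpha_n}\sum_{x\in\mathrm{Conj}(\alpha_n)}\delta_x$ converge in the weak* topology to the equilibrium measure $\mu_\Sigma$ of $\Sigma$.
   Context: For a Borel probability measure $\mu$ on $\mathbb{C}$, the logarithmic energy is $I(\mu) = \iint \log\frac{1}{|z-w|}\,d\mu(w)\,d\mu(z)$. For a compact set $K\subset\mathbb{C}$, the logarithmic capacity is $c(K) = \exp[-\inf\{I(\mu)\}]$, the infimum being over Borel probability measures $\mu$ supported in $K$. If $c(K)>0$ there is a unique such measure $\mu_K$, the equilibrium measure of $K$, with $c(K) = \exp[-I(\mu_K)]$. The Green's function of $K$ with pole at $\infty$ is defined for all $z\in\mathbb{C}$ by $\mathrm{g}_K(z,\infty) = \int \log|z-w|\,d\mu_K(w) - \log c(K)$. For an algebraic number $\alpha \in \overline{\mathbb{Q}} \subset \mathbb{C}$, let $P_\alpha \in \mathbb{Z}[z]$ be the polynomial irreducible over the integers (hence primitive; unique up to sign) with $P_\alpha(\alpha)=0$;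 let $\deg\alpha = \deg P_\alpha$, let $b_\alpha$ be its leading coefficient, and let $\mathrm{Conj}(\alpha)$ be the set of all roots of $P_\alpha$ in $\mathbb{C}$ (the conjugates of $\alpha$). For a compact set $\Sigma$ with $c(\Sigma)>0$, the height of $\alpha$ with respect to $\Sigma$ is $$h_\Sigma(\alpha) = \frac{1}{\deg\alpha}\Big(\log|b_\alpha| + \sum_{x\in \mathrm{Conj}(\alpha)} \mathrm{g}_\Sigma(x,\infty)\Big).$$ Symmetric about the real axis means invariant under complex conjugation. *)

(* Defs.v *)
From HB Require Import structures.
From mathcomp Require Import all_boot all_order all_algebra finmap.
From mathcomp Require Import complex.
From mathcomp Require Import all_classical all_reals all_analysis.

Set Implicit Arguments.
Unset Strict Implicit.
Unset Printing Implicit Defensive.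

Import Order.TTheory GRing.Theory Num.Theory.
Import numFieldNormedType.Exports.

Local Open Scope classical_set_scope.
Local Open Scope ring_scope.
Local Open Scope complex_scope.

(* [R[i]] carries the topology of its (complex-valued) norm, as does any
   [numClosedFieldType], and the Borel sigma-algebra of that topology. *)
HB.instance Definition _ (R : realType) := NormedModule.copy R[i] R[i]^o.

HB.instance Definition _ (R : realType) :=
  Measurable.copy R[i] (g_sigma_algebraType (@open R[i])).

Section Potential.
Context {R : realType}.
Implicit Types (mu : probability R[i] R) (K : set R[i]) (z w : R[i]).

Definition cabs z : R := complex.Re `|z|.

Local Open Scope ereal_scope.

(* Extended-real valued: [lne 0 = -oo], so the kernel of the energy is [+oo] on
   the diagonal. For a measure on a bounded set both kernels are semibounded,
   so that the integrals are unambiguous. *)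
Definition log_energy mu : \bar R :=
  \int[mu]_z \int[mu]_w (- lne (cabs (z - w)%R)%:E).

Definition supported_in K mu : Prop := mu (~` K) = 0.

(* If [K] is compact, then the infimum is not [-oo], hence [fine] is harmless
   and [capacity K = 0] iff the infimum is [+oo]. *)
Definition capacity K : R :=
  fine (expeR (- ereal_inf [set log_energy mu | mu in supported_in K])).

Definition is_equilibrium K mu : Prop :=
  supported_in K mu /\ (capacity K)%:E = expeR (- log_energy mu).

(* The choice below is immaterial: the equilibrium measure is unique on Borel
   sets as soon as [0 < capacity K]. *)
Definition equilibrium K : probability R[i] R := get (is_equilibrium K).

Definition green K z : \bar R :=
  \int[equilibrium K]_w (lne (cabs (z - w)%R)%:E) - (ln (capacity K))%:E.

End Potential.

(* [irreducible_poly] ignores constant factors, and thus would not force a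
   polynomial over [int] to be primitive. *)
Definition irreducible_elt {A : unitRingType} (p : A) : Prop :=
  [/\ p != 0, p \isn't a GRing.unit &
      forall q r, p = q * r -> q \is a GRing.unit \/ r \is a GRing.unit].

Section Conjugates.
Context {R : realType}.
Implicit Types (alpha : R[i]) (K : set R[i]).

(* Defined up to sign, for algebraic [alpha]; [0] otherwise. *)
Definition int_minpoly alpha : {poly int} :=
  xget 0 [set p | irreducible_elt p /\ root (map_poly intr p) alpha].

Definition alg_deg alpha : nat := (size (int_minpoly alpha)).-1.

Definition conjugates alpha : set R[i] :=
  [set x | root (map_poly intr (int_minpoly alpha)) x].

Definition height K alpha : \bar R :=
  (((alg_deg alpha)%:R^-1)%:E *
    ((ln `|(lead_coef (int_minpoly alpha))%:~R|)%:E +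
     \sum_(x \in conjugates alpha) green K x))%E.

Definition conjugates_measure alpha : {measure set R[i] -> \bar R} :=
  let s : seq R[i] := fset_set (conjugates alpha) in
  mscale ((alg_deg alpha)%:R^-1)%:nng (msum (fun k => \d_(s`_k)) (size s)).

End Conjugates.

Definition algebraic_integer {R : realType} (alpha : R[i]) : Prop :=
  integralOver (intr : int -> R[i]) alpha.

Definition weak_cvg {R : realType} (mu_ : nat -> {measure set R[i] -> \bar R})
    (mu : {measure set R[i] -> \bar R}) : Prop :=
  forall f : R[i] -> R, continuous f -> (exists M : R, forall z, `|f z| <= M) ->
  (\int[mu_ n]_z (f z)%:E)%E @[n --> \oo] --> (\int[mu]_z (f z)%:E)%E.

(* Main.v *)
(** Write [c = exp (- V)] for the capacity. Drawing points at random from a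
    measure of almost minimal energy gives finite subsets of [Sigma] with a
    large Vandermonde determinant; near-maximizers of the latter (Fekete points)
    are the roots of a monic real polynomial [F] of degree [m] whose lemniscate
    [|F| <= exp (- (V + e) m)] lies near [Sigma]. A Siegel-type pigeonhole
    argument supplies an integer polynomial that is small in the sup norm
    relative to the lemniscate, hence a way to approximate [(X + B) F ^ k], for
    a huge [B], by a monic polynomial that is Eisenstein at [2]. Its roots are
    one far root [zeta], of modulus roughly [exp (V n)], and [n] roots in the
    lemniscate; moreover the product of the distances from a point to these [n]
    roots is nearly at least [exp (- V n)] close to every given point.

    A weak limit of the root-counting measures (obtained along ultrafilters, by
    coding the roots on a space-filling curve) is supported in [Sigma] and has
    potential at most [V] everywhere, so it has energy at most [V]: it is an
    equilibrium measure. Equilibrium measures are unique because the logarithmic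
    kernel, written in the chordal metric, is a positive definite power series
    whose moments determine a measure. The Green function is then close to [0]
    on average at the [n] near roots, while the far root contributes [V n]. *)
Require Import Defs.
From HB Require Import structures.
From mathcomp Require Import all_boot all_order all_algebra finmap.
From mathcomp Require Import separable complex.
From mathcomp Require Import all_classical all_reals all_analysis.
From mathcomp Require Import measurable_realfun.
From mathcomp Require Import ring lra zify.

Set Implicit Arguments.
Unset Strict Implicit.
Unset Printing Implicit Defensive.

Import Order.TTheory GRing.Theory Num.Theory.
Import numFieldNormedType.Exports.

Local Open Scope classical_set_scope.
Local Open Scope ring_scope.
Local Open Scope complex_scope.

(** By Fekete's theorem a compact set of capacity below 1 has a neighbourhood that contains only
    finitely many complete sets of conjugates, so at least one conjugate has to escape; the factor
    [X + B] lets exactly one do so. The sign of [V] enters through the level [exp (- (V + e) m) < 1]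
    of the lemniscate: high powers of [F] are small there, and this feeds the pigeonhole argument.

    For a general [Sigma] the Green function is not continuous, so weak convergence alone does not
    control its average over the near roots. Two one-sided facts replace continuity. The potential
    of the limit measure is at most [V] at every point, so the Green function is nonnegative at the
    near roots. Truncations of the kernel are bounded and continuous, so the average potential is
    asymptotically at least a truncated energy, which can be taken close to [V]. The first fact is
    Frostman's inequality; it is why the construction tracks products of distances near every point.

    The kernel is shifted by [ln M], with [M] above all relevant distances: potentials and energies
    become monotone limits of nonnegative quantities. *)

Section Elementary.
Context {R : realType}.

Lemma sumr_const_seq (T : Type) (s : seq T) (c : R) : \sum_(x <- s) c = c * (size s)%:R.
Proof. by rewrite big_const_seq count_predT iter_addr addr0 mulr_natr. Qed.

Lemma max_lip (x y c : R) : `|Num.max x c - Num.max y c| <= `|x - y|.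
Proof.
have := ler_norm (x - y); have := ler_norm (y - x); rewrite distrC ler_norml /Num.max.
by case: (ltP x c) => ?; case: (ltP y c) => ? ? ?; apply/andP; split; lra.
Qed.

Lemma min_lip (x y c : R) : `|Num.min x c - Num.min y c| <= `|x - y|.
Proof.
have := ler_norm (x - y); have := ler_norm (y - x); rewrite distrC ler_norml /Num.min.
by case: (ltP x c) => ?; case: (ltP y c) => ? ? ?; apply/andP; split; lra.
Qed.

End Elementary.

(** * The real-valued modulus of complex numbers and its topology *)

Section Modulus.
Context {R : realType}.
Implicit Types (x y z w : R[i]).

Lemma normC_cabs z : `|z| = (cabs z)%:C.
Proof. by rewrite /cabs normc_def. Qed.

Lemma cabs_ge0 z : 0 <= cabs z.
Proof. by rewrite -lecR -normC_cabs rmorph0 normr_ge0. Qed.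
Hint Extern 0 (is_true (0 <= cabs _)) => exact: cabs_ge0 : core.

Lemma cabsM z w : cabs (z * w) = cabs z * cabs w.
Proof. by apply: (@complexI R); rewrite rmorphM/= -!normC_cabs normrM. Qed.

Lemma cabs1 : cabs (1 : R[i]) = 1.
Proof. by apply: (@complexI R); rewrite -normC_cabs normr1. Qed.

Lemma cabs0 : cabs (0 : R[i]) = 0.
Proof. by apply: (@complexI R); rewrite -normC_cabs normr0. Qed.

Lemma cabsN z : cabs (- z) = cabs z.
Proof. by apply: (@complexI R); rewrite -!normC_cabs normrN. Qed.

Lemma cabsV z : cabs z^-1 = (cabs z)^-1.
Proof.
by apply: (@complexI R); rewrite -normC_cabs normfV normC_cabs fmorphV.
Qed.

Lemma cabsX z n : cabs (z ^+ n) = cabs z ^+ n.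
Proof. by apply: (@complexI R); rewrite rmorphXn/= -!normC_cabs normrX. Qed.

Lemma cabs_prod (I : Type) (s : seq I) (P : pred I) (F : I -> R[i]) :
  cabs (\prod_(i <- s | P i) F i) = \prod_(i <- s | P i) cabs (F i).
Proof. exact: (big_morph _ cabsM cabs1). Qed.

Lemma cabs_eq0 z : (cabs z == 0) = (z == 0).
Proof. by rewrite -(inj_eq (@complexI R)) -normC_cabs normr_eq0. Qed.

Lemma cabsD z w : cabs (z + w) <= cabs z + cabs w.
Proof. by rewrite -lecR rmorphD/= -!normC_cabs ler_normD. Qed.

Lemma cabsB z w : cabs (z - w) <= cabs z + cabs w.
Proof. by rewrite -(cabsN w) cabsD. Qed.

Lemma cabs_sum (I : Type) (s : seq I) (P : pred I) (F : I -> R[i]) :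
  cabs (\sum_(i <- s | P i) F i) <= \sum_(i <- s | P i) cabs (F i).
Proof.
elim/big_ind2 : _ => [|x y z w xy zw|//]; first by rewrite cabs0.
exact: le_trans (cabsD _ _) (lerD xy zw).
Qed.

Lemma cabs_distC z w : cabs (z - w) = cabs (w - z).
Proof. by rewrite -cabsN opprB. Qed.

Lemma cabs_triangle y x z : cabs (x - z) <= cabs (x - y) + cabs (y - z).
Proof. by rewrite (_ : x - z = (x - y) + (y - z)) ?cabsD//; ring. Qed.

Lemma ler_cabs_dist z w : `|cabs z - cabs w| <= cabs (z - w).
Proof.
rewrite ler_norml; have := cabsD (z - w) w; have := cabsD (w - z) z.
rewrite (cabs_distC w) !subrK; lra.
Qed.

Lemma cabs_real (r : R) : cabs r%:C = `|r|.
Proof.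
by apply: (@complexI R); rewrite -normC_cabs normc_def /= expr0n addr0 sqrtr_sqr.
Qed.

Lemma cabs_ge_Re z : `|complex.Re z| <= cabs z.
Proof. by rewrite -lecR -normC_cabs normc_ge_Re. Qed.

Lemma sqr_cabs z : cabs z ^+ 2 = complex.Re z ^+ 2 + complex.Im z ^+ 2.
Proof. by rewrite /cabs normc_def /= sqr_sqrtr ?addr_ge0 ?sqr_ge0. Qed.

Lemma cabs_ge_Im z : `|complex.Im z| <= cabs z.
Proof.
rewrite -ler_sqr ?nnegrE// real_normK ?num_real// sqr_cabs.
by rewrite lerDr sqr_ge0.
Qed.

Lemma cabs_le_ReIm z : cabs z <= `|complex.Re z| + `|complex.Im z|.
Proof.
rewrite -ler_sqr ?nnegrE ?addr_ge0// sqr_cabs sqrrD !real_normK ?num_real//.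
by rewrite lerD2r lerDl mulrn_wge0 // mulr_ge0.
Qed.

Lemma cabs_conj z : cabs z^* = cabs z.
Proof. by apply: (@complexI R); rewrite -!normC_cabs normcJ. Qed.

Lemma cabs_int (a : int) : cabs (a%:~R : R[i]) = `|a%:~R|.
Proof. by rewrite -cabs_real -(rmorph_int (@real_complex R)). Qed.

(** The norm takes values in [R[i]], whose order makes every positive element real; radii can
    therefore be taken in [R]. *)
Lemma nbhs_cabs z (A : set R[i]) :
  nbhs z A <-> exists2 e : R, 0 < e & forall y, cabs (z - y) < e -> A y.
Proof.
split=> [/nbhs_ballP[e e0 eA]|[e e0 eA]].
  have e0' : 0 < complex.Re e /\ e = (complex.Re e)%:C.
    by move: e0; case: (e) => a b; rewrite /= ltcE/= => /andP[/eqP-> ?].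
  exists (complex.Re e); first by case: e0'.
  move=> y zy; apply: eA; rewrite -ball_normE /= normC_cabs.
  by case: e0' => _ ->; rewrite ltcR.
apply/nbhs_ballP; exists e%:C; first by rewrite /= ltcR.
by move=> y; rewrite -ball_normE /= normC_cabs ltcR => /eA.
Qed.

Lemma continuous_cabsP (f : R[i] -> R) :
  continuous f <-> forall z (e : R), 0 < e ->
    exists2 d : R, 0 < d & forall y, cabs (z - y) < d -> `|f z - f y| < e.
Proof.
split=> [fc z e e0|H z].
  have /cvgrPdist_lt H := fc z.
  exact/(nbhs_cabs z [set y | `|f z - f y| < e])/H.
move=> A /nbhs_ballP[e /= e0 eA]; have [d d0 dP] := H z e e0.
by apply/(nbhs_cabs z (f @^-1` A)); exists d => // y /dP; exact: eA.
Qed.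

Lemma lipschitz_continuous (f : R[i] -> R) (k : R) :
  (forall z w, `|f z - f w| <= k * cabs (z - w)) -> continuous f.
Proof.
move=> fk; apply/continuous_cabsP => z e e0.
have k1 : 0 < `|k| + 1 by rewrite ltr_pwDr.
exists (e / (`|k| + 1)); first by rewrite divr_gt0.
move=> y; rewrite ltr_pdivlMr// => zy; apply: le_lt_trans zy.
apply: le_trans (fk _ _) _; rewrite mulrC ler_wpM2l//.
by apply: le_trans (ler_norm _) _; rewrite lerDl.
Qed.

Lemma cabs_continuous : continuous (@cabs R).
Proof.
by apply: (@lipschitz_continuous _ 1) => z w; rewrite mul1r ler_cabs_dist.
Qed.

Lemma compact_cabs_bounded (K : set R[i]) :
  compact K -> exists2 r : R, 0 < r & forall z, K z -> cabs z <= r.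
Proof.
move=> cK.
have /compact_bounded [M [_ /(_ (`|M| + 1))]] :
    compact (@cabs R @` K).
  by apply: continuous_compact => //; apply: continuous_subspaceT; exact: cabs_continuous.
rewrite (le_lt_trans (ler_norm _))// ?ltrDl// => /(_ isT) H.
exists (`|M| + 1); first by rewrite ltr_pwDr.
by move=> z Kz; have := H (cabs z); rewrite /= ger0_norm//; apply; exists z.
Qed.

End Modulus.
#[global] Hint Extern 0 (is_true (0 <= cabs _)) => exact: cabs_ge0 : core.

(** * Reduction of real polynomials modulo integer ones, and the pigeonhole lemma *)

Section IntegerPolynomials.
Context {R : realType}.
Implicit Types (p q g : {poly R}).

Local Notation ZtoR := (map_poly (intr : int -> R)).

Lemma size_ZtoR (h : {poly int}) : size (ZtoR h) = size h.
Proof. by apply: size_map_inj_poly; rewrite ?rmorph0//; exact: intr_inj. Qed.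

Lemma size_drop_lead p M : (size p <= M.+1)%N -> p`_M = 0 -> (size p <= M)%N.
Proof.
move=> sp pM; apply/leq_sizeP => j; rewrite leq_eqVlt => /orP[/eqP<-//|Mj].
by rewrite nth_default// (leq_trans sp).
Qed.

Lemma triangular_rounding (b : nat -> {poly R}) (u : nat -> {poly int}) :
  (forall l, size (b l) = l.+1) -> (forall l, size (u l) = l.+1) ->
  (forall l, (b l)`_l = ((u l)`_l)%:~R) ->
  forall M g, (size g <= M)%N -> exists (h : {poly int}) (r : nat -> R),
    [/\ (size h <= M)%N, forall l, 0 <= r l < 1 &
        g = ZtoR h + \sum_(l < M) r l *: b l].
Proof.
move=> sb su bu; elim=> [|M IH] g sg.
  exists 0, (fun=> 0); split; rewrite ?size_poly0//.
    by move=> l; rewrite lexx ltr01.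
  by rewrite big_ord0 addr0 rmorph0; apply/eqP; rewrite -size_poly_leq0.
have bM0 : (b M)`_M != 0.
  by rewrite -[M in _`_M]/(M.+1.-1) -(sb M) -lead_coefE lead_coef_eq0
    -size_poly_eq0 sb.
set x := g`_M / (b M)`_M; set k := Num.floor x; set s := x - k%:~R.
have s01 : 0 <= s < 1.
  by rewrite subr_ge0 ltrBlDr floor_le /= addrC -intrD1 floorD1_gt.
have [|h [r [sh r01 gE]]] := IH (g - ZtoR (k *: u M) - s *: b M).
  apply: size_drop_lead.
    rewrite (leq_trans (size_polyD _ _))// geq_max size_polyN.
    rewrite (leq_trans (size_polyD _ _))/=; last first.
      rewrite geq_max sg size_polyN size_ZtoR.
      by rewrite (leq_trans (size_scale_leq _ _))// su.
    by rewrite (leq_trans (size_scale_leq _ _))// sb.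
  rewrite !coefB coefZ coef_map coefZ/= rmorphM/= -bu /s mulrBl divfK//.
  by ring.
exists (k *: u M + h), (fun l => if l == M then s else r l); split.
- rewrite (leq_trans (size_polyD _ _))// geq_max (leq_trans (size_scale_leq _ _)) ?su//=.
  exact: leqW.
- by move=> l; case: ifP.
- rewrite big_ord_recr/= eqxx rmorphD/=.
  rewrite (eq_bigr (fun l : 'I_M => r l *: b l)); last first.
    by move=> l _; rewrite ifN// neq_ltn ltn_ord.
  have -> : g = (g - ZtoR (k *: u M) - s *: b M) + s *: b M + ZtoR (k *: u M).
    by rewrite !subrK.
  by rewrite {}gE; ring.
Qed.

Lemma triangular_lead (b : nat -> {poly R}) (a : nat -> R) M :
  (forall l, size (b l) = l.+1) -> (exists2 l, (l < M)%N & a l != 0) ->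
  exists d, [/\ (d < M)%N, \sum_(l < M) a l *: b l = \sum_(l < d.+1) a l *: b l,
    size (\sum_(l < M) a l *: b l) = d.+1 &
    (\sum_(l < M) a l *: b l)`_d = a d * (b d)`_d].
Proof.
move=> sb; elim: M => [|M IH] [l lM al]; first by rewrite ltn0 in lM.
have [aM|aM] := eqVneq (a M) 0.
  have [|d [dM dE sE cE]] := IH.
    exists l => //; rewrite ltn_neqAle -ltnS lM andbT.
    by apply: contra_neq al => ->.
  exists d; rewrite big_ord_recr/= aM scale0r addr0; split=> //.
  exact: ltnW.
have sM : (size (\sum_(i < M) a i *: b i)%R <= M)%N.
  apply: (leq_trans (size_sum _ _ _)); apply/bigmax_leqP => i _.
  by rewrite (leq_trans (size_scale_leq _ _))// sb.
exists M; split=> //.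
  by rewrite big_ord_recr/= addrC size_polyDl size_scale// sb ltnS.
by rewrite big_ord_recr/= coefD coefZ nth_default ?add0r.
Qed.

Lemma powerbasis_size (F : {poly R}) m l : F \is monic -> size F = m.+1 ->
  (0 < m)%N -> size ('X^(l %% m) * F ^+ (l %/ m)) = l.+1.
Proof.
move=> mF sF m0; rewrite size_monicM ?monicXn ?monic_neq0 ?monic_exp//.
rewrite size_polyXn -(prednK (_ : 0 < size (F ^+ _))%N); last first.
  by rewrite lt0n size_poly_eq0 monic_neq0// monic_exp.
rewrite size_exp sF /=; have := divn_eq l m; lia.
Qed.

Lemma powerbasis_coef (F : {poly R}) m l : F \is monic -> size F = m.+1 ->
  (0 < m)%N -> ('X^(l %% m) * F ^+ (l %/ m))`_l = 1.
Proof.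
move=> mF sF m0; have /monicP : 'X^(l %% m) * F ^+ (l %/ m) \is monic.
  by rewrite monicMr ?monicXn// monic_exp.
by rewrite lead_coefE powerbasis_size.
Qed.

Lemma ltr_dist_truncn (x y : R) : 0 <= x -> 0 <= y ->
  Num.truncn x = Num.truncn y -> `|x - y| < 1.
Proof.
move=> x0 y0 xy; have := truncn_itv x0; have := truncn_itv y0.
rewrite -xy -natr1 => /andP[y1 y2] /andP[x1 x2]; rewrite ltr_distl; lra.
Qed.

(* Siegel-type lemma by the pigeonhole principle: multiples of the upper half of
   the basis are reduced modulo the lattice of integer polynomials. *)
Lemma small_coordinates (b : nat -> {poly R}) (L Q : nat) :
  (forall l, size (b l) = l.+1) -> (forall l, (b l)`_l = 1) ->
  (0 < L)%N -> (0 < Q)%N ->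
  exists (h : {poly int}) (a : nat -> R),
    [/\ ZtoR h = \sum_(l < 2 * L) a l *: b l,
        exists2 l, (l < 2 * L)%N & a l != 0,
        forall l, (l < L)%N -> `|a l| <= Q%:R^-1 &
        forall l, `|a l| <= (Q ^ 2).+1%:R / Q%:R].
Proof.
move=> sb cb; case: L => // L _; case: Q => // Q _; set Q1 : R := Q.+1%:R.
have Q0 : 0 < Q1 by rewrite ltr0n.
(* Each of the [L.+1] multipliers has one value more than [Q.+1 ^ 2], while the [2 * L.+1]
   remainders fall into [(Q.+1 ^ 2) ^ L.+1] cells; hence a collision. *)
pose S := (Q.+1 ^ 2).+1.
pose T := {ffun 'I_L.+1 -> 'I_S}.
pose sg (s : T) (l : nat) : R :=
  if (L.+1 <= l)%N then (s (inord (l - L.+1)))%:R else 0.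
pose g (s : T) := \sum_(l < 2 * L.+1) (sg s l / Q1) *: b l.
have sb' l : (b l)`_l = (('X^l : {poly int})`_l)%:~R by rewrite cb coefXn eqxx.
have sg_size s : (size (g s) <= 2 * L.+1)%N.
  apply: (leq_trans (size_sum _ _ _)); apply/bigmax_leqP => i _.
  by rewrite (leq_trans (size_scale_leq _ _))// sb.
have /choice[hr hrP] : forall s : T, exists x : {poly int} * (nat -> R),
    (forall l, 0 <= x.2 l < 1) /\
    g s = ZtoR x.1 + \sum_(l < 2 * L.+1) x.2 l *: b l.
  move=> s; have [h [r [_ r01 gE]]] :=
    triangular_rounding sb (@size_polyXn _) sb' (sg_size s).
  by exists (h, r).
pose cell (s : T) : {ffun 'I_(2 * L.+1) -> 'I_Q.+1} :=
  [ffun l : 'I_(2 * L.+1) => inord (Num.truncn (Q1 * (hr s).2 l))].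
have : ~~ injectiveb cell.
  apply/negP => /injectiveP/leq_card; rewrite !card_ffun !card_ord leqNgt.
  by rewrite expnM ltn_exp2r// ltnSn.
move=> /injectivePn[s [s' ss' cs]].
pose a l := (sg s l - sg s' l) / Q1 - ((hr s).2 l - (hr s').2 l).
have rr l : (l < 2 * L.+1)%N -> `|(hr s).2 l - (hr s').2 l| < Q1^-1.
  move=> lL; have := congr1 (fun f : {ffun 'I_(2 * L.+1) -> 'I_Q.+1} => val (f (Ordinal lL))) cs.
  have tq t : (Num.truncn (Q1 * (hr t).2 l) < Q.+1)%N.
    have [+ _] := hrP t => /(_ l)/andP[r0 r1].
    have rQ : 0 <= Q1 * (hr t).2 l by rewrite mulr_ge0// ltW.
    rewrite -(ltr_nat R) (@le_lt_trans _ _ (Q1 * (hr t).2 l)) ?truncn_le//.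
    by rewrite -[ltRHS]mulr1 ltr_pM2l.
  rewrite !ffunE/= !inordK// => tr.
  have [+ _] := hrP s => /(_ l)/andP[r0 _].
  have [+ _] := hrP s' => /(_ l)/andP[r0' _].
  have := ltr_dist_truncn (mulr_ge0 (ltW Q0) r0) (mulr_ge0 (ltW Q0) r0') tr.
  by rewrite -mulrBr normrM (gtr0_norm Q0) -ltr_pdivlMl// mulr1.
exists ((hr s).1 - (hr s').1), (fun l => if (l < 2 * L.+1)%N then a l else 0).
have dE : (Q.+1 ^ 2)%:R / Q1 + Q1^-1 = (Q.+1 ^ 2).+1%:R / Q1.
  by rewrite -[in RHS]natr1 mulrDl mul1r.
split.
- have [_ ge] := hrP s; have [_ ge'] := hrP s'.
  rewrite rmorphB/= -[ZtoR _](addrK (\sum_(l < 2 * L.+1) (hr s).2 l *: b l)) -ge.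
  rewrite -[ZtoR _](addrK (\sum_(l < 2 * L.+1) (hr s').2 l *: b l)) -ge'.
  rewrite /g -!sumrB; apply: eq_bigr => l _; rewrite ltn_ord /a.
  rewrite -!scalerBl; congr (_ *: _); field; exact: lt0r_neq0.
(* Where the two tuples differ, the multiples differ by at least the inverse of [Q.+1] and the
   remainders by less, so this coordinate is not zero. *)
- have /existsP[i si] : [exists i, s i != s' i].
    rewrite -negb_forall; apply: contra ss' => /forallP H.
    by apply/eqP/ffunP => i; apply/eqP.
  have lL : (L.+1 + i < 2 * L.+1)%N by rewrite mul2n -addnn ltn_add2l.
  exists (L.+1 + i)%N => //; rewrite lL.
  have := rr _ lL; rewrite /a /sg leq_addr addKn inord_val.
  apply: contraTneq => /eqP; rewrite subr_eq0 => /eqP <-.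
  rewrite -leNgt normrM (gtr0_norm (_ : 0 < Q1^-1)) ?invr_gt0//.
  rewrite ler_peMl ?invr_ge0 ?(ltW Q0)//.
  have : ((s i : nat)%:Z - (s' i : nat)%:Z != 0 :> int).
    by rewrite subr_eq0 eqz_nat.
  rewrite -normr_gt0 gtz0_ge1 => ss1.
  by rewrite !(pmulrn 1) -intrB -intr_norm (ler_int _ 1).
- move=> l lL; have lL2 : (l < 2 * L.+1)%N by rewrite (leq_trans lL)// leq_pmull.
  rewrite lL2 /a /sg leqNgt lL /= subrr mul0r add0r normrN.
  exact: (ltW (rr _ lL2)).
- move=> l; case: ifP => lL; last by rewrite normr0 divr_ge0.
  apply: (le_trans (ler_normB _ _)); rewrite -dE lerD//; last exact: (ltW (rr _ lL)).
  rewrite normrM (gtr0_norm (_ : 0 < Q1^-1)) ?invr_gt0// ler_wpM2r ?invr_ge0 ?(ltW Q0)//.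
  rewrite /sg; case: ifP => _; last by rewrite subrr normr0.
  have H (t : T) j : (t j)%:R <= (Q.+1 ^ 2)%:R :> R by rewrite ler_nat -ltnS.
  have := H s (inord (l - L.+1)); have := H s' (inord (l - L.+1)).
  have := ler0n R (s (inord (l - L.+1))); have := ler0n R (s' (inord (l - L.+1))).
  rewrite ler_distl; lra.
Qed.

End IntegerPolynomials.

(** * Integer polynomials that are small relative to a lemniscate *)

Section IntegerApproximation.
Context {R : realType}.
Implicit Types (p q g T F : {poly R}) (z : R[i]).

Local Notation ZtoR := (map_poly (intr : int -> R)).
Local Notation ZtoC := (map_poly (intr : int -> R[i])).
Local Notation RtoC := (map_poly (real_complex R)).

Definition pabs p z : R := cabs (RtoC p).[z].

Lemma pabsM p q z : pabs (p * q) z = pabs p z * pabs q z.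
Proof. by rewrite /pabs rmorphM hornerM cabsM. Qed.

Lemma pabsX p n z : pabs (p ^+ n) z = pabs p z ^+ n.
Proof. by rewrite /pabs rmorphXn/= horner_exp cabsX. Qed.

Lemma pabs_polyX z : pabs 'X z = cabs z.
Proof. by rewrite /pabs map_polyX hornerX. Qed.

Lemma pabsZ a p z : pabs (a *: p) z = `|a| * pabs p z.
Proof. by rewrite /pabs map_polyZ hornerZ cabsM cabs_real. Qed.

Lemma pabs_ge0 p z : 0 <= pabs p z. Proof. exact: cabs_ge0. Qed.
Hint Extern 0 (is_true (0 <= pabs _ _)) => exact: pabs_ge0 : core.

Lemma pabs_sum (I : Type) (s : seq I) (P : pred I) (f : I -> {poly R}) z :
  pabs (\sum_(i <- s | P i) f i) z <= \sum_(i <- s | P i) pabs (f i) z.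
Proof. by rewrite /pabs raddf_sum horner_sum cabs_sum. Qed.

Lemma pabsB_le p q z : pabs (p - q) z <= pabs p z + pabs q z.
Proof. by rewrite /pabs rmorphB hornerD hornerN cabsB. Qed.

Lemma RtoC_ZtoR (f : {poly int}) : RtoC (ZtoR f) = ZtoC f.
Proof.
rewrite -map_poly_comp; apply: eq_map_poly => a /=.
by rewrite -(rmorph_int (real_complex R)).
Qed.

Lemma poly_le_exp (A d : R) : 0 < d ->
  exists k0, forall k, (k0 <= k)%N -> A * k.+1%:R ^+ 4 <= expR (d * k%:R).
Proof.
move=> d0; set e := Num.min 1 (d / 5).
have e0 : 0 < e by rewrite lt_min ltr01/= divr_gt0.
have e50 : 0 < e ^+ 5 by rewrite exprn_gt0.
exists (Num.truncn (`|A| / e ^+ 5)).+1 => k kk.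
have Ak : `|A| <= e ^+ 5 * k.+1%:R.
  rewrite mulrC -ler_pdivrMr//; apply: ltW.
  have /andP[_ h] := @truncn_itv _ (`|A| / e ^+ 5) (divr_ge0 (normr_ge0 _) (ltW e50)).
  by apply: (lt_le_trans h); rewrite ler_nat ltnW.
have -> : d * k%:R = 5%:R * (d / 5 * k%:R) by field.
rewrite expRM_natl.
have ek : e * k.+1%:R <= expR (d / 5 * k%:R).
  apply: le_trans (expR_ge1Dx _); rewrite -natr1 mulrDr mulr1 addrC lerD//.
    by rewrite ge_min lexx.
  by rewrite ler_wpM2r// ge_min lexx orbT.
apply: (@le_trans _ _ ((e * k.+1%:R) ^+ 5)); last first.
  by apply: lerXn2r; rewrite ?nnegrE ?expR_ge0 ?mulr_ge0 ?(ltW e0).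
rewrite exprMn (exprS k.+1%:R 4) mulrA ler_wpM2r// (le_trans _ Ak)//.
exact: ler_norm.
Qed.

(** For monic [F] of degree [m] this is a monic polynomial of degree [l] whose size on the
    lemniscate [pabs F <= rho] is of order [rho ^ (l %/ m)]. *)
Definition powbase F m (l : nat) : {poly R} := 'X^(l %% m) * F ^+ (l %/ m).

(** The pigeonhole lemma makes the low coordinates small, and the high ones carry a factor [rho ^ J]
    that beats their size. The weights in the sum are those for which the bound 1 gives
    [pabs f <= omega ^ d] everywhere. *)
Lemma small_integer_polynomial F m (rho C0 : R) :
  F \is monic -> size F = m.+1 -> (0 < m)%N -> 0 < rho < 1 -> 1 <= C0 ->
  exists (f : {poly int}) (d : nat) (a : nat -> R),
    [/\ size f = d.+1, (0 < d)%N,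
        ZtoR f = \sum_(l < d.+1) a l *: powbase F m l,
        \sum_(l < d.+1) `|a l| * (C0 ^+ m * rho ^+ (l %/ m)) <= 1 &
        `|f`_d|%:~R <= rho ^- (d %/ m)].
Proof.
move=> mF sF m0 /andP[r0 r1] C1.
pose c1 := (Num.truncn (C0 ^+ m)).+1.
have C0m : 0 <= C0 ^+ m by rewrite exprn_ge0// (le_trans ler01).
have c1C : C0 ^+ m <= c1%:R by have /andP[_ /ltW] := truncn_itv C0m.
(* The parameter of the pigeonhole lemma will be [4 * m * J * c1], linear in [J], so its square
   loses against [rho ^ J]. *)
have [J [J0 JP]] : exists J, (0 < J)%N /\
    ((4 * m * J * c1) ^ 2).+1%:R * rho ^+ J <= 1.
  have lr : 0 < - ln rho by rewrite oppr_gt0 ln_lt0// r0.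
  have [k0 k0P] := poly_le_exp (((4 * m * c1) ^ 2).+1%:R) lr.
  exists k0.+1; split=> //.
  have -> : rho ^+ k0.+1 = (expR (- ln rho * k0.+1%:R))^-1.
    rewrite -expRN mulNr opprK mulrC mulr_natl -lnXn ?lnK//.
    by rewrite posrE exprn_gt0.
  rewrite ler_pdivrMr ?expR_gt0// mul1r (le_trans _ (k0P _ (leqnSn _)))//.
  rewrite -natrX -natrM ler_nat; set x := k0.+1; set y := (4 * m * c1)%N.
  have -> : (4 * m * x * c1 = y * x)%N by rewrite /y; lia.
  have xx : (x <= x.+1)%N by [].
  have : (x ^ 2 <= x.+1 ^ 4)%N.
    by rewrite (leq_trans (_ : _ <= x.+1 ^ 2)%N) ?leq_exp2r// leq_pexp2l.
  have : (1 <= x.+1 ^ 4)%N by rewrite expn_gt0.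
  rewrite expnMn; nia.
(* Each of the [2 * L] weighted coordinates will be at most [c1 / Q]; this [Q] brings their sum down
   to one half. *)
set L := (m * J)%N; set Q := (4 * m * J * c1)%N.
have L0 : (0 < L)%N by rewrite muln_gt0 m0.
have Q0 : (0 < Q)%N by rewrite !muln_gt0 m0 J0.
have [f [a [fE [l0 l0L al0] aL aU]]] := small_coordinates
  (fun l => powerbasis_size l mF sF m0) (fun l => powerbasis_coef l mF sF m0) L0 Q0.
have [|d [dL dE sE cE]] := @triangular_lead _ (powbase F m) a (2 * L)
  (fun l => powerbasis_size l mF sF m0); first by exists l0.
have ad : ZtoR f = \sum_(l < d.+1) a l *: powbase F m l by rewrite fE dE.
have sum_le : \sum_(l < d.+1) `|a l| * (C0 ^+ m * rho ^+ (l %/ m)) <= 2^-1.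
  have Qr : 0 < Q%:R :> R by rewrite ltr0n.
  have rX i : 0 <= rho ^+ i by rewrite exprn_ge0// ltW.
  apply: (@le_trans _ _ (\sum_(l < 2 * L) c1%:R / Q%:R)); last first.
    rewrite sumr_const card_ord -[_ *+ _]mulr_natr mulrAC -natrM.
    rewrite ler_pdivrMr// mulrC -ler_pdivrMr ?invr_gt0// invrK -natrM ler_nat.
    by rewrite /L /Q; lia.
  have H l : `|a l| * (C0 ^+ m * rho ^+ (l %/ m)) <= c1%:R / Q%:R.
    apply: (@le_trans _ _ (c1%:R * (`|a l| * rho ^+ (l %/ m)))).
      by rewrite mulrCA ler_wpM2r// mulr_ge0.
    rewrite ler_wpM2l//; have [lL|Ll] := ltnP l L.
      rewrite (le_trans _ (aL _ lL))// ler_piMr// exprn_ile1// ltW//.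
    have : rho ^+ (l %/ m) <= rho ^+ J.
      by rewrite ler_wiXn2l ?(ltW r0) ?(ltW r1)// leq_divRL// mulnC.
    move=> rJ; apply: (le_trans (ler_pM (normr_ge0 _) (rX _) (aU l) rJ)).
    by rewrite mulrAC -[leRHS]mul1r ler_wpM2r ?invr_ge0 ?(ltW Qr).
  have d2 : (d.+1 <= 2 * L)%N by [].
  apply: (le_trans (ler_sum _ (fun (i : 'I_d.+1) _ => H i))).
  by rewrite !sumr_const !card_ord ler_wpMn2l// divr_ge0.
exists f, d, a; split=> //.
- by rewrite -(@size_ZtoR R) -sE fE.
(* A constant [f] would be a nonzero integer, and its single weighted coordinate would be at least
   1, against the bound one half. *)
- case: d {dE sE cE} dL ad sum_le => // _ ad.
  rewrite big_ord1 div0n expr0 mulr1 => sl; exfalso.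
  have fC : ZtoR f = (a 0%N)%:P.
    by rewrite ad big_ord1 /powbase mod0n div0n !expr0 mulr1 alg_polyC.
  have f0 : a 0%N = (f`_0)%:~R.
    by have := congr1 (fun p : {poly R} => p`_0) fC; rewrite coef_map coefC.
  have fn0 : f`_0 != 0.
    apply: contraTneq (isT : true) => f00; exfalso.
    have := triangular_lead (fun l => powerbasis_size l mF sF m0)
      (ex_intro2 _ _ l0 l0L al0) => -[d' [_ _ + _]].
    by rewrite -/(powbase F m) -fE fC f0 f00 rmorph0 size_poly0.
  have : 1 <= `|a 0%N|.
    by rewrite f0 -intr_norm (ler_int _ 1) -gtz0_ge1 normr_gt0.
  have : 1 <= C0 ^+ m by rewrite exprn_ege1.
  move=> h1 h2; have := ler_pM ler01 ler01 h2 h1; rewrite mulr1.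
  by move=> /le_trans/(_ sl); lra.
- by rewrite (le_trans sum_le)// invf_le1// ler1n.
- have cd : `|f`_d|%:~R = `|a d|.
    have := congr1 (fun p : {poly R} => p`_d) fE; rewrite coef_map cE.
    by rewrite powerbasis_coef// mulr1 => <-; rewrite intr_norm.
  rewrite cd -[_ ^- _]mul1r ler_pdivlMr ?exprn_gt0//.
  apply: le_trans (_ : \sum_(l < d.+1) `|a l| * (C0 ^+ m * rho ^+ (l %/ m)) <= _); last first.
    by rewrite (le_trans sum_le)// invf_le1// ler1n.
  rewrite big_ord_recr/= -[leLHS]add0r lerD//.
    by apply: sumr_ge0 => i _; rewrite !mulr_ge0// exprn_ge0// ltW.
  by rewrite ler_wpM2l// ler_peMl ?exprn_ege1// exprn_ge0// ltW.
Qed.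

Section Growth.
Variables (F : {poly R}) (m : nat) (rho : R).
Hypotheses (m0 : (0 < m)%N) (rho0 : 0 < rho < 1).

(** The exponential of the Green function with pole at infinity of the lemniscate
    [pabs F <= rho]. *)
Definition omega z : R := (Num.max 1 (pabs F z / rho)) `^ (m%:R^-1).

Lemma omegaX z : omega z ^+ m = Num.max 1 (pabs F z / rho).
Proof.
rewrite /omega -powR_mulrn ?powR_ge0// -powRrM mulVf ?pnatr_eq0 -?lt0n//.
by rewrite powRr1// le_max ler01.
Qed.

Lemma omega_ge1 z : 1 <= omega z.
Proof.
rewrite /omega -[leLHS](congr1 (fun f => f m%:R^-1) (powR1 R)).
by apply: ge0_ler_powR; rewrite ?invr_ge0 ?nnegrE ?le_max ?ler01 ?lexx.
Qed.

Lemma pabs_le_omega z : pabs F z <= rho * omega z ^+ m.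
Proof.
have /andP[r0 _] := rho0.
by rewrite omegaX -ler_pdivrMl// mulrC le_max lexx orbT.
Qed.

(** Outside the disc of radius [2 * C0] every root is at distance at least [cabs z / 2], so
    [pabs F z] is at least the [m]-th power of this number. *)
Lemma omega_bound (C0 : R) (rs : seq R[i]) z : size rs = m ->
  RtoC F = \prod_(x <- rs) ('X - x%:P) ->
  (forall x, x \in rs -> cabs x <= C0) -> 1 <= C0 ->
  cabs z <= 2 * C0 * omega z.
Proof.
move=> srs FE rF C01; have C0_ge0 : 0 <= C0 by rewrite (le_trans ler01).
have [zC|Cz] := leP (cabs z) (2 * C0).
  by rewrite (le_trans zC)// ler_peMr ?omega_ge1// mulr_ge0.
have key : cabs z ^+ m <= 2 ^+ m * pabs F z.
  rewrite /pabs FE horner_prod cabs_prod -srs.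
  have nE (x : R) : x ^+ size rs = \prod_(i <- rs) x.
    by rewrite big_const_seq count_predT iter_mulr_1.
  rewrite !nE -big_split /= !big_seq; apply: ler_prod => x xr.
  rewrite cabs_ge0/= hornerXsubC; have := rF _ xr; have := cabsD (z - x) x.
  rewrite subrK; lra.
have /andP[r0 r1] := rho0.
rewrite -(@ler_pXn2r _ m)// ?nnegrE ?cabs_ge0 ?mulr_ge0 ?(le_trans ler01 (omega_ge1 z))//.
rewrite exprMn (le_trans key)// exprMn -mulrA ler_wpM2l ?exprn_ge0//.
rewrite (le_trans (pabs_le_omega z))// ler_wpM2r//.
  by rewrite exprn_ge0// (le_trans ler01 (omega_ge1 z)).
by rewrite (le_trans (ltW r1))// exprn_ege1.
Qed.

End Growth.


(** Products of powers of [X] and [f] form an integer basis whose member of degree [l] is at most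
    [C0 ^ d * omega ^ l]. Rounding in this basis therefore costs at most [n + 1] terms of order
    [omega ^ n]. Half of [T - X ^ (n + 1)] is rounded, so that [P] is [X ^ (n + 1)] modulo 2. *)
Lemma integer_approximation F m (rho C0 : R) :
  F \is monic -> size F = m.+1 -> (0 < m)%N -> 0 < rho < 1 -> 1 <= C0 ->
  (forall z, cabs z <= C0 * omega F m rho z) ->
  exists2 C : R, 1 <= C & forall k T, (0 < k)%N -> T \is monic ->
    size T = (m * k).+2 -> exists P : {poly int},
    [/\ P \is monic, size P = (m * k).+2, irreducible_poly P,
      forall z, pabs (ZtoR P - T) z <=
        C * k.+1%:R * Num.max 1 (pabs F z / rho) ^+ k &
      `|(ZtoR P - T)`_(m * k)| <= C * rho ^- k].
Proof.
move=> mF sF m0 rho0 C1 zC; have /andP[r0 r1] := rho0.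
have [f [d [a [sf d0 fE fa fl]]]] := small_integer_polynomial mF sF m0 rho0 C1.
have C0_ge0 : 0 <= C0 by rewrite (le_trans ler01).
have om1 z := omega_ge1 F m rho z.
have om0 z : 0 <= omega F m rho z by rewrite (le_trans ler01).
(* Since [cabs z <= C0 * omega] and [pabs F <= rho * omega ^ m], the basis element of index [l] is
   at most [C0 ^ m * rho ^ (l %/ m) * omega ^ l], which is its weight times [omega ^ l]. *)
have fom z : pabs (ZtoR f) z <= omega F m rho z ^+ d.
  rewrite fE (le_trans (pabs_sum _ _ _ _))//.
  have := ler_wpM2r (exprn_ge0 d (om0 z)) fa; rewrite mul1r; apply: le_trans.
  rewrite mulr_suml ler_sum// => l _.
  rewrite pabsZ -!mulrA ler_wpM2l// /powbase pabsM !pabsX pabs_polyX.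
  apply: (@le_trans _ _ ((C0 * omega F m rho z) ^+ (l %% m) *
    (rho * omega F m rho z ^+ m) ^+ (l %/ m))).
    apply: ler_pM; rewrite ?exprn_ge0 ?pabs_ge0//.
      by apply: lerXn2r; rewrite ?nnegrE ?mulr_ge0.
    by apply: lerXn2r; rewrite ?nnegrE ?mulr_ge0 ?exprn_ge0 ?pabs_ge0 ?(ltW r0)// pabs_le_omega.
  rewrite !exprMn -exprM mulrACA -exprD -mulrA.
  have -> : (l %% m + m * (l %/ m) = l)%N by rewrite addnC mulnC -divn_eq.
  rewrite ler_pM ?mulr_ge0 ?exprn_ge0 ?(ltW r0)//.
    by rewrite ler_weXn2l// ltnW// ltn_mod.
  by rewrite ler_wpM2l ?exprn_ge0 ?(ltW r0)// ler_weXn2l// -ltnS.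
pose u l : {poly int} := 'X^(l %% d) * f ^+ (l %/ d).
have f0 : f != 0 by rewrite -size_poly_eq0 sf.
have su l : size (u l) = l.+1.
  rewrite /u size_mul ?expf_neq0 ?polyX_eq0// size_polyXn.
  rewrite -(prednK (_ : 0 < size (f ^+ _))%N); last first.
    by rewrite lt0n size_poly_eq0 expf_neq0.
  rewrite size_exp sf /=; have := divn_eq l d; lia.
have ul z l : pabs (ZtoR (u l)) z <= C0 ^+ d * omega F m rho z ^+ l.
  rewrite /u rmorphM/= !rmorphXn/= map_polyX pabsM !pabsX pabs_polyX.
  apply: (@le_trans _ _ ((C0 * omega F m rho z) ^+ (l %% d) *
    (omega F m rho z ^+ d) ^+ (l %/ d))).
    apply: ler_pM; rewrite ?exprn_ge0 ?pabs_ge0//.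
      by apply: lerXn2r; rewrite ?nnegrE ?mulr_ge0.
    by apply: lerXn2r; rewrite ?nnegrE ?mulr_ge0 ?exprn_ge0 ?pabs_ge0.
  rewrite exprMn -exprM -mulrA -exprD.
  have -> : (l %% d + d * (l %/ d) = l)%N by rewrite addnC mulnC -divn_eq.
  by rewrite ler_wpM2r ?exprn_ge0// ler_weXn2l// ltnW// ltn_mod.
have C0d : 1 <= C0 ^+ d by rewrite exprn_ege1.
exists (2 + 2 * m.+1%:R * C0 ^+ d).
  by rewrite (@le_trans _ _ 2) ?ler1n// lerDl !mulr_ge0// (le_trans ler01).
move=> k T k0 mT sT; set n := (m * k)%N.
have n0 : (0 < n)%N by rewrite muln_gt0 m0.
have sg : (size (2^-1 *: (T - 'X^(n.+1)))%R <= n.+1)%N.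
  rewrite (leq_trans (size_scale_leq _ _))//; apply: size_drop_lead.
    by rewrite (leq_trans (size_polyD _ _))// geq_max size_polyN sT size_polyXn leqnn.
  rewrite coefB coefXn eqxx; have := monicP mT; rewrite lead_coefE sT /= => ->.
  by rewrite subrr.
have su' l : size (ZtoR (u l)) = l.+1 by rewrite size_ZtoR.
have cu l : (ZtoR (u l))`_l = ((u l)`_l)%:~R by rewrite coef_map.
have [h [r [sh r01 gE]]] := triangular_rounding su' su cu sg.
(* Makes the constant coefficient of [h + kap] odd, so that of [P] is 2 modulo 4, as Eisenstein's
   criterion at 2 demands. *)
pose kap : int := if (2 %| h`_0)%Z then 1 else 0.
pose P : {poly int} := 'X^(n.+1) + (2 : int) *: (h + kap%:P).
have shk : (size ((2 : int) *: (h + kap%:P))%R <= n.+1)%N.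
  rewrite (leq_trans (size_scale_leq _ _))// (leq_trans (size_polyD _ _))//.
  by rewrite geq_max sh (leq_trans (size_polyC_leq1 _)).
have sP : size P = n.+2 by rewrite size_polyDl size_polyXn.
have mP : P \is monic.
  by rewrite monicE lead_coefE sP coefD coefXn eqxx nth_default ?addr0.
have PT : ZtoR P - T = (2 * kap%:~R)%:P - 2 *: \sum_(l < n.+1) r l *: ZtoR (u l).
  have -> : \sum_(l < n.+1) r l *: ZtoR (u l) =
      2^-1 *: (T - 'X^(n.+1)) - ZtoR h by rewrite gE addrAC subrr add0r.
  have -> : ZtoR P = 'X^(n.+1) + 2%:R *: (ZtoR h + (kap%:~R)%:P).
    rewrite /P raddfD/= map_polyXn map_polyZ [map_poly _ (h + _)]raddfD/= map_polyC/=.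
    by [].
  rewrite scalerBr scalerA divff// scale1r scalerDr polyCM mul_polyC.
  by ring.
have kap01 : `|kap%:~R : R| <= 1 by rewrite /kap; case: ifP; rewrite ?normr1 ?normr0.
have rn l : `|r l| <= 1 by have /andP[? ?] := r01 l; rewrite ger0_norm// ltW.
exists P; split=> //.
- apply: (@eisenstein_crit 2) => //.
  + by rewrite sP.
  + by rewrite (monicP mP).
  + rewrite coefD coefXn/= add0r coefZ coefD coefC/=.
    rewrite -[_ \in _]/((2 ^+ 2 : int) %| _)%Z expr2 dvdz_mul2l//.
    rewrite /kap; case: ifP => [e|/negbT]; last by rewrite addr0.
    by apply/negP => e1; have := rpredB e1 e; rewrite addrAC subrr add0r.
  + move=> i; rewrite sP /= => iN; rewrite coefD coefXn ltn_eqF// add0r coefZ.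
    exact: dvdz_mulr.
- move=> z; rewrite PT (le_trans (pabsB_le _ _ _))// pabsZ.
  have -> : Num.max 1 (pabs F z / rho) ^+ k = omega F m rho z ^+ n.
    by rewrite exprM omegaX.
  have on1 : 1 <= omega F m rho z ^+ n by rewrite exprn_ege1.
  apply: (@le_trans _ _ (2 * omega F m rho z ^+ n +
      2 * (n.+1%:R * (C0 ^+ d * omega F m rho z ^+ n)))).
    apply: lerD.
      rewrite /pabs map_polyC hornerC cabs_real normrM ger0_norm//.
      by rewrite ler_pM// (le_trans kap01).
    rewrite ger0_norm// ler_wpM2l// (le_trans (pabs_sum _ _ _ _))//.
    rewrite -[n.+1 in leRHS]card_ord mulr_natl -sumr_const ler_sum// => l _.
    rewrite pabsZ -[leRHS]mul1r ler_pM ?pabs_ge0//.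
    rewrite (le_trans (ul _ _))// ler_wpM2l ?exprn_ge0//.
    by rewrite ler_weXn2l// -ltnS.
  rewrite !mulrA -mulrDl ler_wpM2r ?exprn_ge0// [leRHS]mulrDl lerD//.
    by rewrite ler_peMr// ler1n.
  rewrite [leRHS]mulrAC ler_wpM2r ?exprn_ge0// -mulrA ler_wpM2l// -natrM ler_nat.
  exact: ltn_mul (ltnSn m) (ltnSn k).
- rewrite PT coefB coefC gtn_eqF// sub0r normrN coefZ big_ord_recr/=.
  rewrite coefD nth_default ?add0r; last first.
    apply: (leq_trans (size_sum _ _ _)); apply/bigmax_leqP => i _.
    by rewrite (leq_trans (size_scale_leq _ _))// size_ZtoR su.
  rewrite coefZ coef_map /= !normrM ger0_norm//.
  have -> : (u n)`_n = (f`_d) ^+ (n %/ d).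
    have := lead_coefE (u n); rewrite su /= => <-.
    by rewrite /u lead_coefM lead_coefXn mul1r lead_coef_exp lead_coefE sf.
  have lu : `|(f`_d ^+ (n %/ d))%:~R : R| <= rho ^- k.
    rewrite rmorphXn/= normrX.
    apply: (@le_trans _ _ ((rho ^- (d %/ m)) ^+ (n %/ d))).
      apply: lerXn2r; rewrite ?nnegrE ?invr_ge0 ?exprn_ge0 ?(ltW r0)//.
      by rewrite (le_trans _ fl)// intr_norm.
    rewrite exprVn -exprM lef_pV2 ?posrE ?exprn_gt0//.
    rewrite ler_wiXn2l ?(ltW r0) ?(ltW r1)//.
    (* Rounding down twice is harmless: [m * (d %/ m) * (n %/ d)] is at most [d * (n %/ d)], hence
       at most [n = m * k]. *)
    rewrite -(leq_pmul2l m0) -/n mulnA [(m * _)%N]mulnC.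
    by rewrite (leq_trans _ (leq_trunc_div n d))// mulnC leq_mul2l leq_trunc_div orbT.
  apply: (@le_trans _ _ (2 * rho ^- k)).
    by rewrite ler_wpM2l// -[leRHS]mul1r ler_pM.
  by rewrite ler_wpM2r ?invr_ge0 ?exprn_ge0 ?(ltW r0)// lerDl !mulr_ge0// exprn_ge0.
Qed.

End IntegerApproximation.

(** * Roots of the integer approximation of [(X + B) F ^ k] *)

Section Roots.
Context {R : realType}.
Implicit Types (F T : {poly R}) (z : R[i]).

Local Notation ZtoR := (map_poly (intr : int -> R)).
Local Notation ZtoC := (map_poly (intr : int -> R[i])).
Local Notation RtoC := (map_poly (real_complex R)).

(* The sum of the roots distinguishes how many of them are close to [- B]. *)
Lemma one_far_root (rs : seq R[i]) (far : pred R[i]) (B s r D : R) :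
  0 <= s -> 0 <= r -> 0 < B ->
  (forall x, x \in rs -> if far x then cabs (x + B%:C) <= s else cabs x <= r) ->
  cabs (\sum_(x <- rs) x + B%:C) <= D ->
  (size rs)%:R * (s + r) + D < B -> count far rs = 1%N.
Proof.
move=> s0 r0 B0 rsP sD lt_B.
have H : cabs (\sum_(x <- rs) (x + (far x)%:R * B%:C)) <= (size rs)%:R * (s + r).
  have -> : (size rs)%:R * (s + r) = \sum_(x <- rs) (s + r).
    by rewrite big_const_seq count_predT iter_addr addr0 mulr_natl.
  apply: (le_trans (cabs_sum _ _ _)); rewrite !big_seq; apply: ler_sum => x xr.
  have := rsP x xr; case: (far x); rewrite ?mul1r ?mul0r ?addr0 => ?; lra.
move: H; rewrite big_split/= -mulr_suml.
have -> : \sum_(x <- rs) (far x)%:R = (count far rs)%:R :> R[i].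
  by rewrite -natr_sum -sum1_count [in RHS]big_mkcond/=; congr (_%:R); apply: eq_bigr => x _; case: far.
set c := count far rs => H.
(* Once this is below [B], the integer [c - 1] has absolute value below 1 and vanishes. *)
have : cabs ((c%:R - 1) * B%:C) <= (size rs)%:R * (s + r) + D.
  rewrite (_ : _ * _ = (\sum_(x <- rs) x + c%:R * B%:C) - (\sum_(x <- rs) x + B%:C)); last by ring.
  by rewrite (le_trans (cabsB _ _))// lerD.
move=> /le_lt_trans/(_ lt_B); rewrite cabsM cabs_real (gtr0_norm B0).
rewrite -[ltRHS]mul1r ltr_pM2r//.
have -> : c%:R - 1 = (c%:Z - 1)%:~R :> R[i] by rewrite intrB -pmulrn.
rewrite cabs_int -intr_norm (ltr_int _ _ 1) => h.
have {}h : `|c%:Z - 1| < 0 + 1 by rewrite add0r.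
by move: h; rewrite ltzD1 normr_le0 subr_eq0 => /eqP[].
Qed.

(** Gauss's lemma carries irreducibility to the rationals, where characteristic zero makes the
    polynomial separable. *)
Lemma irreducible_uniq_roots (P : {poly int}) (rs : seq R[i]) :
  irreducible_poly P -> ZtoC P = \prod_(x <- rs) ('X - x%:P) -> uniq rs.
Proof.
move=> irP PE; rewrite -separable_prod_XsubC -PE.
have irQ := irreducible_rat_int P; have {}irQ := proj2 irQ irP.
have -> : ZtoC P = map_poly (ratr : rat -> R[i]) (map_poly intr P).
  rewrite -map_poly_comp; apply: eq_map_poly => a /=; by rewrite ratr_int.
rewrite separable_map separable_poly.unlock irreducible_poly_coprime// gtNdvdp//.
  rewrite -size_poly_eq0 polyorder.size_deriv.
  by case: irQ => + _; case: (size _) => [|[]].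
by rewrite lt_size_deriv// -size_poly_eq0; case: irQ => + _; case: (size _).
Qed.

(** Outside the lemniscate the approximation error is at most [s * pabs F ^ k], while [T] has
    modulus [cabs (y + B) * pabs F ^ k]. The common factor cancels, so [P] can vanish there only
    within [s] of [- B]; elsewhere [P] is comparable to [T], which bounds the product of distances
    from below. *)
Lemma algebraic_integers_from_lemniscate (F : {poly R}) m (Zs : seq R[i]) (v r Y e : R) N0 :
  RtoC F = \prod_(x <- Zs) ('X - x%:P) -> size Zs = m -> (0 < m)%N -> 0 < v -> 0 < e ->
  1 <= r -> (forall x, x \in Zs -> cabs x <= r) ->
  (forall y, pabs F y <= expR (- (v * m%:R)) -> cabs y <= r) ->
  exists (P : {poly int}) (zeta : R[i]) (xs : seq R[i]),
  [/\ P \is monic, irreducible_poly P,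
      ZtoC P = \prod_(x <- zeta :: xs) ('X - x%:P), (N0 <= size xs)%N &
  [/\ forall x, x \in xs -> pabs F x <= expR (- (v * m%:R)),
      expR (v * (size xs)%:R) <= cabs zeta,
      cabs zeta <= expR ((v + e) * (size xs)%:R) &
      forall y, cabs y <= Y -> expR (- (v * m%:R)) < pabs F y ->
        expR (- ((v + e) * (size xs)%:R)) <= \prod_(x <- xs) cabs (y - x)]].
Proof.
move=> FE sZ m0 v0 e0 r1 Zr lemr; set rho := expR (- (v * m%:R)).
have r0 : 0 <= r by rewrite (le_trans ler01).
have mR : 0 < m%:R :> R by rewrite ltr0n.
have rho01 : 0 < rho < 1 by rewrite expR_gt0 expR_lt1 oppr_lt0 mulr_gt0.
have /andP[rho0 rho1] := rho01.
have sF : size F = m.+1.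
  by rewrite -(size_map_poly (real_complex R)) FE size_prod_XsubC sZ.
have mF : F \is monic.
  by rewrite -(map_monic (real_complex R)) FE monic_prod_XsubC.
have r2 : 1 <= 2 * r by lra.
have [C C1 HC] := @integer_approximation R F m rho (2 * r) mF sF m0 rho01
  r2 (fun z => @omega_bound R F m rho m0 rho01 r Zs z sZ FE Zr r1).
(* Gathers the constants of three later estimates: the upper bound of [cabs zeta],
   [cabs y <= rho ^- k], and the loss of a factor 3 in the product of distances. *)
pose A := 8 * C * r * (m%:R + 2) + 3 + `|Y|.
have [k1 k1P] := @poly_le_exp R A (e * m%:R) (mulr_gt0 e0 mR).
have [k2 k2P] := @poly_le_exp R A (v * m%:R) (mulr_gt0 v0 mR).
set k := maxn (maxn k1 k2) N0.+1.
have {}k1P := k1P k (leq_trans (leq_maxl _ _) (leq_maxl _ _)).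
have {}k2P := k2P k (leq_trans (leq_maxr _ _) (leq_maxl _ _)).
have kN : (N0 < k)%N by rewrite leq_maxr.
have k0 : (0 < k)%N by rewrite (leq_ltn_trans _ kN).
set n := (m * k)%N; set K : R := k.+1%:R.
have K1 : 1 <= K by rewrite ler1n.
have nE : m%:R * k%:R = n%:R :> R by rewrite natrM.
rewrite -mulrA nE in k1P; rewrite -mulrA nE in k2P.
have rhok : rho ^- k = expR (v * n%:R).
  by rewrite -expRM_natr -expRN mulNr opprK -mulrA nE.
pose s := C * K * rho ^- k; pose N := (n.+1)%:R : R.
(* Large enough for [one_far_root], yet only a polynomial in [k] times [rho ^- k], which keeps
   [cabs zeta] below [exp ((v + e) n)]. *)
pose B := s * (4 * (N + 1) * r).
have Cge0 : 0 <= C by rewrite (le_trans ler01).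
have rk1 : 1 <= rho ^- k by rewrite rhok -[leLHS]expR0 ler_expR mulr_ge0// ltW.
have srk : rho ^- k <= s.
  rewrite ler_peMl ?(le_trans ler01)//; nra.
have s1 : 1 <= s by rewrite (le_trans rk1).
have N1 : 1 <= N by rewrite ler1n.
have NK : N + 1 <= (m%:R + 2) * K.
  have : (n.+1 + 1 <= (m + 2) * k.+1)%N.
    rewrite /n mulnDl mulnS addn1 -[X in (X <= _)%N]addn2 [(m + _)%N]addnC -addnA leq_add2l.
    by rewrite (leq_trans _ (leq_addl _ _))// leq_pmulr.
  by rewrite -(ler_nat R) natrD natrM natrD.
pose T := ('X + B%:P) * F ^+ k.
have B8 : 8 * s <= B by rewrite /B mulrC ler_pM2l ?(lt_le_trans ltr01)//; nra.
have B0 : 0 < B by lra.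
have mT : T \is monic by rewrite monicMr ?monic_exp// -(opprK B) polyCN monicXsubC.
have sT : size T = n.+2.
  rewrite size_monicM ?monic_neq0 ?monic_exp ?size_XaddC//; last first.
    by rewrite -(opprK B) polyCN monicXsubC.
  rewrite -(prednK (_ : 0 < size (F ^+ _))%N); last first.
    by rewrite lt0n size_poly_eq0 monic_neq0// monic_exp.
  by rewrite size_exp sF.
have [P [mP sP irP PT cPT]] := HC k T k0 mT sT.
have [rs PE] := closed_field_poly_normal (ZtoC P).
have lP : lead_coef (ZtoC P) = 1.
  by rewrite lead_coef_map_inj ?rmorph0 ?(monicP mP)//; exact: intr_inj.
rewrite lP scale1r in PE.
have srs : size rs = n.+1.
  have := size_prod_XsubC rs id; rewrite -PE size_map_inj_poly ?rmorph0// ?sP; last exact: intr_inj.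
  by case.
have Teval y : pabs T y = cabs (y + B%:C) * pabs F y ^+ k.
  rewrite /T pabsM pabsX; congr (_ * _).
  by rewrite /pabs rmorphD/= map_polyX map_polyC hornerD hornerX hornerC.
have Peval y : pabs (ZtoR P) y = \prod_(x <- rs) cabs (y - x).
  rewrite /pabs RtoC_ZtoR PE horner_prod cabs_prod; apply: eq_bigr => x _.
  by rewrite hornerXsubC.
have out y : rho < pabs F y ->
    C * K * Num.max 1 (pabs F y / rho) ^+ k = s * pabs F y ^+ k.
  move=> Fy; rewrite max_r; last by rewrite ler_pdivlMr// mul1r ltW.
  by rewrite exprMn exprVn /s; ring.
pose far x := rho < pabs F x.
have farP x : x \in rs -> if far x then cabs (x + B%:C) <= s else cabs x <= r.
  move=> xr; case: ifPn => [fx|]; last by rewrite -leNgt => /lemr.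
  have := PT x; rewrite out// => H.
  have Px0 : pabs (ZtoR P - T) x = pabs T x.
    rewrite /pabs rmorphB/= hornerD hornerN RtoC_ZtoR; have := root_prod_XsubC rs x.
    by rewrite -PE xr => /eqP ->; rewrite sub0r cabsN.
  move: H; rewrite Px0 Teval ler_pM2r// exprn_gt0//; exact: lt_trans fx.
(* The coefficients of degree [n] of [P] and [T] are minus the sums of their roots; this is the use
   of the coefficient bound in [integer_approximation]. *)
have sumD : cabs (\sum_(x <- rs) x + B%:C) <= s + n%:R * r.
  pose ts := (- B%:C) :: flatten (nseq k Zs).
  have TE : RtoC T = \prod_(x <- ts) ('X - x%:P).
    rewrite /T rmorphM rmorphXn/= rmorphD/= map_polyX map_polyC FE big_cons polyCN opprK.
    congr (_ * _); rewrite big_flatten big_nseq /=.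
    by rewrite -iter_mulr_1.
  have sts : size ts = n.+1.
    by rewrite /= size_flatten /shape map_nseq sumn_nseq sZ.
  have cP : (ZtoC P)`_n = - \sum_(x <- rs) x.
    by rewrite PE -[n]/(n.+1.-1) -srs coefPn_prod_XsubC// srs.
  have cT : (RtoC T)`_n = - \sum_(x <- ts) x.
    by rewrite TE -[n]/(n.+1.-1) -sts coefPn_prod_XsubC// sts.
  have sumZ : cabs (\sum_(x <- flatten (nseq k Zs)) x) <= n%:R * r.
    rewrite (le_trans (cabs_sum _ _ _))// big_seq.
    apply: (@le_trans _ _ (\sum_(x <- flatten (nseq k Zs) | x \in flatten (nseq k Zs)) r)).
      apply: ler_sum => x /flattenP[q]; rewrite mem_nseq => /andP[_ /eqP ->]; exact: Zr.
    move: sts => /= [<-].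
    by rewrite -big_seq big_const_seq count_predT iter_addr addr0 mulr_natl.
  have -> : \sum_(x <- rs) x + B%:C =
      - (RtoC (ZtoR P - T))`_n + \sum_(x <- flatten (nseq k Zs)) x.
    rewrite rmorphB/= coefB RtoC_ZtoR cP cT big_cons; ring.
  rewrite (le_trans (cabsD _ _))// lerD// cabsN coef_map cabs_real (le_trans cPT)//.
  by rewrite /s -mulrA ler_wpM2l// ler_peMl// (le_trans ler01).
have cnt : count far rs = 1%N.
  apply: (one_far_root _ r0 B0 farP sumD); first by rewrite (le_trans ler01).
  rewrite srs -/N; have nN : n%:R = N - 1 :> R by rewrite /N -natr1 addrK.
  rewrite nN /B; have : 0 <= (s - 1) * r by rewrite mulr_ge0// subr_ge0.
  have : 0 <= s * (r - 1) by rewrite mulr_ge0 ?subr_ge0// (le_trans ler01).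
  have : 0 < s * r by rewrite mulr_gt0 ?(lt_le_trans ltr01).
  set sr := s * r => sr0 h1 h2.
  have -> : s * (4 * (N + 1) * r) = 4 * (N + 1) * sr by rewrite /sr; ring.
  have h3 : s + r <= 2 * sr by rewrite /sr; nra.
  have : N * (s + r) <= N * (2 * sr) by rewrite ler_wpM2l// (le_trans ler01).
  have : (N - 1) * r <= (N - 1) * sr by rewrite ler_wpM2l ?subr_ge0// /sr; nra.
  rewrite /sr in h1 h2 h3 sr0 *; nra.
have [zeta zE] : exists zeta, [seq x <- rs | far x] = [:: zeta].
  by move: cnt; rewrite -size_filter; case: seq.filter => [|x []]// _; exists x.
set xs := [seq x <- rs | ~~ far x].
have prs : perm_eq (zeta :: xs) rs.
  by rewrite -[zeta :: xs]/([:: zeta] ++ xs) -zE perm_filterC.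
have sxs : size xs = n by have /= := perm_size prs; rewrite srs => -[].
have zfar : far zeta && (zeta \in rs).
  by rewrite -(mem_filter far) zE mem_head.
have /andP[zf zr] := zfar.
have := farP _ zr; rewrite zf => zB.
have z_ub : cabs zeta <= 2 * B.
  have := cabsB (zeta + B%:C) B%:C; rewrite addrK cabs_real (gtr0_norm B0); lra.
have z_lb : B / 2 <= cabs zeta.
  have := cabsB (zeta + B%:C) zeta; rewrite addrAC subrr add0r cabs_real (gtr0_norm B0); lra.
have nR : 0 <= n%:R :> R by [].
have K4 j : (j <= 4)%N -> K ^+ j <= K ^+ 4 by move=> j4; rewrite ler_weXn2l.
have A0 : 0 <= A by rewrite /A !addr_ge0// !mulr_ge0 ?addr_ge0.
exists P, zeta, xs; split=> //.
- by rewrite PE; apply: perm_big; rewrite perm_sym.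
- by rewrite sxs /n (leq_trans (ltnW kN))// leq_pmull.
split.
- by move=> x; rewrite mem_filter /= -leNgt => /andP[].
- by rewrite sxs -rhok; lra.
- rewrite sxs (le_trans z_ub)// [(v + e) * _]mulrDl expRD -rhok.
  rewrite /B /s.
  have -> : 2 * (C * K * rho ^- k * (4 * (N + 1) * r)) =
    rho ^- k * (8 * C * K * (N + 1) * r) by ring.
  rewrite ler_wpM2l ?(le_trans ler01 rk1)// (le_trans _ k1P)//.
  apply: (@le_trans _ _ (8 * C * r * (m%:R + 2) * K ^+ 4)).
    have -> : 8 * C * K * (N + 1) * r = 8 * C * r * (K * (N + 1)) by ring.
    rewrite -[leRHS]mulrA ler_wpM2l ?mulr_ge0//.
    apply: (@le_trans _ _ ((m%:R + 2) * K ^+ 2)).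
      by rewrite expr2 [leRHS]mulrCA ler_wpM2l ?(le_trans ler01).
    by rewrite ler_wpM2l ?K4// addr_ge0.
  by rewrite ler_wpM2r ?exprn_ge0 ?(le_trans ler01)// /A -addrA lerDl addr_ge0.
- move=> y yY Fy; rewrite sxs.
  have YB : cabs y <= rho ^- k.
    rewrite (le_trans yY)// rhok (le_trans _ k2P)// (le_trans (ler_norm _))//.
    have K41 : 1 <= K ^+ 4 by rewrite exprn_ege1.
    apply: (@le_trans _ _ A); last by rewrite ler_peMr.
    by rewrite /A lerDr addr_ge0// !mulr_ge0 ?addr_ge0.
  have yB : B - cabs y <= cabs (y + B%:C).
    have := cabsB (y + B%:C) y; rewrite addrAC subrr add0r cabs_real (gtr0_norm B0); lra.
  have yz : cabs (y - zeta) <= cabs (y + B%:C) + s.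
    have := cabsB (y + B%:C) (zeta + B%:C).
    rewrite (_ : y + B%:C - (zeta + B%:C) = y - zeta); last by ring.
    lra.
  have Py : pabs F y ^+ k * (cabs (y + B%:C) - s) <= pabs (ZtoR P) y.
    have := PT y; rewrite out//; have := pabsB_le (ZtoR P) (ZtoR P - T) y.
    rewrite opprB addrCA subrr addr0 Teval; lra.
  move: Py; rewrite Peval -(perm_big _ prs)/= big_cons => Py.
  set Pi := \prod_(x <- xs) _ in Py *.
  have Pi0 : 0 <= Pi by apply: prodr_ge0.
  have Fk : rho ^+ k <= pabs F y ^+ k.
    by apply: lerXn2r; rewrite ?nnegrE ?pabs_ge0 ?(ltW rho0)// ltW.
  have rk0 : 0 < rho ^+ k by rewrite exprn_gt0.
  (* Dividing by the far factor [cabs (y - zeta) <= q + s] costs a factor 3 at most, because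
     [q >= B - cabs y >= 7 * s] makes [q + s <= 3 * (q - s)]. *)
  have three : rho ^+ k <= 3 * Pi.
    have q0 : 0 < cabs (y + B%:C) + s by lra.
    rewrite -(ler_pM2r q0); set q := cabs (y + B%:C) in yB yz Py q0 *.
    have : rho ^+ k * (3 * (q - s)) <= pabs F y ^+ k * (3 * (q - s)).
      rewrite ler_wpM2r//; lra.
    have : cabs (y - zeta) * Pi <= (q + s) * Pi by rewrite ler_wpM2r.
    have : rho ^+ k * (q + s) <= rho ^+ k * (3 * (q - s)) by rewrite ler_wpM2l ?(ltW rk0)//; lra.
    lra.
  have -> : expR (- ((v + e) * n%:R)) = rho ^+ k * expR (- (e * n%:R)).
    by rewrite -[rho ^+ k]invrK rhok -!expRN -expRD; congr expR; ring.
  have : 3 <= expR (e * n%:R).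
    rewrite (le_trans _ k1P)// (@le_trans _ _ A)//; last by rewrite ler_peMr// exprn_ege1.
    have : 0 <= 8 * C * r * (m%:R + 2) by rewrite !mulr_ge0// addr_ge0.
    by have := normr_ge0 Y; rewrite /A; lra.
  rewrite expRN => e3; rewrite ler_pdivrMr ?expR_gt0//; nra.
Qed.

End Roots.

(** * Fekete points and lemniscates close to a compact set *)

Section Fekete.
Context {R : realType}.
Implicit Types (z w y : R[i]) (zs : seq R[i]) (K : set R[i]).

Local Notation RtoC := (map_poly (real_complex R)).

Fixpoint vandermonde zs : R :=
  if zs is z :: s then (\prod_(w <- s) cabs (z - w)) * vandermonde s else 1.

Lemma vandermonde_ge0 zs : 0 <= vandermonde zs.
Proof. by elim: zs => //= z s IH; rewrite mulr_ge0// prodr_ge0. Qed.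

Lemma vandermonde_rem zs z : z \in zs ->
  vandermonde zs = (\prod_(w <- rem z zs) cabs (z - w)) * vandermonde (rem z zs).
Proof.
elim: zs => // y s IH; rewrite inE /=; have [<- //|zy /= zs] := eqVneq z y.
rewrite IH//= big_cons (perm_big _ (perm_to_rem zs))/= big_cons.
by rewrite (cabs_distC y z); ring.
Qed.

Lemma vandermonde_uniq zs : vandermonde zs != 0 -> uniq zs.
Proof.
elim: zs => //= z s IH; rewrite mulf_eq0 negb_or => /andP[h /IH ->].
rewrite andbT; apply: contra h => zs; rewrite (perm_big _ (perm_to_rem zs))/= big_cons.
by rewrite subrr cabs0 mul0r.
Qed.

Lemma vandermonde_le (M : R) zs : 1 <= M ->
  (forall z w, z \in zs -> w \in zs -> cabs (z - w) <= M) ->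
  vandermonde zs <= M ^+ (size zs * size zs).
Proof.
move=> M1; elim: zs => [|z s IH] H /=; first by rewrite expr0.
have M0 : 0 <= M by rewrite (le_trans ler01).
apply: (@le_trans _ _ (M ^+ size s * M ^+ (size s * size s))).
  apply: ler_pM; rewrite ?vandermonde_ge0 ?prodr_ge0//.
    have -> : M ^+ size s = \prod_(w <- s) M.
      by rewrite big_const_seq count_predT iter_mulr_1.
    rewrite !big_seq; apply: ler_prod => w ws; rewrite cabs_ge0/=.
    by apply: H; rewrite !inE ?eqxx// ws orbT.
  by apply: IH => x y xs ys; apply: H; rewrite inE ?xs ?ys orbT.
by rewrite -exprD ler_weXn2l//; nia.
Qed.

(** Lagrange interpolation reproduces the constant 1: the difference has degree below the number of
    nodes and vanishes at each of them. *)
Lemma lagrange_partition zs y : uniq zs -> zs != [::] ->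
  \sum_(z <- zs) \prod_(w <- rem z zs) ((y - w) / (z - w)) = 1.
Proof.
move=> uzs zs0.
pose q : {poly R[i]} := \sum_(z <- zs)
  (\prod_(w <- rem z zs) (z - w))^-1 *: \prod_(w <- rem z zs) ('X - w%:P).
have ev x : q.[x] = \sum_(z <- zs) \prod_(w <- rem z zs) ((x - w) / (z - w)).
  rewrite /q horner_sum; apply: eq_bigr => z _.
  rewrite hornerZ horner_prod mulrC prodf_div; congr (_ / _).
  by apply: eq_bigr => w _; rewrite hornerXsubC.
suff q1 : q - 1 = 0 by rewrite -ev -(subrK 1 q) q1 add0r hornerC.
apply: (@roots_geq_poly_eq0 _ _ zs) => //.
  apply/allP => x xs; rewrite rootE hornerD hornerN hornerC ev subr_eq0.
  rewrite (perm_big _ (perm_to_rem xs))/= big_cons [X in _ + X]big1_seq ?addr0.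
    rewrite big1_seq// => w /=; rewrite mem_rem_uniq// inE => /andP[wx _].
    by rewrite divff// subr_eq0 eq_sym.
  move=> z /=; rewrite mem_rem_uniq// inE => /andP[zx zs'].
  have xr : x \in rem z zs by rewrite mem_rem_uniq// inE eq_sym zx.
  by rewrite (perm_big _ (perm_to_rem xr))/= big_cons subrr mul0r mul0r.
have szs : (0 < size zs)%N by rewrite lt0n size_eq0.
rewrite (leq_trans (size_polyD _ _))// geq_max size_polyN size_poly1 szs andbT.
rewrite /q; apply: (leq_trans (size_sum _ _ _)); apply/bigmax_leqP_seq => z zzs _.
by rewrite (leq_trans (size_scale_leq _ _))// size_prod_XsubC size_rem// prednK.
Qed.

(** The Lagrange basis polynomials sum to 1 at [y], and each has modulus at most [G / (eta * D)],
    where [G] is the product to be bounded. *)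
Lemma dist_prod_ge zs y (eta D : R) : uniq zs -> zs != [::] -> 0 < eta -> 0 < D ->
  (forall z, z \in zs -> eta <= cabs (y - z)) ->
  (forall z, z \in zs -> D <= \prod_(w <- rem z zs) cabs (z - w)) ->
  eta * D / (size zs)%:R <= \prod_(w <- zs) cabs (y - w).
Proof.
move=> uzs zs0 eta0 D0 yz Dz.
have szs : 0 < (size zs)%:R :> R by rewrite ltr0n lt0n size_eq0.
rewrite ler_pdivrMr//; set G := \prod_(w <- zs) _.
have G0 : 0 <= G by apply: prodr_ge0.
have := cabs_sum zs predT (fun z => \prod_(w <- rem z zs) ((y - w) / (z - w))).
rewrite lagrange_partition// cabs1 => H.
have : 1 <= \sum_(z <- zs) G / (eta * D).
  apply: (le_trans H); rewrite !big_seq; apply: ler_sum => z zzs.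
  rewrite cabs_prod; under eq_bigr do rewrite cabsM cabsV.
  rewrite prodf_div.
  have -> : G = cabs (y - z) * \prod_(w <- rem z zs) cabs (y - w).
    by rewrite /G (perm_big _ (perm_to_rem zzs))/= big_cons.
  set P := \prod_(w <- rem z zs) cabs (y - w); set Q := \prod_(w <- _) _.
  have P0 : 0 <= P by apply: prodr_ge0.
  have DQ : D <= Q by apply: Dz.
  have Q0 : 0 < Q by apply: lt_le_trans DQ.
  rewrite ler_pdivrMr// mulrAC ler_pdivlMr ?mulr_gt0//.
  have -> : P * (eta * D) = eta * (P * D) by ring.
  rewrite -mulrA; apply: ler_pM; rewrite ?mulr_ge0 ?(ltW eta0) ?(ltW D0)//.
    exact: yz.
  by rewrite ler_wpM2l.
have -> : \sum_(z <- zs) G / (eta * D) = G * (size zs)%:R / (eta * D).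
  by rewrite big_const_seq count_predT iter_addr addr0 mulrAC [RHS]mulr_natr.
by rewrite ler_pdivlMr ?mulr_gt0// mul1r.
Qed.

(** If the ratio of consecutive suprema were below [exp (- (V + e) p)] for all [p >= p0], the
    suprema would decay too fast for the hypothesis, since these exponents add up to
    [(V + e) 'C(p, 2)] up to a constant. At a good [p], deleting a point of a near-maximizer with
    [p + 1] points leaves a competitor for [p] points, which bounds the product of distances from
    the deleted point. *)
Lemma fekete_points K (V e : R) p0 : compact K -> 0 < e ->
  (forall p e', 0 < e' -> exists zs, [/\ size zs = p, forall z, z \in zs -> K z &
     expR (- ((V + e') * 'C(p, 2)%:R)) <= vandermonde zs]) ->
  exists p zs, [/\ (p0 <= p)%N, size zs = p.+1, uniq zs, forall z, z \in zs -> K z &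
    forall z, z \in zs ->
      expR (- ((V + e) * p%:R)) / 2 <= \prod_(w <- rem z zs) cabs (z - w)].
Proof.
move=> cK e0 pts; have [r r0 rK] := compact_cabs_bounded cK.
pose S p := [set vandermonde zs | zs in
  [set zs | size zs = p /\ forall z, z \in zs -> K z]].
have supS p : has_sup (S p).
  split.
    by have [zs [szs zsK _]] := pts p 1 ltr01; exists (vandermonde zs), zs.
  exists ((1 + 2 * r) ^+ (p * p)) => _ [zs [<- zsK] <-].
  apply: vandermonde_le => [|z w zz wz]; first lra.
  have := cabsB z w; have := rK _ (zsK _ zz); have := rK _ (zsK _ wz); lra.
have S_ub zs : (forall z, z \in zs -> K z) -> vandermonde zs <= sup (S (size zs)).
  by move=> zK; apply: ub_le_sup; [case: (supS (size zs))|exists zs].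
have Slb p e' : 0 < e' -> expR (- ((V + e') * 'C(p, 2)%:R)) <= sup (S p).
  move=> e'0; have [zs [szs zK vz]] := pts p e' e'0.
  by rewrite (le_trans vz)// -szs S_ub.
have S0 p : 0 < sup (S p) by rewrite (lt_le_trans _ (Slb p 1 ltr01))// expR_gt0.
have [[p [pp0 Vp]]|noV] := pselect (exists p, (p0 <= p)%N /\
    expR (- ((V + e) * p%:R)) * sup (S p) <= sup (S p.+1)).
  have [_ [zs [szs zK] <-] vz] := @sup_adherent _ (S p.+1) (sup (S p.+1) / 2)
    (divr_gt0 (S0 _) (ltr0n _ 2)) (supS _).
  exists p, zs; split=> //.
    apply: vandermonde_uniq; apply: lt0r_neq0; apply: lt_trans vz.
    by have := S0 p.+1; lra.
  move=> z zzs; have := vandermonde_rem zzs; set Q := \prod_(w <- _) _ => vE.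
  have Q0 : 0 <= Q by apply: prodr_ge0.
  have : vandermonde (rem z zs) <= sup (S p).
    have := S_ub (rem z zs); rewrite size_rem// szs /=; apply.
    by move=> w /mem_rem; exact: zK.
  move=> /(ler_wpM2l Q0); rewrite -vE => h.
  rewrite -(ler_pM2r (S0 p)); lra.
exfalso.
have dec j : sup (S (p0 + j)%N) * expR ((V + e) * 'C(p0 + j, 2)%:R) <=
    sup (S p0) * expR ((V + e) * 'C(p0, 2)%:R).
  elim: j => [|j IH]; first by rewrite addn0.
  apply: le_trans IH; rewrite addnS binS bin1 natrD mulrDr expRD mulrA.
  rewrite mulrAC ler_wpM2r ?expR_ge0//.
  rewrite -ler_pdivlMr ?expR_gt0// -expRN mulrC leNgt; apply/negP => h.
  by apply: noV; exists (p0 + j)%N; rewrite leq_addr ltW.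
set W := sup (S p0) * _ in dec.
(* Gives ['C(p0 + j, 2) >= j - 1 > 2 * W / e], so that [exp (e / 2 * 'C(p0 + j, 2))] exceeds [W]. *)
pose j := (Num.truncn (W * 2 / e)).+2.
have W0 : 0 <= W by rewrite mulr_ge0 ?expR_ge0 ?(ltW (S0 _)).
have := dec j; apply/negP; rewrite -ltNge.
have := Slb (p0 + j)%N (e / 2) (divr_gt0 e0 (ltr0n _ 2)).
move=> /(ler_wpM2r (expR_ge0 ((V + e) * 'C(p0 + j, 2)%:R))).
apply: lt_le_trans; rewrite -expRD.
have -> : - ((V + e / 2) * 'C(p0 + j, 2)%:R) + (V + e) * 'C(p0 + j, 2)%:R =
  e / 2 * 'C(p0 + j, 2)%:R by field.
apply: lt_le_trans (expR_ge1Dx _).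
have jC : (j.-1 <= 'C(p0 + j, 2))%N.
  by rewrite /j addnS binS bin1 /=; lia.
have Wj : W * 2 / e < j.-1%:R.
  by have /andP[_] := truncn_itv (divr_ge0 (mulr_ge0 W0 (ler0n _ 2)) (ltW e0)).
have : (j.-1)%:R <= 'C(p0 + j, 2)%:R :> R by rewrite ler_nat.
move: Wj; rewrite ltr_pdivrMr// => Wj /(ler_wpM2r (ltW e0)); lra.
Qed.

(** Fekete points of a symmetric set need not be symmetric; pairing each with its conjugate gives a
    real polynomial. *)
Definition quad_poly (z : R[i]) : {poly R} :=
  'X^2 - (2 * complex.Re z) *: 'X + (complex.Re z ^+ 2 + complex.Im z ^+ 2)%:P.

Lemma quad_polyE z : RtoC (quad_poly z) = ('X - z%:P) * ('X - (z^*)%:P).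
Proof.
rewrite /quad_poly rmorphD rmorphB/= map_polyXn map_polyZ map_polyX map_polyC/=.
have h1 : (2 * complex.Re z)%:C = z + z^*.
  by case: z => a b; rewrite /= ; apply/eqP; rewrite eq_complex /=; apply/andP; split; apply/eqP; ring.
have h2 : (complex.Re z ^+ 2 + complex.Im z ^+ 2)%:C = z * z^*.
  by case: z {h1} => a b; rewrite /= ; apply/eqP; rewrite eq_complex /=; apply/andP; split; apply/eqP; ring.
rewrite h1 h2 -mul_polyC polyCD polyCM; ring.
Qed.

(** One more candidate than there are points of [Zs], spaced by [2 * eta] on a segment from [z]: no
    point of [Zs] is closer than [eta] to two candidates. *)
Lemma far_from_finite (Zs : seq R[i]) z (e : R) : 0 < e ->
  exists2 y, cabs (y - z) <= e &
    forall x, x \in Zs -> e / (2 * (size Zs).+1%:R) <= cabs (y - x).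
Proof.
move=> e0; set m := size Zs; set eta := e / _.
have m0 : 0 < m.+1%:R :> R by rewrite ltr0n.
have eta0 : 0 < eta by rewrite divr_gt0// mulr_gt0.
have em : eta * (2 * m.+1%:R) = e by rewrite divfK// mulf_neq0 ?pnatr_eq0.
clearbody eta.
pose y (j : 'I_m.+1) := z + (2 * eta * j%:R)%:C.
pose near j x := cabs (y j - x) < eta.
have [/existsP[j /hasPn far]|] := boolP [exists j, ~~ has (near j) Zs].
  exists (y j); last by move=> x /far; rewrite /near -leNgt.
  rewrite /y addrAC subrr add0r cabs_real.
  have ej : 0 <= 2 * eta * j%:R by rewrite mulr_ge0// mulr_ge0// ltW.
  rewrite ger0_norm//; have jm : (j%:R : R) <= m.+1%:R by rewrite ler_nat ltnW.
  by rewrite -em; have := ler_wpM2l (ltW eta0) jm; lra.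
move=> /existsPn H; exfalso.
have {}H j : has (near j) Zs by have := H j; rewrite negbK.
pose idx j : 'I_m := Ordinal (etrans (esym (has_find (near j) Zs)) (H j)).
have : ~~ injectiveb idx.
  by apply/negP => /injectiveP/leq_card; rewrite !card_ord ltnn.
move=> /injectivePn[j [j' jj' ij]].
have nj := nth_find 0 (H j); have nj' := nth_find 0 (H j').
have ff : find (near j) Zs = find (near j') Zs by have := congr1 val ij.
rewrite ff in nj; set x := nth _ _ _ in nj nj'.
have := cabsB (y j - x) (y j' - x).
have -> : y j - x - (y j' - x) = (2 * eta * (j%:R - j'%:R))%:C.
  by rewrite /y mulrBr rmorphB; ring.
rewrite cabs_real !normrM (gtr0_norm eta0) (ger0_norm (ler0n _ 2)).
have : 1 <= `|j%:R - j'%:R| :> R.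
  have : ((j : nat)%:Z - (j' : nat)%:Z != 0 :> int) by rewrite subr_eq0 eqz_nat.
  rewrite -normr_gt0 gtz0_ge1 => ss1.
  by rewrite !(pmulrn 1) -intrB -intr_norm (ler_int _ 1).
move: nj nj'; rewrite /near; nra.
Qed.

(** A point at distance at least [eta] from all roots lies outside the lemniscate, by [dist_prod_ge]
    at the point and at its conjugate. Hence the lemniscate stays near [K], and it contains no disc
    of radius [e]. *)
Lemma fekete_lemniscate K (V e : R) : compact K -> [set z^* | z in K] = K ->
  0 <= V -> 0 < e ->
  (forall p e', 0 < e' -> exists zs, [/\ size zs = p, forall z, z \in zs -> K z &
     expR (- ((V + e') * 'C(p, 2)%:R)) <= vandermonde zs]) ->
  exists (F : {poly R}) (Zs : seq R[i]),
  [/\ RtoC F = \prod_(x <- Zs) ('X - x%:P), (0 < size Zs)%N,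
      forall x, x \in Zs -> K x,
      forall y, pabs F y <= expR (- ((V + e) * (size Zs)%:R)) ->
        exists2 x, K x & cabs (y - x) <= e &
      forall z, exists2 y, cabs (y - z) <= e &
        expR (- ((V + e) * (size Zs)%:R)) < pabs F y].
Proof.
move=> cK symK V0 e0 pts.
have e20 : 0 < e / 2 by rewrite divr_gt0.
(* Half of the slack [e] is spent on the Fekete points; the other half must absorb [eta], the number
   of points and a factor 2, all polynomial in [p]. *)
have [p0 p0P] := poly_le_exp (16 / e) e20.
have [p [zs [pp0 szs uzs zsK Dz]]] := fekete_points p0 cK e20 pts.
pose F := \prod_(z <- zs) quad_poly z.
pose Zs := zs ++ [seq z^* | z <- zs].
have FE : RtoC F = \prod_(x <- Zs) ('X - x%:P).
  rewrite /F rmorph_prod big_cat big_map /= -big_split /=.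
  by apply: eq_bigr => z _; rewrite quad_polyE.
have sZ : size Zs = (2 * p.+1)%N by rewrite size_cat size_map szs; lia.
have ZK x : x \in Zs -> K x.
  rewrite mem_cat => /orP[/zsK//|/mapP[z /zsK Kz ->]].
  by rewrite -symK; exists z.
have FY y : pabs F y = (\prod_(z <- zs) cabs (y - z)) * (\prod_(z <- zs) cabs (y^* - z)).
  rewrite /pabs FE horner_prod cabs_prod big_cat big_map; congr (_ * _).
    by apply: eq_bigr => z _; rewrite hornerXsubC.
  apply: eq_bigr => z _; rewrite hornerXsubC -cabs_conj rmorphB/= conjcK.
  by [].
set eta := e / (2 * (size Zs).+1%:R).
have eta0 : 0 < eta by rewrite divr_gt0// mulr_gt0.
have zs0 : zs != [::] by rewrite -size_eq0 szs.
have low y : (forall x, x \in Zs -> eta <= cabs (y - x)) ->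
    expR (- ((V + e) * (size Zs)%:R)) < pabs F y.
  move=> yZ; set D := expR (- ((V + e / 2) * p%:R)) / 2 in Dz.
  have D0 : 0 < D by rewrite divr_gt0// expR_gt0.
  have b1 := dist_prod_ge uzs zs0 eta0 D0 _ Dz.
  have l1 := b1 y (fun z zz => yZ z _).
  have l2 := b1 y^* (fun z zz => _).
  have {}l1 : eta * D / (size zs)%:R <= \prod_(w <- zs) cabs (y - w).
    by apply: b1 => z zz; apply: yZ; rewrite mem_cat zz.
  have {}l2 : eta * D / (size zs)%:R <= \prod_(w <- zs) cabs (y^* - w).
    apply: b1 => z zz; rewrite -cabs_conj rmorphB/= conjcK; apply: yZ.
    by rewrite mem_cat map_f// orbT.
  rewrite FY; have eD0 : 0 < eta * D / (size zs)%:R.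
    by apply: divr_gt0; [exact: mulr_gt0|rewrite szs ltr0n].
  apply: lt_le_trans (ler_pM (ltW eD0) (ltW eD0) l1 l2).
  rewrite -expr2 sZ; have -> : (2 * p.+1)%:R = p.+1%:R * 2 :> R by rewrite natrM mulrC.
  rewrite mulrA -mulNr expRM_natr (@ltr_pXn2r _ 2)// ?nnegrE ?expR_ge0 ?(ltW eD0)//.
  rewrite szs ltr_pdivlMr ?ltr0n//.
  have := p0P p pp0 => pe.
  have -> : expR (- ((V + e) * p.+1%:R)) = D * 2 * (expR (e / 2 * p%:R) * expR (V + e))^-1.
    rewrite /D divfK// -expRD -expRN -expRD -natr1; congr expR; by field.
  set E := expR (e / 2 * p%:R) in pe *; set E' := expR (V + e).
  have E0 : 0 < E by exact: expR_gt0.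
  have E'1 : 1 < E' by rewrite /E' -expR0 ltr_expR ltr_wpDl.
  have -> : D * 2 * (E * E')^-1 * p.+1%:R = D * (2 * p.+1%:R / (E * E')) by ring.
  rewrite [eta * D]mulrC ltr_pM2l// /eta sZ.
  rewrite ltr_pdivrMr ?mulr_gt0 ?expR_gt0//.
  rewrite mulrAC ltr_pdivlMr ?mulr_gt0//.
  have : 16 / e * p.+1%:R ^+ 4 * e <= E * e by rewrite ler_wpM2r// ltW.
  have -> : 16 / e * p.+1%:R ^+ 4 * e = 16 * p.+1%:R ^+ 4 by field; exact: lt0r_neq0.
  move=> h; have P1 : 1 <= p.+1%:R :> R by rewrite ler1n.
  have h2 : e * (E * E') > e * E by rewrite mulrA ltr_pMr// mulr_gt0.
  apply: le_lt_trans h2; rewrite [e * E]mulrC; apply: le_trans h.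
  have -> : (2 * p.+1).+1%:R = 2 * p.+1%:R + 1 :> R by rewrite -natr1 natrM.
  set q := p.+1%:R in P1 *.
  have q2 : q ^+ 2 <= q ^+ 4 by rewrite ler_weXn2l.
  have := q2; rewrite expr2; nra.
exists F, Zs; split=> //.
- by rewrite sZ.
- move=> y yF; have [/allP al|/allPn[x xZ]] := boolP (all (fun x => eta <= cabs (y - x)) Zs).
    by have := low y al; rewrite ltNge yF.
  rewrite -ltNge => xe; exists x; first exact: ZK.
  rewrite (le_trans (ltW xe))// /eta ler_pdivrMr ?mulr_gt0//.
  rewrite ler_peMr ?(ltW e0)//; have : 1 <= (size Zs).+1%:R :> R by rewrite ler1n.
  lra.
- by move=> z; have [y yz yZ] := far_from_finite Zs z e0; exists y => //; exact: low.
Qed.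

End Fekete.

(** * The integer minimal polynomial and the conjugates *)

Section MinimalPolynomial.
Context {R : realType}.
Implicit Types (P q : {poly int}) (a : R[i]) (rs : seq R[i]).

Local Notation ZtoC := (map_poly (intr : int -> R[i])).
Local Notation ZtoQ := (map_poly (intr : int -> rat)).
Local Notation QtoC := (map_poly (ratr : rat -> R[i])).

Lemma QtoC_ZtoQ q : QtoC (ZtoQ q) = ZtoC q.
Proof. by rewrite -map_poly_comp; apply: eq_map_poly => a /=; rewrite ratr_int. Qed.

(** The leading coefficients of two factors multiply to 1, so a constant factor is a unit. *)
Lemma monic_irreducible_elt P : P \is monic -> irreducible_poly P -> irreducible_elt P.
Proof.
move=> mP [sP irP].
have unitP q : size q = 1%N -> (lead_coef q) \is a GRing.unit -> q \is a GRing.unit.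
  by move=> sq; rewrite poly_unitE sq lead_coefE sq.
split; first exact: monic_neq0.
  by rewrite poly_unitE negb_and gtn_eqF.
move=> q r PE; have := monicP mP; rewrite PE lead_coefM => lqr.
have lqU : lead_coef q \is a GRing.unit by apply/unitrPr; exists (lead_coef r).
have lrU : lead_coef r \is a GRing.unit.
  by apply/unitrPr; exists (lead_coef q); rewrite mulrC.
have [/eqP sq|sq] := eqVneq (size q) 1%N; first by left; apply: unitP => //; apply/eqP.
right; apply: unitP => //; have := irP q sq; rewrite PE => /(_ (dvdp_mulr _ (dvdpp q))).
move=> /eqp_size; have q0 : q != 0 by apply: contraTneq lqU => ->; rewrite lead_coef0 unitr0.
have r0 : r != 0 by apply: contraTneq lrU => ->; rewrite lead_coef0 unitr0.
rewrite size_mul//; move: q0 r0; rewrite -!size_poly_eq0; case: (size q) => // j _.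
by case: (size r) => // l _ /=; rewrite addnS /= => /eqP; rewrite -[X in X == _]addn0 eqn_add2l => /eqP <-.
Qed.

(** Division by a monic polynomial stays over the integers. A nonzero remainder has smaller degree,
    hence is coprime to [P] over the rationals and cannot share the root [a]. *)
Lemma irreducible_root_dvd P q a : P \is monic -> irreducible_poly P ->
  root (ZtoC P) a -> root (ZtoC q) a -> exists s, q = s * P.
Proof.
move=> mP irP rP rq; exists (Pdiv.CommonRing.rdivp q P).
have qE := Pdiv.RingMonic.rdivp_eq mP q.
have [r0|r0] := eqVneq (Pdiv.CommonRing.rmodp q P) 0; first by rewrite {1}qE r0 addr0.
exfalso; have rr : root (ZtoC (Pdiv.CommonRing.rmodp q P)) a.
  move: rq; rewrite {1}qE rmorphD rmorphM/= !rootE hornerD hornerM.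
  by move: rP => /eqP ->; rewrite mulr0 add0r.
have /irreducible_rat_int irQ := irP.
have cop : coprimep (ZtoQ P) (ZtoQ (Pdiv.CommonRing.rmodp q P)).
  rewrite irreducible_poly_coprime// gtNdvdp//.
    by rewrite -size_poly_eq0 size_rat_int_poly size_poly_eq0.
  by rewrite !size_rat_int_poly Pdiv.CommonRing.ltn_rmodp monic_neq0.
have copC : coprimep (ZtoC P) (ZtoC (Pdiv.CommonRing.rmodp q P)).
  by rewrite -!QtoC_ZtoQ coprimep_map.
by have := coprimep_root copC rP; rewrite -rootE rr.
Qed.

Lemma int_minpolyE P a : P \is monic -> irreducible_poly P -> root (ZtoC P) a ->
  int_minpoly a = P \/ int_minpoly a = - P.
Proof.
move=> mP irP rP; rewrite /int_minpoly.
case: xgetP => [q _ [[q0 qU qI] rq]|/(_ P)]; last first.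
  by case; split => //; exact: monic_irreducible_elt.
have [s sE] := irreducible_root_dvd mP irP rP rq.
have [_ PU _] := monic_irreducible_elt mP irP.
have [|sP] := qI _ _ sE; last by rewrite sP in PU.
rewrite poly_unitE => /andP[/size_poly1P[c c0 sc]].
rewrite sc coefC/= sE sc -[_ \is a _]/((c == 1) || (c == -1)).
by case/orP => /eqP ->; [left; rewrite mul1r|right; rewrite polyCN mulN1r].
Qed.

Lemma conjugates_data P rs a : P \is monic -> irreducible_poly P ->
  ZtoC P = \prod_(x <- rs) ('X - x%:P) -> uniq rs -> a \in rs ->
  [/\ algebraic_integer a, alg_deg a = size rs, conjugates a = [set` rs],
     ln `|(lead_coef (int_minpoly a))%:~R| = 0 :> R &
     perm_eq (fset_set (conjugates a)) rs].
Proof.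
move=> mP irP PE urs ars.
have rP : root (ZtoC P) a by rewrite PE root_prod_XsubC.
have cE : conjugates a = [set` rs].
  have rN x : root (ZtoC (- P)) x = root (ZtoC P) x by rewrite rmorphN rootN.
  apply/seteqP; split=> x; rewrite /conjugates /= -(root_prod_XsubC rs) -PE.
    by case: (int_minpolyE mP irP rP) => -> // H; rewrite -rN; exact: H.
  by case: (int_minpolyE mP irP rP) => -> // H; rewrite -rN in H; exact: H.
split=> //.
- by exists P.
- have sP : size P = (size rs).+1.
    by rewrite -(size_prod_XsubC rs id) -PE size_map_inj_poly ?rmorph0//; exact: intr_inj.
  rewrite /alg_deg; case: (int_minpolyE mP irP rP) => ->; by rewrite ?size_polyN sP.
- by case: (int_minpolyE mP irP rP) => ->; rewrite ?lead_coefN (monicP mP) ?rmorphN ?normrN rmorph1 normr1 ln1.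
- rewrite cE; apply: uniq_perm => // x.
  by rewrite in_fset_set ?mem_setE//; apply/finite_seqP; exists rs.
Qed.

End MinimalPolynomial.

(** * Borel measures on the plane and means of bounded continuous functions *)

Section BorelPlane.
Context {R : realType}.
Implicit Types (f g : R[i] -> R) (A K : set R[i]).

Lemma open_measurable_plane A : open A -> measurable A.
Proof. by move=> oA; apply: sub_sigma_algebra. Qed.

Lemma closed_measurable_plane A : closed A -> measurable A.
Proof.
by move=> cA; rewrite -(setCK A); apply: measurableC; apply: open_measurable_plane; exact: closed_openC.
Qed.

Lemma compact_measurable_plane A : compact A -> measurable A.
Proof.
by move=> cA; apply: closed_measurable_plane; apply: compact_closed.
Qed.

Lemma continuous_measurable_plane f : continuous f -> measurable_fun [set: R[i]] f.
Proof.
move=> cf; apply: (measurability _ (RGenOInfty.measurableE R)) => _ [_ [x ->] <-].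
rewrite setTI; apply: open_measurable_plane; apply: open_comp => // ? _; exact: cf.
Qed.

Definition bcont f := continuous f /\ exists M : R, forall z, `|f z| <= M.

Lemma bcont_cst (c : R) : bcont (fun=> c).
Proof.
split; last by exists `|c|.
by apply: (@lipschitz_continuous _ _ 0) => z w; rewrite subrr normr0 mul0r.
Qed.

Lemma bcontD f g : bcont f -> bcont g -> bcont (fun z => f z + g z).
Proof.
move=> [cf [M fM]] [cg [N gN]]; split; first by move=> z; apply: cvgD; [exact: nbhs_filter|exact: cf|exact: cg].
by exists (M + N) => z; rewrite (le_trans (ler_normD _ _))// lerD.
Qed.

Lemma bcontM f g : bcont f -> bcont g -> bcont (fun z => f z * g z).
Proof.
move=> [cf [M fM]] [cg [N gN]]; split; first by move=> z; apply: cvgM; [exact: nbhs_filter|exact: cf|exact: cg].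
by exists (M * N) => z; rewrite normrM ler_pM.
Qed.

Lemma bcontZ (c : R) f : bcont f -> bcont (fun z => c * f z).
Proof. by move=> bf; apply: bcontM => //; exact: bcont_cst. Qed.

Lemma bcont_sum (I : Type) (s : seq I) (F : I -> R[i] -> R) :
  (forall i, bcont (F i)) -> bcont (fun z => \sum_(i <- s) F i z).
Proof.
move=> bF; elim: s => [|i s IH].
  rewrite (_ : (fun z => _) = fun=> 0); first exact: bcont_cst.
  by apply/funext => z; rewrite big_nil.
rewrite (_ : (fun _ => _) = fun z => F i z + \sum_(j <- s) F j z).
  exact: bcontD.
by apply/funext => z; rewrite big_cons.
Qed.

Lemma bcont_integrable (mu : probability R[i] R) f : bcont f ->
  mu.-integrable setT (EFin \o f).
Proof.
move=> [cf [M fM]]; apply: measurable_bounded_integrable => //.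
- by apply: (@le_lt_trans _ _ 1%E); [exact: probability_le1|exact: ltry].
- exact: continuous_measurable_plane.
- by exists M; split; [exact: num_real|move=> x Mx z _ /=; rewrite (le_trans (fM z))// ltW].
Qed.

Lemma bcont_measurable f : bcont f -> measurable_fun setT (fun z => (f z)%:E).
Proof. by case=> cf _; apply/measurable_EFinP; exact: continuous_measurable_plane. Qed.

Lemma integral_prob_cst (mu : probability R[i] R) (c : R) : (\int[mu]_z (cst c%:E z) = c%:E)%E.
Proof. by rewrite -[RHS]mule1 -(probability_setT mu); exact: integral_cst. Qed.

Definition mean (mu : probability R[i] R) f : R := (\int[mu]_z f z)%R.

Lemma meanE (mu : probability R[i] R) f : bcont f ->
  (\int[mu]_z (f z)%:E)%E = (mean mu f)%:E.
Proof.
move=> bf; rewrite /mean /Rintegral fineK//.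
exact: (integrable_fin_num measurableT (bcont_integrable mu bf)).
Qed.

Lemma mean_le (mu : probability R[i] R) f g : bcont f -> bcont g ->
  (forall z, f z <= g z) -> mean mu f <= mean mu g.
Proof. by move=> bf bg fg; apply: le_Rintegral => //; exact: bcont_integrable. Qed.

Lemma meanD (mu : probability R[i] R) f g : bcont f -> bcont g ->
  mean mu (fun z => f z + g z) = mean mu f + mean mu g.
Proof. by move=> bf bg; apply: RintegralD => //; exact: bcont_integrable. Qed.

Lemma meanZ (mu : probability R[i] R) (c : R) f : bcont f ->
  mean mu (fun z => c * f z) = c * mean mu f.
Proof. by move=> bf; apply: RintegralZl => //; exact: bcont_integrable. Qed.

Lemma mean_cst (mu : probability R[i] R) (c : R) : mean mu (fun=> c) = c.
Proof.
rewrite /mean Rintegral_cst// (_ : fine _ = 1) ?mulr1//.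
exact: (congr1 fine (probability_setT mu)).
Qed.

Lemma mean_sum (mu : probability R[i] R) (I : Type) (s : seq I) (F : I -> R[i] -> R) :
  (forall i, bcont (F i)) ->
  mean mu (fun z => \sum_(i <- s) F i z) = \sum_(i <- s) mean mu (F i).
Proof.
move=> bF; elim: s => [|i s IH].
  rewrite big_nil (_ : (fun _ => _) = fun=> 0) ?mean_cst//.
  by apply/funext => z; rewrite big_nil.
rewrite big_cons -IH -meanD//; last exact: bcont_sum.
by congr mean; apply/funext => z; rewrite big_cons.
Qed.

Lemma supported_integral K (mu : probability R[i] R) (f g : R[i] -> \bar R) :
  measurable K -> supported_in K mu -> measurable_fun setT f -> measurable_fun setT g ->
  (forall z, K z -> f z = g z) -> (\int[mu]_z f z = \int[mu]_z g z)%E.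
Proof.
move=> mK sK mf mg fg; apply: ae_eq_integral => //.
exists (~` K); split; [exact: measurableC|exact: sK|].
by move=> z /= h Kz; apply: h => _; exact: fg.
Qed.

Lemma supported_le K (mu : probability R[i] R) (f g : R[i] -> \bar R) :
  measurable K -> supported_in K mu -> measurable_fun setT f -> measurable_fun setT g ->
  (forall z, (0 <= f z)%E) -> (forall z, (0 <= g z)%E) ->
  (forall z, K z -> (f z <= g z)%E) -> (\int[mu]_z f z <= \int[mu]_z g z)%E.
Proof.
move=> mK sK mf mg f0 g0 fg; apply: ae_ge0_le_integral => //.
exists (~` K); split; [exact: measurableC|exact: sK|].
by move=> z /= h Kz; apply: h => _; exact: fg.
Qed.

(** When [f] has infinite integral, so has the positive part of [f - c], while its negative part is
    at most [c]; the equality then reads [+oo = +oo]. *)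
Lemma ge0_integral_shift (mu : probability R[i] R) (f : R[i] -> \bar R) (c : R) : 0 <= c ->
  measurable_fun setT f -> (forall z, (0 <= f z)%E) ->
  (\int[mu]_z (f z - c%:E) = \int[mu]_z f z - c%:E)%E.
Proof.
move=> c0 mf f0.
have cint : mu.-integrable setT (cst c%:E) by apply: finite_measure_integrable_cst.
have ic : (\int[mu]_z c%:E = c%:E)%E by exact: integral_prob_cst.
have [fi|fi] := boolP ((\int[mu]_z f z < +oo)%E).
  rewrite integralB ?ic//; apply/integrableP; split => //.
  by under eq_integral do rewrite gee0_abs//.
have fy : (\int[mu]_z f z = +oo)%E by apply/eqP; rewrite -leye_eq leNgt.
rewrite fy /=; pose g z := (f z - c%:E)%E.
have mg : measurable_fun setT g by apply: emeasurable_funB.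
have gp : (\int[mu]_z (g^\+ z) = +oo)%E.
  have mgp : measurable_fun setT g^\+%E by exact: measurable_funepos.
  have : (\int[mu]_z f z <= \int[mu]_z (g^\+ z + c%:E))%E.
    apply: ge0_le_integral => //.
    - by apply: emeasurable_funD.
    - by move=> z _; rewrite -leeBlDr// funeposE le_max lexx.
  rewrite fy leye_eq ge0_integralD//.
  by rewrite ic; move: (\int[mu]_z (g^\+ z))%E => [r| |] /eqP.
have gn : (\int[mu]_z (g^\- z) <= c%:E)%E.
  rewrite -ic; apply: ge0_le_integral => //.
  - exact: measurable_funeneg.
  - move=> z _; rewrite funenegE ge_max lee_fin c0 andbT /g fin_num_oppeB//.
    by rewrite -[leRHS]add0e leeD2r// oppe_le0.
rewrite [LHS]integralE -/g gp.
have : (0 <= \int[mu]_z (g^\- z))%E by apply: integral_ge0.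
by move: gn; case: (\int[mu]_z _)%E.
Qed.

End BorelPlane.

(** * Limits along ultrafilters *)

Section Ultralimits.
Context {R : realType}.

Lemma ultra_fmap (T T' : Type) (U : set_system T) (u : T -> T') :
  UltraFilter U -> UltraFilter (u @ U).
Proof.
move=> UU; have PU : ProperFilter U by exact: ultra_proper.
apply: Build_UltraFilter => G PG uG.
apply/seteqP; split=> A GA; last exact: uG.
have [//|nA] := in_ultra_setVsetC (u @^-1` A) UU.
have /uG GnA : (u @ U) (~` A) by [].
exfalso; apply: (@filter_not_empty _ G PG).
by rewrite -[set0](setICr A); exact: filterI.
Qed.

Lemma ultra_bounded_cvg (T : Type) (U : set_system T) (u : T -> R) (M : R) :
  UltraFilter U -> (forall n, `|u n| <= M) -> exists2 l : R, `|l| <= M & u @ U --> l.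
Proof.
move=> UU uM; have PU : ProperFilter U by exact: ultra_proper.
have := @segment_compact R (- M) M; rewrite compact_ultra => /(_ (u @ U) (ultra_fmap u UU)).
case.
  have -> : (u @ U) [set` `[- M, M]] = U [set n | `|u n| <= M].
    by congr U; apply/seteqP; split=> n /=; rewrite in_itv/= -ler_norml.
  by apply: filterE => n; exact: uM.
by move=> l [/=]; rewrite in_itv/= -ler_norml; exists l.
Qed.

(** A neighbourhood whose preimage is missed by [F] gives an ultrafilter above [F] containing the
    complement. Convergence of a whole sequence thus reduces to the identification of its
    ultralimits. *)
Lemma cvg_ultra (T : Type) (S : topologicalType) (F : set_system T) (u : T -> S) (l : S) :
  Filter F -> (forall U, UltraFilter U -> F `<=` U -> u @ U --> l) -> u @ F --> l.
Proof.
move=> FF H A lA; have [//|nFA] := pselect ((u @ F) A); exfalso.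
pose G : set_system T := filter_from F (fun B => B `&` ~` (u @^-1` A)).
have PG : ProperFilter G.
  apply: filter_from_proper.
    apply: filter_from_filter; first by exists setT; exact: filterT.
    by move=> B C FB FC; exists (B `&` C); [exact: filterI|move=> x [[]]].
  move=> B FB; apply/set0P; apply: contra_notN nFA => /eqP B0.
  apply: (@filterS _ F FF B (u @^-1` A) _ FB) => x Bx; apply: contrapT => nAx.
  have : (B `&` ~` (u @^-1` A)) x by [].
  by rewrite B0.
have [U [UU GU]] := ultraFilterLemma PG.
have PU : ProperFilter U by exact: ultra_proper.
have FU : F `<=` U by move=> B FB; apply: GU; exists B => // x [].
have /= UA : U (u @^-1` A) by exact: (H U UU FU).
have UnA : U (~` (u @^-1` A)) by apply: GU; exists setT; [exact: filterT|move=> x []].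
by apply: (@filter_not_empty _ U PU); rewrite -[set0](setICr (u @^-1` A)); exact: filterI.
Qed.

End Ultralimits.

(** * Truncated logarithmic kernels, potentials and energies *)

Section LogKernel.
Context {R : realType}.
Implicit Types (s t : R) (z w : R[i]).

Lemma monotone_cvg d (T : measurableType d) (mu : {measure set T -> \bar R})
    (g : nat -> T -> \bar R) (f : T -> \bar R) :
  (forall n, measurable_fun setT (g n)) -> (forall n x, (0 <= g n x)%E) ->
  (forall x n m, (n <= m)%N -> (g n x <= g m x)%E) ->
  (forall x, g n x @[n --> \oo] --> f x) ->
  (\int[mu]_x g n x)%E @[n --> \oo] --> (\int[mu]_x f x)%E.
Proof.
move=> mg g0 gnd gf.
have := @cvg_monotone_convergence _ T R mu setT measurableT g mg
  (fun n x _ => g0 n x) (fun x _ n m nm => gnd x n m nm).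
rewrite (_ : (fun x => limn (g^~ x)) = f)//.
by apply/funext => x; apply/cvg_lim => //; exact: gf.
Qed.

Lemma neg_lne_cvg (A t : R) : 0 < A -> 0 <= t ->
  ((- ln (Num.max t (A * expR (- j%:R))))%:E @[j --> \oo] --> - lne t%:E)%E.
Proof.
move=> A0; rewrite le_eqVlt => /predU1P[<-|t0].
  rewrite /= lexx /=; apply/cvgeyPge => B.
  exists (Num.truncn `|B + ln A|).+1 => // j /= Bj; rewrite lee_fin.
  rewrite max_r ?mulr_ge0 ?expR_ge0 ?(ltW A0)// lnM ?posrE ?expR_gt0// expRK.
  have /andP[_ h] := @truncn_itv _ `|B + ln A| (normr_ge0 _).
  have := ler_norm (B + ln A).
  have : (Num.truncn `|B + ln A|).+1%:R <= j%:R :> R by rewrite ler_nat.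
  lra.
rewrite lne_EFin//; apply: cvg_near_cst.
exists (Num.truncn `|ln A - ln t|).+1 => // j /= Bj; congr (- ln _)%:E.
rewrite max_l// -[leRHS]lnK ?posrE// -[leLHS]lnK ?posrE ?mulr_gt0 ?expR_gt0//.
rewrite ler_expR lnM ?posrE ?expR_gt0// expRK.
have /andP[_ h] := @truncn_itv _ `|ln A - ln t| (normr_ge0 _).
have := ler_norm (ln A - ln t).
have : (Num.truncn `|ln A - ln t|).+1%:R <= j%:R :> R by rewrite ler_nat.
lra.
Qed.

Lemma ln_lip (a x y : R) : 0 < a -> a <= x -> a <= y -> `|ln x - ln y| <= `|x - y| / a.
Proof.
move=> a0.
have H u v : a <= u -> u <= v -> ln v - ln u <= (v - u) / a.
  move=> au uv; have u0 : 0 < u by exact: lt_le_trans au.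
  have v0 : 0 < v by exact: lt_le_trans uv.
  rewrite -ln_div ?posrE//; have -> : v / u = 1 + (v - u) / u by field; exact: lt0r_neq0.
  have vu : 0 <= (v - u) / u by rewrite divr_ge0 ?subr_ge0// ltW.
  apply: (le_trans (le_ln1Dx _)); first by rewrite (lt_le_trans _ vu)// ltrN10.
  by rewrite ler_wpM2l ?subr_ge0// lef_pV2.
move=> ax ay; have [xy|/ltW yx] := leP x y.
  rewrite distrC (distrC x) (ger0_norm (_ : 0 <= y - x)) ?subr_ge0//.
  rewrite ger0_norm ?subr_ge0 ?ler_ln ?posrE ?(lt_le_trans a0)//.
  exact: H.
rewrite (ger0_norm (_ : 0 <= x - y)) ?subr_ge0//.
rewrite ger0_norm ?subr_ge0 ?ler_ln ?posrE ?(lt_le_trans a0)//.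
exact: H.
Qed.

Section Kernel.
Variable M : R.
Hypothesis M1 : 1 <= M.

Let M0 : 0 < M. Proof. exact: lt_le_trans M1. Qed.

(** For [s >= 0], the truncation of [ln (M / s)] to values between 0 and [j]. It is Lipschitz, hence
    admissible in weak limits, and increases with [j] to [kapoo]. For a measure on a set of diameter
    at most [M], [kapoo] is the logarithmic kernel plus [ln M]. *)
Definition kap j s : R := ln M - ln (Num.max (Num.min s M) (M * expR (- j%:R))).

Definition kapoo s : \bar R := ((ln M)%:E - lne (Num.min s M)%:E)%E.

Let cut j s := Num.max (Num.min s M) (M * expR (- j%:R)).

Let cut_gt0 j s : 0 < cut j s.
Proof. by rewrite /cut lt_max mulr_gt0 ?expR_gt0 ?orbT. Qed.

Let cut_leM j s : cut j s <= M.
Proof.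
by rewrite /cut ge_max ge_min lexx orbT /= ler_piMr ?(ltW M0) ?expR_le1 ?oppr_le0.
Qed.

Lemma kap_ge0 j s : 0 <= kap j s.
Proof. by rewrite subr_ge0 ler_ln ?posrE// ?cut_gt0 ?cut_leM. Qed.

Lemma kap_le j s : kap j s <= j%:R.
Proof.
have : ln (M * expR (- j%:R)) <= ln (cut j s).
  by rewrite ler_ln ?posrE ?mulr_gt0 ?expR_gt0// le_max lexx orbT.
rewrite lnM ?posrE ?expR_gt0// expRK /kap -/(cut j s); lra.
Qed.

Lemma kap_lip j s t : `|kap j s - kap j t| <= expR j%:R / M * `|s - t|.
Proof.
have -> : kap j s - kap j t = ln (cut j t) - ln (cut j s).
  by rewrite /kap -/(cut j s) -/(cut j t); ring.
have aM : 0 < M * expR (- j%:R) by rewrite mulr_gt0 ?expR_gt0.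
have c x : M * expR (- j%:R) <= cut j x by rewrite /cut le_max lexx orbT.
apply: (le_trans (ln_lip aM (c t) (c s))).
have -> : (M * expR (- j%:R))^-1 = expR j%:R / M by rewrite expRN invfM invrK mulrC.
rewrite mulrC ler_wpM2l ?divr_ge0 ?expR_ge0 ?(ltW M0)//.
by apply: le_trans (max_lip _ _ _) _; rewrite (distrC s) min_lip.
Qed.

Lemma kap_mono i j s : (i <= j)%N -> kap i s <= kap j s.
Proof.
move=> ij; rewrite lerD2l lerN2 ler_ln ?posrE ?cut_gt0//.
rewrite ge_max !le_max lexx /= ler_wpM2l ?(ltW M0) ?orbT//.
by rewrite ler_expR lerN2 ler_nat.
Qed.

Lemma kapoo_cvg s : 0 <= s -> (kap j s)%:E @[j --> \oo] --> kapoo s.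
Proof.
move=> s0; rewrite /kap /kapoo.
have := @neg_lne_cvg M (Num.min s M) M0; rewrite le_min s0 (ltW M0) => /(_ isT) H.
under eq_fun do rewrite EFinB.
apply: cvgeD => //.
exact: cvg_cst.
Qed.

Lemma kapoo_ge0 s : 0 <= s -> (0 <= kapoo s)%E.
Proof.
move=> s0; have [m0|m0] := ltP 0 (Num.min s M).
  by rewrite /kapoo lne_EFin// -EFinB lee_fin subr_ge0 ler_ln ?posrE// ge_min lexx orbT.
by rewrite /kapoo le0_lneNy ?lee_fin//= leey.
Qed.

Lemma kap_le_kapoo j s : 0 <= s -> ((kap j s)%:E <= kapoo s)%E.
Proof.
move=> s0; have [m0|m0] := ltP 0 (Num.min s M); last first.
  by rewrite /kapoo le0_lneNy ?lee_fin//= leey.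
rewrite /kapoo lne_EFin// -EFinB lee_fin lerD2l lerN2 ler_ln ?posrE ?cut_gt0//.
by rewrite le_max lexx.
Qed.

Lemma kapooE s : s <= M -> (- lne s%:E = kapoo s - (ln M)%:E)%E.
Proof.
move=> sM; rewrite /kapoo min_l//; case: (lne s%:E) => [r| |] //.
by rewrite -!EFinB -EFinN; congr EFin; ring.
Qed.

Lemma kapoo_pos s : 0 < s -> kapoo s = (ln M - ln (Num.min s M))%:E.
Proof. by move=> s0; rewrite /kapoo lne_EFin ?EFinB// lt_min s0 M0. Qed.

Lemma bcont_kap j z : bcont (fun w => kap j (cabs (z - w))).
Proof.
split; last by exists j%:R => w; rewrite ger0_norm ?kap_ge0 ?kap_le.
apply: (@lipschitz_continuous _ _ (expR j%:R / M)) => w w'.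
apply: (le_trans (kap_lip _ _ _)); rewrite ler_wpM2l ?divr_ge0 ?expR_ge0 ?(ltW M0)//.
apply: (le_trans (ler_cabs_dist _ _)).
by rewrite (_ : z - w - (z - w') = w' - w) ?(cabs_distC w')//; ring.
Qed.

Lemma measurable_kapoo z : measurable_fun setT (fun w => kapoo (cabs (z - w))).
Proof.
apply: (emeasurable_fun_cvg (fun j w => (kap j (cabs (z - w)))%:E)) => [j|w _].
  exact: bcont_measurable (bcont_kap j z).
by apply: kapoo_cvg; exact: cabs_ge0.
Qed.

Section Potentials.
Variable mu : probability R[i] R.

Definition potj j z : R := mean mu (fun w => kap j (cabs (z - w))).
Definition pot z : \bar R := (\int[mu]_w kapoo (cabs (z - w)%R))%E.
Definition enj j : R := mean mu (potj j).
Definition en : \bar R := (\int[mu]_z pot z)%E.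

Lemma pot_ge0 z : (0 <= pot z)%E.
Proof. by apply: integral_ge0 => w _; apply: kapoo_ge0; exact: cabs_ge0. Qed.

Lemma potj_ge0 j z : 0 <= potj j z.
Proof.
rewrite -(mean_cst mu 0); apply: mean_le; [exact: bcont_cst|exact: bcont_kap|].
by move=> w; exact: kap_ge0.
Qed.

Lemma potj_le j z : potj j z <= j%:R.
Proof.
rewrite -(mean_cst mu j%:R); apply: mean_le; [exact: bcont_kap|exact: bcont_cst|].
by move=> w; exact: kap_le.
Qed.

Lemma bcont_potj j : bcont (potj j).
Proof.
split; last by exists j%:R => w; rewrite ger0_norm ?potj_ge0 ?potj_le.
have H z z' : potj j z <= potj j z' + expR j%:R / M * cabs (z - z').
  rewrite -[X in _ + X](mean_cst mu) -meanD; [|exact: bcont_kap|exact: bcont_cst].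
  apply: mean_le; [exact: bcont_kap|by apply: bcontD; [exact: bcont_kap|exact: bcont_cst]|].
  move=> w; rewrite -lerBlDl (le_trans (ler_norm _))// (le_trans (kap_lip _ _ _))//.
  rewrite ler_wpM2l ?divr_ge0 ?expR_ge0 ?(ltW M0)//.
  apply: (le_trans (ler_cabs_dist _ _)).
  by rewrite (_ : z - w - (z' - w) = z - z')//; ring.
apply: (@lipschitz_continuous _ _ (expR j%:R / M)) => z z'.
have := H z z'; have := H z' z; rewrite (cabs_distC z') ler_norml => h1 h2.
by apply/andP; split; lra.
Qed.

Lemma pot_cvg z : (potj j z)%:E @[j --> \oo] --> pot z.
Proof.
rewrite (_ : (fun j => _) = fun j => (\int[mu]_w (kap j (cabs (z - w)%R))%:E)%E); last first.
  by apply/funext => j; rewrite meanE//; exact: bcont_kap.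
apply: monotone_cvg.
- by move=> j; exact: bcont_measurable (bcont_kap j z).
- by move=> j w; rewrite lee_fin kap_ge0.
- by move=> w i j ij; rewrite lee_fin kap_mono.
- by move=> w; apply: kapoo_cvg; exact: cabs_ge0.
Qed.

Lemma potj_mono i j z : (i <= j)%N -> potj i z <= potj j z.
Proof. by move=> ij; apply: mean_le; try exact: bcont_kap; move=> w; exact: kap_mono. Qed.

Lemma measurable_pot : measurable_fun setT pot.
Proof.
apply: (emeasurable_fun_cvg (fun j z => (potj j z)%:E)) => [j|z _]; last exact: pot_cvg.
exact: bcont_measurable (bcont_potj j).
Qed.

Lemma en_cvg : (enj j)%:E @[j --> \oo] --> en.
Proof.
rewrite (_ : (fun j => _) = fun j => (\int[mu]_w (potj j w)%:E)%E); last first.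
  by apply/funext => j; rewrite meanE//; exact: bcont_potj.
apply: monotone_cvg.
- by move=> j; exact: bcont_measurable (bcont_potj j).
- by move=> j w; rewrite lee_fin potj_ge0.
- by move=> w i j ij; rewrite lee_fin potj_mono.
- exact: pot_cvg.
Qed.

Lemma potj_le_pot j z : ((potj j z)%:E <= pot z)%E.
Proof.
rewrite -meanE; last exact: bcont_kap.
apply: ge0_le_integral => //.
- by move=> w _; rewrite lee_fin kap_ge0.
- exact: bcont_measurable (bcont_kap j z).
- exact: measurable_kapoo.
- by move=> w _; apply: kap_le_kapoo; exact: cabs_ge0.
Qed.

End Potentials.
End Kernel.
End LogKernel.

(** * Riemann sums for the uniform law on the unit interval *)

Section UnitInterval.
Context {R : realType}.

Definition unif01 := mrestr (@lebesgue_measure R) (measurable_itv `[0:R, 1[).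

HB.instance Definition _ := Measure.on unif01.

Lemma unif01_itv (x y : R) : 0 <= x -> x < y -> y <= 1 -> unif01 `[x, y[ = (y - x)%:E.
Proof.
move=> x0 xy y1; rewrite /unif01 /mrestr setIidl.
  by rewrite lebesgue_measure_itv /= lte_fin xy.
by move=> t /=; rewrite !in_itv/= => /andP[xt ty]; rewrite (le_trans x0 xt) (lt_le_trans ty y1).
Qed.

Lemma unif01_setT : unif01 setT = 1%E.
Proof.
rewrite /unif01 /mrestr setTI lebesgue_measure_itv /= lte_fin ltr01.
by rewrite oppr0 adde0.
Qed.

HB.instance Definition _ := Measure_isProbability.Build _ _ _ unif01 unif01_setT.

Lemma unif01_out : unif01 (~` `[0, 1[) = 0%E.
Proof. by rewrite /unif01 /mrestr setICl measure0. Qed.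

Lemma unif01_integrable (g : R -> R) (B : R) :
  measurable_fun setT g -> (forall t, `|g t| <= B) -> unif01.-integrable setT (EFin \o g).
Proof.
move=> mg gB; apply: measurable_bounded_integrable => //.
  by apply: (@le_lt_trans _ _ 1%E); [exact: probability_le1|exact: ltry].
by exists B; split; [exact: num_real|move=> x Mx z _ /=; rewrite (le_trans (gB z))// ltW].
Qed.

Lemma riemann_sum_dist (g : R -> R) (B : R) (K : nat) (c d : nat -> R) :
  (0 < K)%N -> measurable_fun setT g -> (forall t, `|g t| <= B) ->
  (forall j t, (j < K)%N -> j%:R / K%:R <= t -> t < j.+1%:R / K%:R -> `|g t - c j| <= d j) ->
  `|\int[unif01]_t g t - (\sum_(j < K) c j) / K%:R| <= (\sum_(j < K) d j) / K%:R.
Proof.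
move=> K0 mg gB gcd; have KR : 0 < K%:R :> R by rewrite ltr0n.
pose I (j : nat) : set R := `[j%:R / K%:R, j.+1%:R / K%:R[%classic.
have PI j : (j < K)%N -> fine (unif01 (I j)) = K%:R^-1.
  move=> jK; rewrite unif01_itv ?divr_ge0 ?ltr_pM2r ?invr_gt0 ?ltr_nat//.
    by rewrite /= -mulrBl -natrB// subSnn mul1r.
  by rewrite ler_pdivrMr// mul1r ler_nat.
have mI j : measurable (I j) by exact: measurable_itv.
pose out : set R := ~` `[0, 1[%classic.
have mout : measurable out by apply: measurableC; exact: measurable_itv.
pose D t := \sum_(j < K) c j * \1_(I j) t.
(* The law lives on the whole line and [g] need not vanish off the unit interval; the term with
   [out] dominates it there and has integral zero. *)
pose E t := B * \1_out t + \sum_(j < K) d j * \1_(I j) t.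
have i1 (A : set R) : measurable A -> unif01.-integrable setT (EFin \o (\1_A : R -> R)).
  move=> mA; apply: (@unif01_integrable _ 1); first exact: measurable_indic.
  by move=> t; rewrite indicE; case: (_ \in _); rewrite ?normr1 ?normr0.
have iZ (a : R) (A : set R) : measurable A -> unif01.-integrable setT (EFin \o (fun t => a * \1_A t)).
  by move=> mA; apply: (integrableZl _ a (i1 A mA)).
have RI (A : set R) : measurable A -> \int[unif01]_t (\1_A t : R) = fine (unif01 A).
  by move=> mA; rewrite /Rintegral integral_indic// setIT.
have iS (a : nat -> R) n : (n <= K)%N ->
    unif01.-integrable setT (EFin \o (fun t => \sum_(j < n) a j * \1_(I j) t)) /\
    \int[unif01]_t (\sum_(j < n) a j * \1_(I j) t) = (\sum_(j < n) a j) / K%:R.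
  elim: n => [_|n IH nK].
    rewrite (_ : (fun t => _) = cst 0); last by apply/funext => t; rewrite big_ord0.
    split; first by apply: (@unif01_integrable _ 0) => // t; rewrite normr0.
    by rewrite Rintegral_cst// big_ord0 !mul0r.
  have [IH1 IH2] := IH (ltnW nK).
  rewrite (_ : (fun t => _) = fun t => (\sum_(j < n) a j * \1_(I j) t) + a n * \1_(I n) t); last first.
    by apply/funext => t; rewrite big_ord_recr.
  split.
    have := integrableD measurableT IH1 (iZ (a n) (I n) (mI n)).
    by apply: eq_integrable => // t _.
  rewrite RintegralD//; last exact: iZ.
  rewrite IH2 RintegralZl//; last exact: i1.
  by rewrite RI// PI// big_ord_recr/= mulrDl.
have [iD ID] := iS c K (leqnn K).
have [iE' IE'] := iS d K (leqnn K).
have iE : unif01.-integrable setT (EFin \o E).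
  have := integrableD measurableT (iZ B out mout) iE'.
  by apply: eq_integrable => // t _.
have IE : \int[unif01]_t E t = (\sum_(j < K) d j) / K%:R.
  rewrite /E RintegralD//; last exact: iZ.
  rewrite IE' RintegralZl//; last exact: i1.
  by rewrite RI// [unif01 _]unif01_out mulr0 add0r.
have ig := unif01_integrable mg gB.
rewrite -ID -RintegralB// -IE.
have igD : unif01.-integrable setT (EFin \o (fun t => g t - D t)).
  have := integrableB measurableT ig iD.
  by apply: eq_integrable => // t _.
apply: (le_trans (le_normr_Rintegral measurableT igD)).
apply: le_Rintegral => //.
  have := integrable_abse igD.
  by apply: eq_integrable => // t _.
move=> t _; rewrite /D /E.
have pick (a : nat -> R) : 0 <= t < 1 ->
    \sum_(j < K) a j * \1_(I j) t = a (Num.truncn (t * K%:R)).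
  move=> /andP[t0 t1]; have tK0 : 0 <= t * K%:R by rewrite mulr_ge0// ltW.
  have /andP[h1 h2] := truncn_itv tK0.
  have jK : (Num.truncn (t * K%:R) < K)%N.
    by rewrite -(ltr_nat R) (le_lt_trans h1)// -[ltRHS]mul1r ltr_pM2r.
  rewrite (bigD1 (Ordinal jK))//= big1 ?addr0.
    rewrite indicE mem_set ?mulr1// /I /= in_itv/= ler_pdivrMr// ltr_pdivlMr//.
    by rewrite h1 h2.
  move=> i /eqP ij; rewrite indicE memNset ?mulr0// /I /= in_itv/= => /andP[].
  rewrite ler_pdivrMr// ltr_pdivlMr// => k1 k2; apply: ij; apply/val_inj => /=.
  by rewrite (@truncn_def _ _ i)// k1 k2.
have [t01|t01] := boolP (0 <= t < 1).
  rewrite !pick// indicE memNset ?mulr0 ?add0r; last by move=> H; apply: H; rewrite /= in_itv/= t01.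
  have /andP[t0 t1] := t01; have tK0 : 0 <= t * K%:R by rewrite mulr_ge0// ltW.
  have /andP[h1 h2] := truncn_itv tK0.
  apply: gcd.
  - by rewrite -(ltr_nat R) (le_lt_trans h1)// -[ltRHS]mul1r ltr_pM2r.
  - by rewrite ler_pdivrMr.
  - by rewrite ltr_pdivlMr.
have z0 (a : nat -> R) : \sum_(j < K) a j * \1_(I j) t = 0.
  rewrite big1// => i _; rewrite indicE memNset ?mulr0// /I /= in_itv/= => /andP[k1 k2].
  move/negP: t01; apply; rewrite (le_trans _ k1) ?divr_ge0//= (lt_le_trans k2)//.
  by rewrite ler_pdivrMr// mul1r ler_nat.
have ot : out t.
  by move=> H; move/negP: t01; apply; move: H; rewrite /= in_itv/=.
by rewrite !z0 subr0 addr0 indicE mem_set// mulr1.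
Qed.

(* For monotone [X], the total oscillation of [X] over a subdivision of the
   unit interval telescopes. *)
Lemma monotone_riemann_sum (h X : R -> R) (B A e : R) K : (0 < K)%N ->
  (forall s t, s <= t -> X s <= X t) -> (forall t, 0 <= X t <= 1) ->
  measurable_fun setT (h \o X) -> (forall t, `|h t| <= B) -> 0 <= A ->
  (forall s t, `|h s - h t| <= e + A * `|s - t|) ->
  `|\int[unif01]_t h (X t) - (\sum_(j < K) h (X (j%:R / K%:R))) / K%:R| <= e + A / K%:R.
Proof.
move=> K0 Xnd X01 mhX hB A0 hA; have KR : 0 < K%:R :> R by rewrite ltr0n.
pose x (j : nat) := X (j%:R / K%:R).
have xnd j : x j <= x j.+1.
  by apply: Xnd; rewrite ler_pM2r ?invr_gt0// ler_nat.
pose d (j : nat) := e + A * (x j.+1 - x j).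
apply: (le_trans (@riemann_sum_dist (h \o X) B K (fun j => h (x j)) d K0 mhX _ _)).
- by move=> t; exact: hB.
- move=> j t jK jt tj; apply: (le_trans (hA _ _)); rewrite lerD2l ler_wpM2l//.
  rewrite ger0_norm ?subr_ge0; last exact: Xnd.
  by rewrite lerD2r; apply: Xnd; exact: ltW.
rewrite /d big_split/= sumr_const card_ord -mulr_sumr.
rewrite -(big_mkord xpredT (fun j => x j.+1 - x j)) telescope_sumr//.
rewrite mulrDl -[_ *+ K]mulr_natr mulfK ?lt0r_neq0// lerD2l ler_wpM2r ?invr_ge0 ?(ltW KR)//.
rewrite ler_piMr//; have /andP[_ h1] := X01 (K%:R / K%:R).
by have /andP[h0 _] := X01 (0%:R / K%:R); rewrite /x; lra.
Qed.

End UnitInterval.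

(** * Schoenberg's space-filling curve *)

Section Peano.
Context {R : realType}.
Implicit Types t s : R.

(** On a number of the unit interval whose first ternary digit is 0 or 2, [fold3] deletes this digit
    and [digit] returns half of it; elsewhere both continue piecewise linearly, so they are
    Lipschitz. *)
Definition fold3 t : R := Num.min (3 * t) `|3 * t - 2|.
Definition digit t : R := Num.max 0 (Num.min 1 (3 * t - 1)).

(** Two foldings at each step: one coordinate of the curve uses every other ternary digit as a
    binary digit, and starting from [fold3 t] uses the remaining ones for the other coordinate. *)
Fixpoint peano_sum n t : R :=
  if n is m.+1 then (digit t + peano_sum m (fold3 (fold3 t))) / 2 else 0.

Lemma digit01 t : 0 <= digit t <= 1.
Proof. by rewrite /digit le_max lexx ge_max ler01 ge_min lexx. Qed.

Lemma peano_sum_cauchy n m t : 0 <= peano_sum (n + m) t - peano_sum n t <= 2^-1 ^+ n.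
Proof.
elim: n t => [t|n IH t]; last first.
  rewrite addSn /= -mulrBl opprD addrACA subrr add0r exprS.
  by have /andP[h1 h2] := IH (fold3 (fold3 t)); apply/andP; split; lra.
rewrite add0n subr0 expr0; elim: m t => [t|m IH t]; first by rewrite lexx ler01.
by have /andP[h1 h2] := IH (fold3 (fold3 t)); have /andP[] := digit01 t; rewrite /=; lra.
Qed.

Definition peano1 t : R := limn (peano_sum^~ t).

Lemma peano_sum_nd t : nondecreasing_seq (peano_sum^~ t).
Proof.
move=> n m /subnKC <-; have /andP[h _] := peano_sum_cauchy n (m - n) t.
by rewrite -subr_ge0.
Qed.

Lemma peano1_cvg t : cvgn (peano_sum^~ t).
Proof.
apply: nondecreasing_is_cvgn; first exact: peano_sum_nd.
exists 1 => _ [n _ <-]; have /andP[_] := peano_sum_cauchy 0 n t.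
by rewrite add0n /= subr0 expr0.
Qed.

Lemma peano1_approx n t : 0 <= peano1 t - peano_sum n t <= 2^-1 ^+ n.
Proof.
rewrite subr_ge0 nondecreasing_cvgn_le//; [|exact: peano_sum_nd|exact: peano1_cvg].
rewrite lerBlDr; apply: limr_le; first exact: peano1_cvg.
exists n => // m /= /subnKC <-; have /andP[_] := peano_sum_cauchy n (m - n) t.
by rewrite lerBlDr.
Qed.

Lemma peano1_rec t : peano1 t = (digit t + peano1 (fold3 (fold3 t))) / 2.
Proof.
apply/cvg_lim => //; rewrite -cvg_shiftS /=.
apply: cvgM; last exact: cvg_cst.
by apply: cvgD; [exact: cvg_cst|exact: peano1_cvg].
Qed.

Lemma peano1_01 t : 0 <= peano1 t <= 1.
Proof. by have := peano1_approx 0 t; rewrite /= subr0 expr0. Qed.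

Lemma fold3_lip s t : `|fold3 s - fold3 t| <= 3 * `|s - t|.
Proof.
rewrite /fold3 /Num.min; have [h|h] := leP 0 (3 * s - 2); have [k|k] := leP 0 (3 * t - 2);
  rewrite ?(ger0_norm h) ?(ltr0_norm h) ?(ger0_norm k) ?(ltr0_norm k);
  case: ltP => ?; case: ltP => ?; have [l|l] := leP 0 (s - t);
  rewrite ?(ger0_norm l) ?(ltr0_norm l) ler_norml; apply/andP; split; lra.
Qed.

Lemma digit_lip s t : `|digit s - digit t| <= 3 * `|s - t|.
Proof.
have H x y : x <= y -> 0 <= digit y - digit x <= 3 * (y - x).
  rewrite /digit /Num.max /Num.min => xy; apply/andP.
  case: (ltP 1 (3 * x - 1)) => ?; case: (ltP 1 (3 * y - 1)) => ?; case: ltP => ?; case: ltP => ?; split; lra.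
have [st|/ltW ts] := leP s t.
  by have /andP[h1 h2] := H s t st; rewrite distrC ger0_norm// distrC ger0_norm ?subr_ge0.
by have /andP[h1 h2] := H t s ts; rewrite ger0_norm// ger0_norm ?subr_ge0.
Qed.

Lemma peano_sum_lip n : exists2 L, 0 <= L &
  forall s t, `|peano_sum n s - peano_sum n t| <= L * `|s - t|.
Proof.
elim: n => [|n [L L0 IH]].
  by exists 0 => // s t; rewrite /= subrr normr0 mul0r.
exists ((3 + L * 9) / 2); first lra.
move=> s t; rewrite /= -mulrBl normrM (@gtr0_norm _ 2^-1) ?invr_gt0// opprD addrACA.
rewrite [leRHS]mulrAC ler_wpM2r// mulrDl (le_trans (ler_normD _ _))// lerD ?digit_lip//.
apply: (le_trans (IH _ _)); rewrite -mulrA ler_wpM2l//.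
have := fold3_lip (fold3 s) (fold3 t); have := fold3_lip s t; lra.
Qed.

Lemma expr2V_small (e : R) : 0 < e -> exists n, 2^-1 ^+ n <= e.
Proof.
move=> e0; exists (Num.truncn e^-1).+1; set n := (Num.truncn e^-1).+1.
have eV : 0 <= e^-1 by rewrite invr_ge0 ltW.
have /andP[_ h] := truncn_itv eV.
rewrite exprVn invf_ple ?posrE ?exprn_gt0//.
rewrite (le_trans (ltW h))// -natrX ler_nat.
exact: ltnW (ltn_expl _ _).
Qed.

(** The partial sums are Lipschitz and converge uniformly. Uniform continuity is used throughout in
    this form, an error [e] plus a Lipschitz term, because such bounds can be summed over points. *)
Lemma peano1_modulus (e : R) : 0 < e -> exists2 A, 0 <= A &
  forall s t, `|peano1 s - peano1 t| <= e + A * `|s - t|.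
Proof.
move=> e0; have [n ne] := expr2V_small (divr_gt0 e0 (ltr0n _ 2)).
have [L L0 Lip] := peano_sum_lip n; exists L => // s t.
have := Lip s t; have := peano1_approx n s; have := peano1_approx n t.
move=> /andP[h1 h2] /andP[h3 h4]; rewrite !ler_norml => /andP[h5 h6].
by apply/andP; split; lra.
Qed.

Lemma fold3_digit (c : bool) s : 0 <= s <= 1 ->
  let t := (2 * c%:R + s) / 3 in [/\ 0 <= t <= 1, fold3 t = s & digit t = c%:R].
Proof.
move=> /andP[s0 s1] t; have tE : 3 * t = 2 * c%:R + s by rewrite /t; lra.
clearbody t; rewrite /fold3 /digit; case: c tE; rewrite ?mulr1n ?mulr0n => tE; split.
- by apply/andP; split; lra.
- have e : 3 * t - 2 = s by lra.
  by rewrite e ger0_norm// min_r//; lra.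
- by rewrite min_l ?max_r//; lra.
- by apply/andP; split; lra.
- have e : 3 * t = s by lra.
  by rewrite e ltr0_norm ?min_l//; lra.
- by rewrite min_r ?max_l//; lra.
Qed.

(** The leading binary digits [c] and [d] of [a] and [b] become the first two ternary digits of the
    parameter. Density is enough, since points are coded only up to [2 ^ - n]. *)
Lemma peano1_dense n (a b : R) : 0 <= a <= 1 -> 0 <= b <= 1 ->
  exists t, [/\ 0 <= t <= 1, `|peano1 t - a| <= 2^-1 ^+ n &
    `|peano1 (fold3 t) - b| <= 2^-1 ^+ n].
Proof.
elim: n a b => [|n IH] a b a01 b01.
  exists 0; rewrite lexx ler01 expr0; split=> //.
    have /andP[? ?] := peano1_01 0; have /andP[? ?] := a01.
    by rewrite ler_norml; apply/andP; split; lra.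
  have /andP[? ?] := peano1_01 (fold3 0); have /andP[? ?] := b01.
  by rewrite ler_norml; apply/andP; split; lra.
have shift (x : R) : 0 <= x <= 1 -> exists c : bool, 0 <= 2 * x - c%:R <= 1.
  move=> /andP[x0 x1]; have [h|h] := leP (1 / 2) x.
    by exists true; apply/andP; split; rewrite /=; lra.
  by exists false; apply/andP; split; rewrite /=; lra.
have [c ca] := shift a a01; have [d db] := shift b b01.
have [t' [t01 ta tb]] := IH _ _ ca db.
have [s01 fs ds] := fold3_digit d t01; set s := _ / 3 in s01 fs ds.
have [u01 fu du] := fold3_digit c s01; set u := _ / 3 in u01 fu du.
exists u; split=> //.
  rewrite peano1_rec fu fs du exprS.
  have -> : (c%:R + peano1 t') / 2 - a = 2^-1 * (peano1 t' - (2 * a - c%:R)) by field.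
  by rewrite normrM (@gtr0_norm _ 2^-1) ?invr_gt0// ler_wpM2l.
rewrite fu peano1_rec fs ds exprS.
have -> : (d%:R + peano1 (fold3 t')) / 2 - b = 2^-1 * (peano1 (fold3 t') - (2 * b - d%:R)) by field.
by rewrite normrM (@gtr0_norm _ 2^-1) ?invr_gt0// ler_wpM2l.
Qed.

(* Schoenberg's space-filling curve, scaled to the square of half-side [r]. *)
Definition peano (r t : R) : R[i] :=
  (r * (2 * peano1 t - 1)) +i* (r * (2 * peano1 (fold3 t) - 1)).

Lemma peano_modulus (r e : R) : 0 < r -> 0 < e -> exists2 A, 0 <= A &
  forall s t, cabs (peano r s - peano r t) <= e + A * `|s - t|.
Proof.
move=> r0 e0; have [A A0 HA] := @peano1_modulus (e / (4 * r)) (divr_gt0 e0 (mulr_gt0 (ltr0n _ 4) r0)).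
exists (8 * r * A); first by rewrite !mulr_ge0// ltW.
move=> s t; apply: (le_trans (cabs_le_ReIm _)).
have := HA s t; have := HA (fold3 s) (fold3 t); have := fold3_lip s t.
rewrite /peano /= -!mulrBr !normrM (gtr0_norm r0).
have E x y : 2 * x - 1 - (2 * y - 1) = 2 * (x - y) :> R by ring.
rewrite !E !normrM (ger0_norm (ler0n _ 2)) => h0 /(ler_wpM2l (ltW r0)) h1 /(ler_wpM2l (ltW r0)) h2.
have rA : 0 <= r * A by rewrite mulr_ge0// ltW.
have h3 := ler_wpM2l rA h0.
have re : r * (e / (4 * r)) = e / 4 by field; exact: lt0r_neq0.
rewrite mulrDr re in h1; rewrite mulrDr re in h2; lra.
Qed.

Lemma peano_dense (r e : R) z : 0 < r -> 0 < e -> cabs z <= r ->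
  exists2 t, 0 <= t <= 1 & cabs (peano r t - z) <= e.
Proof.
move=> r0 e0 zr; have [n ne] := expr2V_small (divr_gt0 e0 (mulr_gt0 (ltr0n _ 4) r0)).
have c01 (x : R) : `|x| <= r -> 0 <= (x / r + 1) / 2 <= 1.
  rewrite ler_norml => /andP[h1 h2].
  have h3 : -1 <= x / r by rewrite ler_pdivlMr// mulN1r.
  have h4 : x / r <= 1 by rewrite ler_pdivrMr// mul1r.
  by apply/andP; split; lra.
have [t [t01 ta tb]] := peano1_dense n (c01 _ (le_trans (cabs_ge_Re z) zr))
  (c01 _ (le_trans (cabs_ge_Im z) zr)).
exists t => //; apply: (le_trans (cabs_le_ReIm _)).
rewrite /peano; move: ta tb; case: z zr => x y zr /= ta tb.
have E (u v : R) : r * (2 * u - 1) - v = 2 * r * (u - (v / r + 1) / 2).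
  by field; exact: lt0r_neq0.
rewrite !E !normrM (gtr0_norm r0) (ger0_norm (ler0n _ 2)).
have e4 : r * (e / (4 * r)) = e / 4 by field; exact: lt0r_neq0.
have := ler_wpM2l (ltW r0) (le_trans ta ne); have := ler_wpM2l (ltW r0) (le_trans tb ne).
rewrite e4; lra.
Qed.

Lemma peano_bound (r t : R) : 0 < r -> cabs (peano r t) <= 2 * r.
Proof.
move=> r0; apply: (le_trans (cabs_le_ReIm _)); rewrite /peano /= !normrM (gtr0_norm r0).
have H (x : R) : 0 <= x <= 1 -> `|2 * x - 1| <= 1.
  by move=> /andP[? ?]; rewrite ler_norml; apply/andP; split; lra.
have := ler_wpM2l (ltW r0) (H _ (peano1_01 t)).
have := ler_wpM2l (ltW r0) (H _ (peano1_01 (fold3 t))); lra.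
Qed.

End Peano.

(** * Weak limits of root-counting measures along ultrafilters *)

Section WeakLimit.
Context {R : realType}.
Implicit Types (f : R[i] -> R) (s : seq R[i]).

Definition avg f s : R := (\sum_(x <- s) f x) / (size s)%:R.

Lemma ultra_bounded_cvgC (T : Type) (U : set_system T) (u : T -> R[i]) (M : R) :
  UltraFilter U -> (forall n, cabs (u n) <= M) ->
  exists l : R[i], forall e : R, 0 < e -> U [set n | cabs (l - u n) < e].
Proof.
move=> UU uM; have PU : ProperFilter U by exact: ultra_proper.
have [x _ xP] := ultra_bounded_cvg UU (fun n => le_trans (cabs_ge_Re (u n)) (uM n)).
have [y _ yP] := ultra_bounded_cvg UU (fun n => le_trans (cabs_ge_Im (u n)) (uM n)).
exists (x +i* y) => e e0.
have e2 : 0 < e / 2 by rewrite divr_gt0.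
move/cvgrPdist_lt : xP => /(_ _ e2) h1; move/cvgrPdist_lt : yP => /(_ _ e2) h2.
apply: (@filterS _ U _ _ _ _ (filterI h1 h2)) => n [/= k1 k2].
apply: (le_lt_trans (cabs_le_ReIm _)); move: k1 k2; case: (u n) => a b /=; lra.
Qed.

(** Failure for every slope [n] gives pairs with [n * cabs (z - w) < 2 * B], where [B] bounds [f];
    at the ultralimit of their first entries continuity is violated. *)
Lemma bcont_modulus f (r e : R) : bcont f -> 0 < e -> exists2 A, 0 <= A &
  forall z w, cabs z <= r -> cabs w <= r -> `|f z - f w| <= e + A * cabs (z - w).
Proof.
move=> [cf [B fB]] e0; apply: contrapT => noA.
have /choice[zw zwP] : forall n : nat, exists zw : R[i] * R[i],
    [/\ cabs zw.1 <= r, cabs zw.2 <= r &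
      e + n%:R * cabs (zw.1 - zw.2) < `|f zw.1 - f zw.2|].
  move=> n; apply: contrapT => H; apply: noA; exists n%:R => // z w zr wr.
  by rewrite leNgt; apply/negP => h; apply: H; exists (z, w).
have [U [UU FU]] := ultraFilterLemma (eventually_filter : ProperFilter \oo).
have PU : ProperFilter U by exact: ultra_proper.
have zr n : cabs (zw n).1 <= r by case: (zwP n).
have [l lP] := ultra_bounded_cvgC UU zr.
move/continuous_cabsP : cf => /(_ l (e / 2) (divr_gt0 e0 (ltr0n _ 2))) [d d0 dP].
have d2 : 0 < d / 2 by rewrite divr_gt0.
have big : U [set n | (Num.truncn (2 * B / (d / 2))).+1 <= n]%N.
  by apply: FU; exists (Num.truncn (2 * B / (d / 2))).+1.
have [n [/= ln nn]] := filter_ex (filterI (lP _ d2) big).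
have [_ _ h] := zwP n.
have B0 : 0 <= B by rewrite (le_trans (normr_ge0 _) (fB 0)).
have hB : `|f (zw n).1 - f (zw n).2| <= 2 * B.
  by rewrite (le_trans (ler_normB _ _))//; have := fB (zw n).1; have := fB (zw n).2; lra.
have n0 : 0 < n%:R :> R by rewrite ltr0n (leq_trans _ nn).
have dist : cabs ((zw n).1 - (zw n).2) < d / 2.
  have nc : n%:R * cabs ((zw n).1 - (zw n).2) < 2 * B by lra.
  rewrite -(ltr_pM2l n0) (lt_le_trans nc)//.
  have q0 : 0 <= 2 * B / (d / 2) by rewrite divr_ge0 ?mulr_ge0// ltW.
  have /andP[_ /ltW k] := truncn_itv q0.
  rewrite -ler_pdivrMr// (le_trans k)// ler_nat.
  by [].
have := dP _ (lt_trans ln _ : cabs (l - (zw n).1) < d).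
move=> /(_ (_ : d / 2 < d)) h1.
have h2 : `|f l - f (zw n).2| < e / 2.
  apply: dP; apply: (le_lt_trans (cabs_triangle (zw n).1 _ _)); lra.
have {}h1 : `|f l - f (zw n).1| < e / 2 by apply: h1; lra.
have := ler_normB (f l - f (zw n).2) (f l - f (zw n).1).
rewrite (_ : f l - f (zw n).2 - (f l - f (zw n).1) = f (zw n).1 - f (zw n).2); last by ring.
have : 0 <= n%:R * cabs ((zw n).1 - (zw n).2) by rewrite mulr_ge0.
lra.
Qed.

Lemma cvg_sum_seq (I : Type) (U : set_system nat) (r : seq I) (u : I -> nat -> R) (l : I -> R) :
  Filter U -> (forall i, u i @ U --> l i) ->
  (\sum_(i <- r) u i n) @[n --> U] --> \sum_(i <- r) l i.
Proof.
move=> FU ul; elim: r => [|i r IH].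
  by rewrite big_nil; under eq_fun do rewrite big_nil; exact: cvg_cst.
by rewrite big_cons; under eq_fun do rewrite big_cons; exact: cvgD.
Qed.

Lemma modulus_continuous (h : R -> R) :
  (forall e : R, 0 < e -> exists2 A : R, 0 <= A & forall x y, `|h x - h y| <= e + A * `|x - y|) ->
  continuous h.
Proof.
move=> H x; apply/cvgrPdist_le => e e0.
have [A A0 HA] := H _ (divr_gt0 e0 (ltr0n _ 2)).
have d0 : 0 < e / (2 * (A + 1)) by rewrite divr_gt0// mulr_gt0// ltr_pwDr.
near=> y; apply: (le_trans (HA _ _)).
have xy : `|x - y| <= e / (2 * (A + 1)).
  near: y; have := @cvgr_dist_le _ _ _ (nbhs x) _ id x; apply => //.
have k : A * `|x - y| <= (A + 1) * (e / (2 * (A + 1))).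
  by apply: ler_pM => //; lra.
have E : (A + 1) * (e / (2 * (A + 1))) = e / 2 by field; apply: lt0r_neq0; lra.
rewrite E in k; lra.
Unshelve. all: by end_near. Qed.

Lemma peano_comp_modulus f (r e : R) : bcont f -> 0 < r -> 0 < e -> exists2 A, 0 <= A &
  forall s t : R, `|f (peano r s) - f (peano r t)| <= e + A * `|s - t|.
Proof.
move=> bf r0 e0.
have e2 : 0 < e / 2 by rewrite divr_gt0.
have [A A0 HA] := bcont_modulus (2 * r) bf e2.
have A1 : 0 < A + 1 by rewrite ltr_pwDr.
have [A' A'0 HA'] := peano_modulus r0 (divr_gt0 e2 A1).
exists (A * A'); first exact: mulr_ge0.
move=> s t; apply: (le_trans (HA _ _ (peano_bound _ r0) (peano_bound _ r0))).
have := ler_wpM2l A0 (HA' s t); rewrite mulrDr mulrA.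
have : A * (e / 2 / (A + 1)) <= e / 2.
  by rewrite mulrA ler_pdivrMr// mulrC ler_wpM2l ?(ltW e2)//; lra.
lra.
Qed.

Lemma measurable_peano_comp (r : R) (X : R -> R) : 0 < r -> measurable_fun setT X ->
  measurable_fun setT (peano r \o X).
Proof.
move=> r0 mX; apply: (measurability (@open R[i])) => // _ [A oA <-].
rewrite setTI comp_preimage -[X in measurable X]setTI; apply: mX => //.
apply: open_measurable; rewrite openE => t /= At.
have /(nbhs_cabs (peano r t)) [e e0 eA] : nbhs (peano r t) A by exact: open_nbhs_nbhs.
have [K K0 HK] := peano_modulus r0 (divr_gt0 e0 (ltr0n _ 2)).
apply/nbhs_ballP; exists (e / (2 * (K + 1))) => /=.
  by rewrite divr_gt0// mulr_gt0// ltr_pwDr.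
move=> y; rewrite /ball/= => ty; apply: eA; apply: (le_lt_trans (HK _ _)).
have k : K * `|t - y| <= K * (e / (2 * (K + 1))) by rewrite ler_wpM2l// ltW.
have E : K * (e / (2 * (K + 1))) < e / 2.
  rewrite mulrA ltr_pdivrMr ?mulr_gt0 ?ltr_pwDr//; lra.
lra.
Qed.

(** The default value 1 past the end, and the truncation to index 0 at negative arguments, make this
    monotone on the whole line for a sorted list in the unit interval. *)
Definition quantile (ts : seq R) (t : R) : R := nth 1 ts (Num.truncn (t * (size ts)%:R)).

Lemma quantile_mono (ts : seq R) : sorted <=%R ts -> (forall t, t \in ts -> 0 <= t <= 1) ->
  (forall u v, u <= v -> quantile ts u <= quantile ts v) /\
  (forall u, 0 <= quantile ts u <= 1).
Proof.
move=> sts t01; have q01 u : 0 <= quantile ts u <= 1.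
  rewrite /quantile; have [h|h] := ltnP (Num.truncn (u * (size ts)%:R)) (size ts).
    by apply: t01; exact: mem_nth.
  by rewrite nth_default// ler01 lexx.
split=> // u v uv; have [h|h] := ltnP (Num.truncn (v * (size ts)%:R)) (size ts); last first.
  by rewrite {2}/quantile nth_default//; case/andP: (q01 u).
have uv' : (Num.truncn (u * (size ts)%:R) <= Num.truncn (v * (size ts)%:R))%N.
  by apply: le_truncn; rewrite ler_wpM2r.
rewrite /quantile; apply: (sorted_leq_nth le_trans le_refl 1 sts) => //.
by rewrite inE; exact: leq_ltn_trans uv' h.
Qed.

Lemma quantile_sum (h : R -> R) (ts : seq R) : ts != [::] ->
  \sum_(j < size ts) h (quantile ts (j%:R / (size ts)%:R)) = \sum_(t <- ts) h t.
Proof.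
move=> ts0; have N0 : 0 < (size ts)%:R :> R by rewrite ltr0n lt0n size_eq0.
rewrite (big_nth 1) big_mkord; apply: eq_bigr => j _; rewrite /quantile; congr (h (nth _ _ _)).
by apply: truncn_def; rewrite divfK ?lt0r_neq0// lexx ltr_nat ltnSn.
Qed.

(** Helly's selection argument on the codes of the points. An ultralimit of measurable functions
    need not be measurable, but one of monotone functions is monotone; this is why the codes are
    sorted into quantile functions. The limit measure is the law of the curve at the limit
    quantile. *)
Lemma weak_limit (U : set_system nat) (xs : nat -> seq R[i]) (r : R) :
  UltraFilter U -> \oo `<=` U -> 0 < r -> (forall n x, x \in xs n -> cabs x <= r) ->
  (forall k, U [set n | k <= size (xs n)]%N) ->
  exists nu : probability R[i] R, forall f, bcont f ->
    avg f (xs n) @[n --> U] --> mean nu f.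
Proof.
move=> UU ooU r0 xr sU; have PU : ProperFilter U by exact: ultra_proper.
have /choice[code codeP] : forall p : nat * R[i], exists t,
    cabs p.2 <= r -> 0 <= t <= 1 /\ cabs (peano r t - p.2) <= 2^-1 ^+ p.1.
  move=> [n x] /=; have [xle|xle] := pselect (cabs x <= r); last by exists 0.
  have n2 : 0 < 2^-1 ^+ n :> R by rewrite exprn_gt0// invr_gt0.
  have [t t01 tx] := peano_dense r0 n2 xle.
  by exists t.
pose ts n := sort <=%R [seq code (n, x) | x <- xs n].
have sts n : size (ts n) = size (xs n) by rewrite size_sort size_map.
have ts01 n t : t \in ts n -> 0 <= t <= 1.
  by rewrite mem_sort => /mapP[x xx ->]; case: (codeP (n, x)) => //; exact: xr xx.
have tsq n := quantile_mono (sort_sorted le_total [seq code (n, x) | x <- xs n]) (@ts01 n).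
pose X n := quantile (ts n).
have X1 n t : `|X n t| <= 1.
  by have [_ /(_ t)/andP[h1 h2]] := tsq n; rewrite ger0_norm.
have /choice[sg sgP] : forall t, exists l : R, X n t @[n --> U] --> l.
  by move=> t; have [l _ lP] := ultra_bounded_cvg UU (X1^~ t); exists l.
have sgnd u v : u <= v -> sg u <= sg v.
  move=> uv; apply: (ler_cvg_to (sgP u) (sgP v)).
  by apply: nearW => n; case: (tsq n) => + _; exact.
have sg01 t : 0 <= sg t <= 1.
  apply/andP; split.
    apply: (ler_cvg_to (cvg_cst 0) (sgP t)); apply: nearW => n.
    by case: (tsq n) => _ /(_ t)/andP[].
  apply: (ler_cvg_to (sgP t) (@cvg_cst R 1 nat U _)); apply: nearW => n.
  by case: (tsq n) => _ /(_ t)/andP[].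
have msg : measurable_fun setT sg by apply: nondecreasing_measurable.
have mX n : measurable_fun setT (X n).
  by apply: nondecreasing_measurable => //; case: (tsq n).
have mps : @measurable_fun _ _ (g_sigma_algebraType (R.-ocitv.-measurable)) R[i] setT
  (peano r \o sg) := measurable_peano_comp r0 msg.
pose Y := mfun_Sub (mem_set mps : (peano r \o sg :
  g_sigma_algebraType (R.-ocitv.-measurable) -> R[i]) \in mfun).
exists (distribution (@unif01 R) Y) => f bf.
pose h t := f (peano r t).
have [B fB] := proj2 bf.
have hB t : `|h t| <= B by exact: fB.
have hc : continuous h.
  by apply: modulus_continuous => e e0; exact: peano_comp_modulus.
have mh : measurable_fun setT h by exact: continuous_measurable_fun.
have mhs : measurable_fun setT (h \o sg) by exact: measurableT_comp mh msg.
have -> : mean (distribution (@unif01 R) Y) f = \int[@unif01 R]_t h (sg t).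
  rewrite /mean /Rintegral integral_distribution//.
    exact: bcont_measurable bf.
  exact: (@unif01_integrable R (h \o sg) B mhs (fun t => hB (sg t))).
apply/cvgrPdist_le => e e0.
have e9 : 0 < e / 16 by rewrite divr_gt0.
have [A A0 HA] := peano_comp_modulus bf r0 e9.
have [A' A'0 HA'] := bcont_modulus (2 * r) bf e9.
(* The number of nodes is fixed before [n], because the ultralimit can be taken only at finitely
   many of them. The average over the points is compared with that over their codes, then with the
   integral for [X n], the sum over [K] nodes, the same sum for [sg] and the integral for [sg]; the
   errors add up to [9 * e / 16]. *)
pose K := (Num.truncn (A / (e / 16))).+1.
have K0 : (0 < K)%N by [].
have KR : 0 < K%:R :> R by rewrite ltr0n.
have AK : A / K%:R <= e / 16.
  rewrite ler_pdivrMr// mulrC -ler_pdivrMr//.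
  by have /andP[_ /ltW] := truncn_itv (divr_ge0 A0 (ltW e9)).
have [n0 n0P] := expr2V_small (divr_gt0 e9 (ltr_pwDr ltr01 A'0)).
have RK : (\sum_(j < K) h (X n (j%:R / K%:R))) @[n --> U] --> \sum_(j < K) h (sg (j%:R / K%:R)).
  apply: cvg_sum_seq => i; exact: (cvg_comp _ h (sgP (i%:R / K%:R)) (hc _)).
move/cvgrPdist_le : RK => /(_ (e / 16) e9) RK.
have big : U [set n | n0 <= n]%N by apply: ooU; exists n0.
apply: (@filterS _ U _ _ _ _ (filterI (sU K) (filterI big RK))) => n [/= Kn [/= nn RKn]].
have N0 : 0 < (size (xs n))%:R :> R by rewrite ltr0n (leq_trans _ Kn).
have xs0 : xs n != [::] by rewrite -size_eq0 -lt0n (leq_trans _ Kn).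
have ts0 : ts n != [::] by rewrite -size_eq0 sts size_eq0.
have c1 : `|avg f (xs n) - (\sum_(t <- ts n) h t) / (size (xs n))%:R| <= e / 16 + e / 16.
  rewrite (perm_big _ (permEl (perm_sort _ _)))/= big_map /avg -mulrBl -sumrB.
  rewrite normrM (gtr0_norm (_ : 0 < _^-1)) ?invr_gt0// ler_pdivrMr//.
  apply: (le_trans (ler_norm_sum _ _ _)).
  have -> : (e / 16 + e / 16) * (size (xs n))%:R = \sum_(x <- xs n) (e / 16 + e / 16).
    by rewrite sumr_const_seq.
  rewrite !big_seq; apply: ler_sum => x xx; have [_ cx] := codeP (n, x) (xr _ _ xx).
  have x2r : cabs x <= 2 * r by have := xr _ _ xx; lra.
  apply: (le_trans (HA' _ _ x2r (peano_bound _ r0))); rewrite lerD2l cabs_distC.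
  apply: (@le_trans _ _ (A' * 2^-1 ^+ n0)).
    rewrite ler_wpM2l// (le_trans cx)//= ler_wiXn2l//; lra.
  apply: (le_trans (ler_wpM2l A'0 n0P)); rewrite mulrA ler_pdivrMr ?ltr_pwDr//.
  by rewrite mulrC ler_wpM2l ?(ltW e9)//; lra.
have [Xnd X01] := tsq n.
have mhX : measurable_fun setT (h \o X n) by exact: measurableT_comp mh (mX n).
have tsn0 : (0 < size (ts n))%N by rewrite sts (leq_trans _ Kn).
have c2 := @monotone_riemann_sum R h (X n) B A (e / 16) (size (ts n)) tsn0 Xnd X01 mhX hB A0 HA.
have c3 := @monotone_riemann_sum R h (X n) B A (e / 16) K K0 Xnd X01 mhX hB A0 HA.
have c4 := @monotone_riemann_sum R h sg B A (e / 16) K K0 sgnd sg01 mhs hB A0 HA.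
have AN : A / (size (xs n))%:R <= e / 16.
  by rewrite (le_trans _ AK)// ler_wpM2l// lef_pV2 ?posrE// ler_nat.
have c5 : `|(\sum_(j < K) h (sg (j%:R / K%:R))) / K%:R - (\sum_(j < K) h (X n (j%:R / K%:R))) / K%:R| <= e / 16.
  rewrite -mulrBl normrM (gtr0_norm (_ : 0 < K%:R^-1)) ?invr_gt0// ler_pdivrMr//.
  by rewrite (le_trans RKn)// ler_peMr ?(ltW e9)// ler1n.
rewrite /X quantile_sum// sts in c2.
move: c1 c2 c3 c4 c5; rewrite !ler_norml.
move=> /andP[p1 q1] /andP[p2 q2] /andP[p3 q3] /andP[p4 q4] /andP[p5 q5].
by clear - p1 q1 p2 q2 p3 q3 p4 q4 p5 q5 AN AK e0; apply/andP; split; lra.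
Qed.

End WeakLimit.

(** * Energy, capacity and points with a large Vandermonde product *)

Section Energy.
Context {R : realType}.
Implicit Types (mu : probability R[i] R) (K : set R[i]) (z w : R[i]) (zs : seq R[i]).

Lemma measurable_neg_lne z : measurable_fun setT (fun w => - lne (cabs (z - w)%R)%:E)%E.
Proof.
apply: (emeasurable_fun_cvg (fun j w =>
  (- ln (Num.max (cabs (z - w)) (1 * expR (- j%:R))))%:E)) => [j|w _].
  apply/measurable_EFinP; apply: continuous_measurable_plane.
  have e0 : 0 < 1 * expR (- j%:R) :> R by rewrite mul1r expR_gt0.
  apply: (@lipschitz_continuous _ _ (1 * expR (- j%:R))^-1) => x y.
  rewrite opprK addrC.
  apply: (le_trans (ln_lip e0 _ _)); rewrite ?le_max ?lexx ?orbT//.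
  rewrite mulrC ler_wpM2l ?invr_ge0 ?(ltW e0)//; set b := 1 * _.
  have d : `|cabs (z - y) - cabs (z - x)| <= cabs (x - y).
    apply: (le_trans (ler_cabs_dist _ _)).
    by rewrite (_ : z - y - (z - x) = x - y)//; ring.
  exact: le_trans (max_lip _ _ _) d.
apply: neg_lne_cvg => //; exact: cabs_ge0.
Qed.

Section Supported.
Variables (K : set R[i]) (r : R).
Hypotheses (cK : compact K) (rK : forall z, K z -> cabs z <= r).

Let mK : measurable K. Proof. exact: compact_measurable_plane. Qed.

Lemma neg_log_potential mu M z : supported_in K mu -> 1 <= M -> cabs z + r <= M ->
  (\int[mu]_w (- lne (cabs (z - w)%R)%:E) = pot M mu z - (ln M)%:E)%E.
Proof.
move=> sK M1 zrM; rewrite -ge0_integral_shift ?ln_ge0//; last 2 first.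
- exact: measurable_kapoo.
- by move=> w; apply: kapoo_ge0 => //; exact: cabs_ge0.
apply: (supported_integral mK sK) => //.
- exact: measurable_neg_lne.
- by apply: emeasurable_funB => //; exact: measurable_kapoo.
move=> w Kw; apply: kapooE; have := cabsB z w; have := rK Kw; lra.
Qed.

Lemma log_energyE mu M : supported_in K mu -> 1 <= M -> 2 * r <= M ->
  (log_energy mu = en M mu - (ln M)%:E)%E.
Proof.
move=> sK M1 rM; rewrite /log_energy /en -ge0_integral_shift ?ln_ge0//; last 2 first.
- exact: measurable_pot.
- by move=> z; exact: pot_ge0.
apply: (supported_integral mK sK).
(* The shift in [neg_log_potential] has to grow with [z]. Measurability on the whole plane comes
   from shifts [Mk k], whose formulas become constant in [k] at each point. *)
- pose Mk (k : nat) : R := k%:R + `|r| + 1.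
  apply: (emeasurable_fun_cvg (fun k z => (pot (Mk k) mu z - (ln (Mk k))%:E)%E)) => [k|z _].
    apply: emeasurable_funB => //; apply: measurable_pot.
    by rewrite /Mk lerDr addr_ge0.
  apply: cvg_near_cst; exists (Num.truncn (cabs z)).+1 => // k /= zk.
  rewrite (@neg_log_potential mu (Mk k) z)// /Mk ?lerDr ?addr_ge0//.
  have /andP[_ h] := truncn_itv (cabs_ge0 z); have := ler_norm r.
  have : (Num.truncn (cabs z)).+1%:R <= k%:R :> R by rewrite ler_nat.
  lra.
- by apply: emeasurable_funB => //; exact: measurable_pot.
by move=> z Kz; apply: neg_log_potential => //; have := rK Kz; lra.
Qed.

End Supported.

(** [fine] turns an infinite infimum of either sign into capacity 0, so positive capacity makes the
    infimum a real number [V]; capacity below 1 makes it positive. *)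
Lemma capacity_energy K : 0 < capacity K < 1 -> exists V : R, [/\ 0 < V, capacity K = expR (- V),
  forall mu, supported_in K mu -> (V%:E <= log_energy mu)%E,
  forall e, 0 < e -> exists2 mu, supported_in K mu & (log_energy mu < (V + e)%:E)%E &
  forall mu, is_equilibrium K mu <-> supported_in K mu /\ log_energy mu = V%:E].
Proof.
rewrite /is_equilibrium /capacity; set S := [set _ | _ in _].
case E : (ereal_inf S) => [V| |] //=; rewrite ?ltxx// => /andP[_ cV].
have V0 : 0 < V by move: cV; rewrite expR_lt1 oppr_lt0.
exists V; split=> //.
- by move=> mu sK; rewrite -E; apply: ereal_inf_lbound; exists mu.
- move=> e e0; have fS : ereal_inf S \is a fin_num by rewrite E.
  have [_ [mu sK <-] h] := lb_ereal_inf_adherent e0 fS.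
  by exists mu => //; move: h; rewrite E -EFinD.
- move=> mu; split=> -[sK h]; split => //; last by rewrite h.
  move: h; case: (log_energy mu) => [x| |] //= -[]; first by move/expR_inj/oppr_inj->.
  by move=> h; have := expR_gt0 (- V); rewrite h ltxx.
Qed.

Section Derandomization.
Variables (K : set R[i]) (r M : R) (mu : probability R[i] R).
Hypotheses (cK : compact K) (rK : forall z, K z -> cabs z <= r)
  (M1 : 1 <= M) (rM : 2 * r <= M) (sK : supported_in K mu).

Let mK : measurable K. Proof. exact: compact_measurable_plane. Qed.

Lemma supported_exists_le (f : R[i] -> \bar R) (a : R) : measurable_fun setT f ->
  (forall z, (0 <= f z)%E) -> (\int[mu]_z f z < a%:E)%E -> exists2 z, K z & (f z <= a%:E)%E.
Proof.
move=> mf f0 fa; apply: contrapT => H.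
have a0 : (0 <= a%:E)%E by rewrite ltW// (le_lt_trans _ fa)// integral_ge0.
move: fa; apply/negP; rewrite -leNgt.
rewrite -(integral_prob_cst mu a).
apply: (supported_le mK sK) => // z Kz.
by apply: ltW; rewrite ltNge; apply/negP => h; apply: H; exists z.
Qed.

Fixpoint pair_energy zs : \bar R :=
  if zs is z :: s then ((\sum_(w <- s) kapoo M (cabs (z - w)%R)) + pair_energy s)%E else 0%E.

Lemma pair_energy_ge0 zs : (0 <= pair_energy zs)%E.
Proof.
elim: zs => //= z s IH; rewrite adde_ge0// sume_ge0// => w _.
by apply: kapoo_ge0 => //; exact: cabs_ge0.
Qed.

(** The method of conditional expectations. With [s] points still to be drawn, the left side is the
    part of the expected energy that depends on the chosen points. The new point is taken where the
    contribution depending on it exceeds its mean by at most [eta]. *)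
Lemma low_energy_points (E eta : R) p s : en M mu = E%:E -> 0 < eta ->
  exists zs, [/\ size zs = p, forall z, z \in zs -> K z &
   (pair_energy zs + s%:R%:E * \sum_(z <- zs) pot M mu z <=
     (('C(p, 2) + s * p)%:R * E + p%:R * eta)%:E)%E].
Proof.
move=> enE eta0; elim: p s => [|p IH] s.
  exists [::]; split => //; rewrite big_nil mule0 adde0 /=.
  by rewrite muln0 addn0 bin0n /= !mul0r addr0.
have [zs [szs zsK zsE]] := IH s.+1.
have E0 : 0 <= E by rewrite -lee_fin -enE integral_ge0// => z _; exact: pot_ge0.
have k0 z w : (0 <= kapoo M (cabs (z - w)%R))%E by apply: kapoo_ge0 => //; exact: cabs_ge0.
have p0 z : (0 <= pot M mu z)%E by exact: pot_ge0.
have mk w : measurable_fun setT (fun z => kapoo M (cabs (z - w)%R)).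
  by under eq_fun do rewrite cabs_distC; exact: measurable_kapoo.
pose f z : \bar R := (\sum_(w <- zs) kapoo M (cabs (z - w)%R) + s%:R%:E * pot M mu z)%E.
have mf : measurable_fun setT f.
  apply: emeasurable_funD; first by apply: emeasurable_sum => w; exact: mk.
  by apply: measurable_funeM; exact: measurable_pot.
have f0 z : (0 <= f z)%E by rewrite adde_ge0 ?sume_ge0 ?mule_ge0// lee_fin.
have sp0 : (0 <= \sum_(z <- zs) pot M mu z)%E by apply: sume_ge0 => z _.
have If : (\int[mu]_z f z = \sum_(z <- zs) pot M mu z + (s%:R * E)%:E)%E.
  rewrite ge0_integralD//; last 4 first.
  - by move=> z _; exact: sume_ge0.
  - by apply: emeasurable_sum => w; exact: mk.
  - by move=> z _; rewrite mule_ge0// lee_fin.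
  - by apply: measurable_funeM; exact: measurable_pot.
  congr (_ + _)%E.
    rewrite ge0_integral_sum//; apply: eq_bigr => w _.
    by apply: eq_integral => z _; rewrite cabs_distC.
  rewrite ge0_integralZl_EFin//; last exact: measurable_pot.
  by rewrite -/(en M mu) enE -EFinM.
have pe0 := pair_energy_ge0 zs.
have spfin : (\sum_(z <- zs) pot M mu z)%E \is a fin_num.
  rewrite ge0_fin_numE//; apply: le_lt_trans (ltry _); apply: le_trans zsE.
  rewrite -[leLHS]add0e leeD// -[leLHS]mul1e lee_wpmul2r// lee_fin ler1n.
  by [].
have pefin : pair_energy zs \is a fin_num.
  rewrite ge0_fin_numE//; apply: le_lt_trans (ltry _); apply: le_trans zsE.
  by rewrite leeDl// mule_ge0// lee_fin.
set S := (\sum_(z <- zs) pot M mu z)%E in zsE sp0 If spfin.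
have SE : S = (fine S)%:E by rewrite fineK.
have PE : pair_energy zs = (fine (pair_energy zs))%:E by rewrite fineK.
have [z Kz fz] : exists2 z, K z & (f z <= (fine S + s%:R * E + eta)%:E)%E.
  apply: supported_exists_le => //; rewrite If SE -EFinD lte_fin; lra.
exists (z :: zs); split; first by rewrite /= szs.
  by move=> x; rewrite inE => /predU1P[->//|]; exact: zsK.
rewrite /= big_cons -/S ge0_muleDr//.
have -> : (\sum_(w <- zs) kapoo M (cabs (z - w)%R) + pair_energy zs +
    (s%:R%:E * pot M mu z + s%:R%:E * S) = f z + (pair_energy zs + s%:R%:E * S))%E.
  by rewrite /f addeACA.
apply: (@le_trans _ _ ((fine S + s%:R * E + eta)%:E + (pair_energy zs + s%:R%:E * S))%E).
  by rewrite leeD2r.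
move: zsE; rewrite SE PE -!EFinM -!EFinD !lee_fin => zsE.
have -> : ('C(p.+1, 2) + s * p.+1 = 'C(p, 2) + s.+1 * p + s)%N by rewrite binS bin1; lia.
rewrite natrD mulrDl -[p.+1%:R]natr1 mulrDl mul1r.
move: zsE; rewrite -[s.+1%:R]natr1; lra.
Qed.

(** A coincidence would make the energy infinite; between distinct points of [K] the cap at [M] is
    inactive. *)
Lemma pair_energy_vandermonde zs : (forall z, z \in zs -> K z) -> (pair_energy zs < +oo)%E ->
  0 < vandermonde zs /\
  pair_energy zs = ('C(size zs, 2)%:R * ln M - ln (vandermonde zs))%:E.
Proof.
elim: zs => [|z s IH] zK /=; first by rewrite ltr01 ln1 bin0n mul0r subr0.
have kk w : (0 <= kapoo M (cabs (z - w)%R))%E by apply: kapoo_ge0 => //; exact: cabs_ge0.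
move=> fin; have sfin : (pair_energy s < +oo)%E.
  by apply: le_lt_trans fin; rewrite leeDr// sume_ge0.
have kfin : (\sum_(w <- s) kapoo M (cabs (z - w)%R) < +oo)%E.
  by apply: le_lt_trans fin; rewrite leeDl// pair_energy_ge0.
have [|v0 ->] := IH _ sfin; first by move=> w ws; apply: zK; rewrite inE ws orbT.
have : 0 < \prod_(w <- s) cabs (z - w) /\
    (\sum_(w <- s) kapoo M (cabs (z - w)%R) = ((size s)%:R * ln M - ln (\prod_(w <- s) cabs (z - w)%R))%:E)%E.
  have sK' w : w \in s -> cabs (z - w) <= M.
    move=> ws; have := cabsB z w; have := rK (zK z (mem_head _ _)).
    have wz : w \in z :: s by rewrite inE ws orbT.
    have := rK (zK w wz); move: rM; lra.
  elim: s {IH sfin v0 fin zK} kfin sK' => [|w s IH] kfin sM.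
    by rewrite !big_nil ltr01 ln1 mul0r subr0.
  rewrite !big_cons in kfin *.
  have sM' x : x \in s -> cabs (z - x) <= M by move=> xs; apply: sM; rewrite inE xs orbT.
  have [|p0 ->] := IH _ sM'; first by apply: le_lt_trans kfin; rewrite leeDr.
  have c0 : 0 < cabs (z - w).
    rewrite lt_neqAle cabs_ge0 andbT; apply/negP => /eqP c0; move: kfin.
    rewrite -c0 /kapoo le0_lneNy ?lee_fin ?ge_min ?lexx//=.
    have s0 : (0 <= \sum_(x <- s) kapoo M (cabs (z - x)%R))%E by exact: sume_ge0.
    by rewrite addye//; apply/eqP => h; rewrite h in s0.
  split; first exact: mulr_gt0.
  rewrite kapoo_pos// min_l ?sM ?mem_head// -EFinD lnM ?posrE//; congr EFin.
  by rewrite /= -[(size s).+1%:R]natr1; ring.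
move=> [p0 ->]; split; first exact: mulr_gt0.
by rewrite -EFinD lnM ?posrE// binS bin1 natrD; congr EFin; ring.
Qed.

End Derandomization.

Lemma fekete_lower_bound K (V : R) : compact K ->
  (forall e, 0 < e -> exists2 mu, supported_in K mu & (log_energy mu < (V + e)%:E)%E) ->
  forall p e, 0 < e -> exists zs, [/\ size zs = p, forall z, z \in zs -> K z &
     expR (- ((V + e) * 'C(p, 2)%:R)) <= vandermonde zs].
Proof.
move=> cK HV p e e0; have [r r0 rK] := compact_cabs_bounded cK.
have [mu sK muV] := HV (e / 2) (divr_gt0 e0 (ltr0n _ 2)).
pose M := 2 * r + 1; have M1 : 1 <= M by rewrite /M lerDr mulr_ge0// ltW.
have rM : 2 * r <= M by rewrite /M lerDl.
rewrite (log_energyE cK rK sK M1 rM) in muV.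
have en0 : (0 <= en M mu)%E by apply: integral_ge0 => z _; exact: pot_ge0.
have enfin : en M mu \is a fin_num.
  by rewrite ge0_fin_numE// ltey; apply/eqP => h; move: muV; rewrite h.
have enE : en M mu = (fine (en M mu))%:E by rewrite fineK.
rewrite enE -EFinB lte_fin in muV.
have eta0 : 0 < e / (2 * p.+1%:R) by rewrite divr_gt0// mulr_gt0.
have [zs [szs zsK]] := low_energy_points cK M1 rM sK p 0 enE eta0.
rewrite mul0e adde0 mul0n addn0 => zsE; exists zs; split=> //.
have [|v0 vE] := pair_energy_vandermonde rK M1 rM zsK; first exact: le_lt_trans zsE (ltry _).
rewrite vE szs lee_fin in zsE.
rewrite -[leRHS]lnK ?posrE// ler_expR.
(* With at most one point there are no pairs to absorb the error terms, but then the Vandermonde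
   product is 1. *)
have pe : p%:R * (e / (2 * p.+1%:R)) <= e / 2 * 'C(p, 2)%:R \/ (p <= 1)%N.
  have [p1|p1] := leqP p 1; [by right|left].
  have C1 : 1 <= 'C(p, 2)%:R :> R by rewrite ler1n bin_gt0.
  apply: (@le_trans _ _ (e / 2)); last by rewrite ler_peMr// ltW// divr_gt0.
  have -> : p%:R * (e / (2 * p.+1%:R)) = e / 2 * (p%:R / p.+1%:R) by rewrite invfM; ring.
  rewrite ler_piMr// ?divr_ge0 ?(ltW e0)//.
  by rewrite ler_pdivrMr// mul1r ler_nat.
case: pe => [pe|p1].
  have : 'C(p, 2)%:R * (fine (en M mu) - ln M) <= 'C(p, 2)%:R * (V + e / 2).
    by rewrite ler_wpM2l// ltW.
  have aux (c f l v q : R) : c * l - v <= c * f + q -> q <= e / 2 * c ->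
      c * (f - l) <= c * (V + e / 2) -> - ((V + e) * c) <= v.
    by move=> *; nra.
  exact: aux zsE pe.
rewrite bin_small// mulr0 oppr0.
by move: szs p1; case: zs {zsK v0 vE zsE} => [|z [|? ?]] <-//= _; rewrite ?big_nil ?mulr1 ln1.
Qed.

End Energy.

(** * The power series of the logarithm on the closed unit interval *)

Section LogSeries.
Context {R : realType}.

Definition logsum (n : nat) (t : R) : R := \sum_(k < n) t ^+ k.+1 / k.+1%:R.

Lemma is_derive_logsum n (t : R) : is_derive t 1 (logsum n) (\sum_(k < n) t ^+ k).
Proof.
elim: n => [|n IH].
  rewrite (_ : logsum 0 = cst 0) ?big_ord0; first exact: is_derive_cst.
  by apply/funext => x; rewrite /logsum big_ord0.
have h := is_deriveZ (n.+1%:R^-1 : R) (is_deriveX n.+1 (is_derive_id t (1 : R))).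
refine (eq_ind _ (fun P => P) (is_deriveD IH h) _ _); congr (is_derive t 1 _ _).
  by apply/funext => x; rewrite !fctE /logsum big_ord_recr/= mulrC.
by rewrite big_ord_recr /= scaler1 /GRing.scale/= mulKf// pnatr_eq0.
Qed.

Lemma ge0_derive_le (f df : R -> R) (t : R) : 0 <= t ->
  (forall x, 0 <= x <= t -> is_derive x 1 f (df x)) ->
  (forall x, 0 <= x <= t -> 0 <= df x) -> f 0 <= f t.
Proof.
move=> t0 fd df0; have [c cI E] : exists2 c, c \in `[0, t] & f t - f 0 = df c * (t - 0).
  apply: MVT_segment => //.
    by move=> x; rewrite in_itv/= => /andP[/ltW x0 /ltW xt]; apply: fd; rewrite x0.
  by apply: derivable_within_continuous => x; rewrite in_itv/= => /fd xt; exact: ex_derive.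
by rewrite -subr_ge0 E subr0 mulr_ge0// df0.
Qed.

Lemma is_derive_neg_ln1B (x : R) : x < 1 -> is_derive x 1 (fun x : R => - ln (1 - x)) (1 - x)^-1.
Proof.
move=> x1; have x10 : 0 < 1 - x by rewrite subr_gt0.
have dl : is_derive (1 - x) 1 (@ln R) (1 - x)^-1 by exact: is_derive1_ln.
have ds := is_deriveB (is_derive_cst (1 : R) x (1 : R)) (is_derive_id x (1 : R)).
refine (eq_ind _ (fun P => P) (is_deriveN (@is_derive1_comp R (@ln R) (cst 1 - id) x _ _ dl ds)) _ _).
by congr (is_derive x 1 _ _); rewrite sub0r mulrN1 opprK.
Qed.

Lemma geometric_sumE n (x : R) : x < 1 ->
  (1 - x)^-1 - \sum_(k < n) x ^+ k = x ^+ n / (1 - x).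
Proof.
move=> x1; have x10 : 1 - x != 0 by rewrite lt0r_neq0// subr_gt0.
apply: (mulIf x10); rewrite mulrBl mulVf// divfK//.
rewrite -[RHS](subrK 1) subrX1; ring.
Qed.

Lemma logsum_lower n (t : R) : 0 <= t < 1 -> logsum n t <= - ln (1 - t).
Proof.
move=> /andP[t0 t1]; rewrite -subr_ge0.
have -> : 0 = - ln (1 - 0) - logsum n 0 :> R.
  rewrite subr0 ln1 oppr0 sub0r /logsum big1 ?oppr0// => k _.
  by rewrite expr0n mul0r.
apply: (@ge0_derive_le (fun x => - ln (1 - x) - logsum n x)
    (fun x => (1 - x)^-1 - \sum_(k < n) x ^+ k)) => // x /andP[x0 xt].
  exact: is_deriveB (is_derive_neg_ln1B (le_lt_trans xt t1)) (is_derive_logsum n x).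
rewrite geometric_sumE ?(le_lt_trans xt)// divr_ge0 ?exprn_ge0//.
by rewrite subr_ge0 (le_trans xt)// ltW.
Qed.

(** The terms [x ^ n / (1 - x)] cancel in the derivative of right side minus left side, leaving
    [n * x ^ (n - 1) * - ln (1 - x)], which is nonnegative. *)
Lemma logsum_upper n (t : R) : 0 <= t < 1 ->
  - ln (1 - t) - logsum n t <= t ^+ n * (- ln (1 - t)).
Proof.
move=> /andP[t0 t1]; rewrite -subr_ge0.
pose f (x : R) := x ^+ n * (- ln (1 - x)) - (- ln (1 - x) - logsum n x).
have -> : 0 = f 0.
  rewrite /f subr0 ln1 !oppr0 mulr0 !sub0r opprK /logsum big1// => k _.
  by rewrite expr0n mul0r.
apply: (@ge0_derive_le f (fun x => n%:R * x ^+ n.-1 * (- ln (1 - x)))) => // x /andP[x0 xt].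
  have x1 := le_lt_trans xt t1.
  have dX := is_deriveX n (is_derive_id x (1 : R)).
  have dl := is_derive_neg_ln1B x1.
  refine (eq_ind _ (fun P => P) (is_deriveB (is_deriveM dX dl) (is_deriveB dl (is_derive_logsum n x))) _ _).
  congr (is_derive x 1 _ _); first by apply/funext => y; rewrite !fctE.
  rewrite [X in _ - X]geometric_sumE// scaler1 /GRing.scale/= !fctE.
  by ring.
have x10 : 0 < 1 - x by rewrite subr_gt0 (le_lt_trans xt).
rewrite !mulr_ge0 ?exprn_ge0// oppr_ge0 -ln1 ler_ln ?posrE// gerBl//.
Qed.

(** The endpoint 1, where the harmonic series diverges, corresponds to the diagonal of the
    logarithmic kernel. *)
Lemma logsum_cvg (t : R) : 0 <= t <= 1 -> ((logsum n t)%:E @[n --> \oo] --> - lne (1 - t)%:E)%E.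
Proof.
move=> /andP[t0]; rewrite le_eqVlt => /predU1P[->|t1].
  rewrite subrr le0_lneNy ?lee_fin//=; apply/cvgeyPge => B.
  have := @nondecreasing_dvgn_lt R (series harmonic).
  move=> /(_ (nondecreasing_series (fun i _ _ => harmonic_ge0 i)) (@dvg_harmonic R)).
  move/cvgryPge => /(_ B); apply: filterS => n; rewrite lee_fin /logsum.
  rewrite /series/= big_mkord => h; apply: (le_trans h).
  by rewrite ler_sum// => k _; rewrite expr1n mul1r.
have t10 : 0 < 1 - t by rewrite subr_gt0.
rewrite lne_EFin// -EFinN; apply/cvg_EFin; first by near=> n.
apply/cvgrPdist_le => e e0.
have : t ^+ n * (- ln (1 - t)) @[n --> \oo] --> 0 * (- ln (1 - t)).
  by apply: cvgMl; apply: cvg_expr; rewrite ger0_norm.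
rewrite mul0r => /cvgrPdist_le /(_ e e0); apply: filterS => n /=.
rewrite sub0r normrN => h; have /andP[] : 0 <= - ln (1 - t) - logsum n t <= e.
  rewrite subr_ge0 logsum_lower ?t0//=; apply: le_trans (le_trans (ler_norm _) h).
  by apply: logsum_upper; rewrite t0.
by move=> h1 h2; rewrite ger0_norm.
Unshelve. all: by end_near. Qed.

End LogSeries.

(** * The average of two probability measures *)

Section Mixture.
Context {R : realType}.

(** Supplies the competitor in the uniqueness proof, the midpoint of two energy minimizers. *)
Lemma mixture_exists (mu nu : probability R[i] R) : exists la : probability R[i] R,
  (forall K, supported_in K mu -> supported_in K nu -> supported_in K la) /\
  forall f, bcont f -> mean la f = 2^-1 * mean mu f + 2^-1 * mean nu f.
Proof.
have h0 : 0 <= 2^-1 :> R by rewrite invr_ge0.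
pose h := NngNum h0.
pose F (n : nat) : {measure set R[i] -> \bar R} := if n is 0%N then mscale h mu else mscale h nu.
have mE A : msum F 2 A = (2^-1%:E * mu A + 2^-1%:E * nu A)%E by exact: measure_addE.
have m1 : msum F 2 setT = 1%E.
  rewrite mE (probability_setT mu) (probability_setT nu).
  by rewrite !mule1 -EFinD; congr EFin; lra.
pose pm := Measure_isProbability.Build _ _ _ (msum F 2) m1.
pose la : probability R[i] R := HB.pack (msum F 2) pm.
exists la; split; first by rewrite /supported_in => K h1 h2; rewrite /= mE h1 h2 !mule0 adde0.
have nn f : bcont f -> (forall z, 0 <= f z) -> mean la f = 2^-1 * mean mu f + 2^-1 * mean nu f.
  move=> bf f0; have mf : measurable_fun setT (EFin \o f).
    exact: bcont_measurable bf.
  apply: EFin_inj; rewrite EFinD !EFinM -!meanE//.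
  rewrite [LHS](@ge0_integral_measure_add _ _ R (mscale h mu) (mscale h nu))//; last by move=> z _; rewrite lee_fin.
  by rewrite !ge0_integral_mscale// => z _; rewrite lee_fin.
move=> f bf; have [B fB] := proj2 bf.
have bB := bcont_cst (R := R) B.
have := nn _ (bcontD bf bB); rewrite !meanD// !mean_cst => h1.
have {}h1 := h1 (fun z => _).
have -> : mean la f = mean la f + B - B by ring.
rewrite h1; first by lra.
by move=> z; have := ler_normlW (fB z) ; rewrite -lerBlDr sub0r; have := fB z; rewrite ler_norml => /andP[].
Qed.

End Mixture.

(** * The chordal metric as a positive definite kernel *)

Section Chordal.
Context {R : realType}.
Implicit Types (z w : R[i]).

Definition sqA z : R := 1 + cabs z ^+ 2.

(** Real coordinates of the orthogonal projector onto the complex line through the vector with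
    entries 1 and [z]; the root of 2 accounts for the two conjugate off-diagonal entries in the
    trace form. *)
Definition feat (i : 'I_4) z : R :=
  nth 0 [:: 1; cabs z ^+ 2; Num.sqrt 2 * complex.Re z; Num.sqrt 2 * complex.Im z] i / sqA z.

Lemma sqA_ge1 z : 1 <= sqA z.
Proof. by rewrite /sqA lerDl sqr_ge0. Qed.

Lemma sqA_gt0 z : 0 < sqA z.
Proof. exact: lt_le_trans (sqA_ge1 z). Qed.

Lemma sqA_continuous : continuous sqA.
Proof.
move=> z; rewrite /sqA; apply: cvgD; [exact: nbhs_filter|by apply: (bcont_cst (1:R)).1|].
rewrite expr2; under eq_fun do rewrite expr2.
by apply: cvgM; [exact: nbhs_filter|exact: cabs_continuous|exact: cabs_continuous].
Qed.

Lemma bcont_feat i : bcont (feat i).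
Proof.
have cV : continuous (fun z => (sqA z)^-1).
  move=> z; apply: cvgV; [exact: nbhs_filter|by rewrite lt0r_neq0 ?sqA_gt0|exact: sqA_continuous].
have cR : continuous (fun z => complex.Re z).
  by apply: (@lipschitz_continuous _ _ 1) => z w; rewrite mul1r -raddfB cabs_ge_Re.
have cI : continuous (fun z => complex.Im z).
  by apply: (@lipschitz_continuous _ _ 1) => z w; rewrite mul1r -raddfB cabs_ge_Im.
have cs (f : R[i] -> R) : continuous f -> continuous (fun z => Num.sqrt 2 * f z).
  by move=> cf z; apply: cvgM; [exact: nbhs_filter|apply: (bcont_cst (Num.sqrt 2:R)).1|exact: cf].
have s2 : Num.sqrt 2 <= 2 :> R.
  by rewrite -ler_sqr ?nnegrE ?sqrtr_ge0// sqr_sqrtr//; lra.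
have s20 : 0 <= Num.sqrt 2 :> R by rewrite sqrtr_ge0.
split.
  move=> z; apply: cvgM; [exact: nbhs_filter| |exact: cV].
  case: i => -[|[|[|[|//]]]] ilt /=.
  - by apply: (bcont_cst (1:R)).1.
  - rewrite expr2; under eq_fun do rewrite expr2.
    by apply: cvgM; [exact: nbhs_filter|exact: cabs_continuous|exact: cabs_continuous].
  - exact: cs.
  - exact: cs.
exists 1 => z; rewrite /feat normrM (gtr0_norm (_ : 0 < (sqA z)^-1)) ?invr_gt0 ?sqA_gt0//.
rewrite ler_pdivrMr ?sqA_gt0// mul1r.
have c0 := cabs_ge0 z.
have hs (x : R) : `|x| <= cabs z -> `|Num.sqrt 2 * x| <= sqA z.
  move=> xz; rewrite normrM ger0_norm// (@le_trans _ _ (2 * cabs z))//; first exact: ler_pM.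
  by rewrite /sqA -subr_ge0 (_ : _ - _ = (1 - cabs z) ^+ 2) ?sqr_ge0//; ring.
case: i => -[|[|[|[|//]]]] ilt /=; rewrite ?normr1 ?sqA_ge1//.
- by rewrite ger0_norm ?sqr_ge0// /sqA lerDr.
- by apply: hs; exact: cabs_ge_Re.
- by apply: hs; exact: cabs_ge_Im.
Qed.

(* [chord z w = |1 + z w^*| ^ 2 / (sqA z * sqA w)], so that up to a function of
   [z] plus a function of [w] the kernel [- ln |z - w|] is
   [- ln (1 - chord z w) / 2], a power series in [chord] with positive
   coefficients. *)
Definition chord z w : R := \sum_i feat i z * feat i w.

Lemma chordE z w : 1 - chord z w = cabs (z - w) ^+ 2 / (sqA z * sqA w).
Proof.
have Az := lt0r_neq0 (sqA_gt0 z); have Aw := lt0r_neq0 (sqA_gt0 w).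
rewrite /chord /feat !big_ord_recl big_ord0 /= addr0.
have s2 : Num.sqrt 2 * Num.sqrt 2 = 2 :> R by rewrite -expr2 sqr_sqrtr.
apply: (mulIf (mulf_neq0 Az Aw)); rewrite divfK ?mulf_neq0//.
set q := Num.sqrt 2 in s2 *.
transitivity (sqA z * sqA w - (1 + cabs z ^+ 2 * cabs w ^+ 2 + q * q * (complex.Re z * complex.Re w)
   + q * q * (complex.Im z * complex.Im w))).
  by field; rewrite Az Aw.
rewrite s2 /sqA !sqr_cabs !raddfB /=; ring.
Qed.

Lemma chord01 z w : 0 <= chord z w <= 1.
Proof.
have Az := sqA_gt0 z; have Aw := sqA_gt0 w.
have AA : 0 < sqA z * sqA w by rewrite mulr_gt0.
have -> : chord z w = 1 - cabs (z - w) ^+ 2 / (sqA z * sqA w) by rewrite -chordE; ring.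
rewrite gerBl divr_ge0 ?sqr_ge0 ?(ltW AA)// andbT subr_ge0 ler_pdivrMr// mul1r.
rewrite /sqA !sqr_cabs !raddfB /=.
case: z {Az AA} => x y; case: w {Aw} => u v /=; rewrite -subr_ge0.
rewrite (_ : _ - _ = (1 + x * u + y * v) ^+ 2 + (x * v - y * u) ^+ 2) ?addr_ge0 ?sqr_ge0//.
by ring.
Qed.

Definition fmon k (v : {ffun 'I_k -> 'I_4}) z : R := \prod_(j < k) feat (v j) z.

Lemma bcont_fmon k (v : {ffun 'I_k -> 'I_4}) : bcont (fmon v).
Proof.
rewrite /fmon; elim: (index_enum _) => [|j s IH].
  under eq_fun do rewrite big_nil; exact: bcont_cst.
by under eq_fun do rewrite big_cons; apply: bcontM => //; exact: bcont_feat.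
Qed.

Lemma chordX k z w : chord z w ^+ k = \sum_(v : {ffun 'I_k -> 'I_4}) fmon v z * fmon v w.
Proof.
rewrite -[in LHS](card_ord k) -prodr_const /chord.
rewrite (bigA_distr_bigA (fun _ i => feat i z * feat i w)) /=.
by apply: eq_bigr => v _; rewrite big_split.
Qed.

End Chordal.

(** * Energies of kernels that are monotone limits of positive definite sums *)

Section PositiveKernel.
Context {R : realType}.
Variables (I : nat -> finType) (g : forall k, I k -> R[i] -> R) (beta : R[i] -> R).
Hypotheses (bg : forall k v, bcont (@g k v)) (bb : bcont beta) (b0 : forall z, 0 <= beta z)
  (g0 : forall k z w, 0 <= \sum_v @g k v z * @g k v w).
Variable kappa : R[i] -> R[i] -> \bar R.

(** The term in [beta] contributes linearly in the measure to the energy, so it cancels in the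
    parallelogram identity; only the squares of the means remain. *)
Definition psum n z w : R := \sum_(k < n) \sum_v @g k v z * @g k v w + (beta z + beta w).

Hypothesis psum_cvg : forall z w, (psum n z w)%:E @[n --> \oo] --> kappa z w.

Implicit Types mu nu : probability R[i] R.

Definition ppot n mu z : R :=
  \sum_(k < n) \sum_v mean mu (@g k v) * @g k v z + (beta z + mean mu beta).

Definition pen n mu : R := \sum_(k < n) \sum_v mean mu (@g k v) ^+ 2 + mean mu beta *+ 2.

Lemma bcont_psum n z : bcont (psum n z).
Proof.
apply: bcontD; last by apply: bcontD => //; exact: bcont_cst.
by apply: bcont_sum => k; apply: bcont_sum => v; exact: bcontZ.
Qed.

Lemma mean_psum n mu z : mean mu (psum n z) = ppot n mu z.
Proof.
have bc : bcont (fun=> beta z) by exact: bcont_cst.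
rewrite meanD; [|by apply: bcont_sum => k; apply: bcont_sum => v; exact: bcontZ|exact: bcontD].
rewrite meanD// mean_cst mean_sum; last by move=> k; apply: bcont_sum => v; exact: bcontZ.
congr (_ + _); apply: eq_bigr => k _; rewrite mean_sum; last by move=> v; exact: bcontZ.
by apply: eq_bigr => v _; rewrite meanZ// mulrC.
Qed.

Lemma bcont_ppot n mu : bcont (ppot n mu).
Proof.
apply: bcontD; last by apply: bcontD => //; exact: bcont_cst.
by apply: bcont_sum => k; apply: bcont_sum => v; exact: bcontZ.
Qed.

Lemma mean_ppot n mu : mean mu (ppot n mu) = pen n mu.
Proof.
have bc : bcont (fun=> mean mu beta) by exact: bcont_cst.
rewrite meanD; [|by apply: bcont_sum => k; apply: bcont_sum => v; exact: bcontZ|exact: bcontD].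
rewrite meanD// mean_cst mean_sum; last by move=> k; apply: bcont_sum => v; exact: bcontZ.
congr (_ + _); apply: eq_bigr => k _; rewrite mean_sum; last by move=> v; exact: bcontZ.
by apply: eq_bigr => v _; rewrite meanZ.
Qed.

Lemma psum_ge0 n z w : 0 <= psum n z w.
Proof. by rewrite addr_ge0 ?addr_ge0// sumr_ge0. Qed.

Lemma psum_mono m n z w : (m <= n)%N -> psum m z w <= psum n z w.
Proof.
move=> mn; rewrite lerD2r -!(big_mkord xpredT (fun k => \sum_v @g k v z * @g k v w)).
by rewrite [leRHS](@big_cat_nat _ _ _ m)//= lerDl sumr_ge0.
Qed.

Lemma measurable_kappa z : measurable_fun setT (kappa z).
Proof.
apply: (emeasurable_fun_cvg (fun n w => (psum n z w)%:E)) => // n.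
exact: bcont_measurable (bcont_psum n z).
Qed.

Lemma ppot_cvg mu z : (ppot n mu z)%:E @[n --> \oo] --> (\int[mu]_w kappa z w)%E.
Proof.
rewrite (_ : (fun n => _) = fun n => (\int[mu]_w (psum n z w)%:E)%E); last first.
  by apply/funext => n; rewrite meanE ?mean_psum//; exact: bcont_psum.
apply: monotone_cvg => //.
- by move=> n; exact: bcont_measurable (bcont_psum n z).
- by move=> n w; rewrite lee_fin psum_ge0.
- by move=> w m n mn; rewrite lee_fin psum_mono.
Qed.

Lemma ppot_mono m n mu z : (m <= n)%N -> ppot m mu z <= ppot n mu z.
Proof. by move=> mn; rewrite -!mean_psum; apply: mean_le; try exact: bcont_psum; move=> w; exact: psum_mono. Qed.

Lemma pen_cvg mu : (pen n mu)%:E @[n --> \oo] --> (\int[mu]_z \int[mu]_w kappa z w)%E.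
Proof.
rewrite (_ : (fun n => _) = fun n => (\int[mu]_z (ppot n mu z)%:E)%E); last first.
  by apply/funext => n; rewrite meanE ?mean_ppot//; exact: bcont_ppot.
apply: monotone_cvg => //.
- by move=> n; exact: bcont_measurable (bcont_ppot n mu).
- move=> n z; rewrite lee_fin -mean_psum -(mean_cst mu 0).
  by apply: mean_le => [||w]; [exact: bcont_cst|exact: bcont_psum|exact: psum_ge0].
- by move=> z m n mn; rewrite lee_fin ppot_mono.
- by move=> z; exact: ppot_cvg.
Qed.

Lemma measurable_ppot mu : measurable_fun setT (fun z => \int[mu]_w kappa z w)%E.
Proof.
apply: (emeasurable_fun_cvg (fun n z => (ppot n mu z)%:E)) => [n|z _]; last exact: ppot_cvg.
exact: bcont_measurable (bcont_ppot n mu).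
Qed.

Lemma pen_le mu n : ((pen n mu)%:E <= \int[mu]_z \int[mu]_w kappa z w)%E.
Proof.
apply: cvge_ge (@pen_cvg mu).
exists n => // m /= nm; rewrite lee_fin -!mean_ppot; apply: mean_le; try exact: bcont_ppot.
by move=> z; exact: ppot_mono.
Qed.

(* The parallelogram identity for the quadratic form [pen]. *)
Lemma minimizers_equal_means mu nu la (E : R) :
  (forall f, bcont f -> mean la f = 2^-1 * mean mu f + 2^-1 * mean nu f) ->
  (\int[mu]_z \int[mu]_w kappa z w <= E%:E)%E ->
  (\int[nu]_z \int[nu]_w kappa z w <= E%:E)%E ->
  (E%:E <= \int[la]_z \int[la]_w kappa z w)%E ->
  forall k v, mean mu (@g k v) = mean nu (@g k v).
Proof.
move=> laE muE nuE Ela k0 v0; apply/eqP; rewrite -subr_eq0 -sqrf_eq0 eq_le sqr_ge0 andbT.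
pose d k v := mean mu (@g k v) - mean nu (@g k v).
have D n : pen n la = 2^-1 * pen n mu + 2^-1 * pen n nu -
    4^-1 * \sum_(k < n) \sum_v d k v ^+ 2.
  rewrite /pen laE// !mulrDr addrACA.
  have -> (a b c : R) : a + b - c = a - c + b by ring.
  congr (_ + _); last by rewrite !mulr2n; ring.
  rewrite !mulr_sumr -big_split -sumrB; apply: eq_bigr => k _.
  rewrite !mulr_sumr -big_split -sumrB; apply: eq_bigr => v _.
  by rewrite laE// /d /=; field.
rewrite -/(d k0 v0).
have : ((\int[la]_z \int[la]_w kappa z w) <= (E - 4^-1 * d k0 v0 ^+ 2)%:E)%E.
  apply: cvge_le (@pen_cvg la).
  exists k0.+1 => // n /= kn; rewrite lee_fin D.
  have h1 : pen n mu <= E by rewrite -lee_fin (le_trans (pen_le mu n)).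
  have h2 : pen n nu <= E by rewrite -lee_fin (le_trans (pen_le nu n)).
  have h3 : d k0 v0 ^+ 2 <= \sum_(k < n) \sum_v d k v ^+ 2.
    rewrite (bigD1 (Ordinal kn))//= (bigD1 v0)//= -addrA lerDl addr_ge0// ?sumr_ge0// => *.
      by rewrite sqr_ge0.
    by rewrite sumr_ge0// => *; rewrite sqr_ge0.
  lra.
move/(le_trans Ela); rewrite lee_fin; lra.
Qed.

End PositiveKernel.

(** * Bernstein operators and polynomials in the features *)

Section Bernstein.
Context {R : realType}.

(** The Bernstein polynomial in de Casteljau's form: for [0 <= u <= 1], the expectation of [h] at a
    binomial variable with [n] trials of probability [u]. *)
Fixpoint bern n (h : nat -> R) (u : R) : R :=
  if n is n'.+1 then u * bern n' (h \o S) u + (1 - u) * bern n' h u else h 0%N.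

Lemma bern_le n (h1 h2 : nat -> R) u : 0 <= u <= 1 ->
  (forall s, (s <= n)%N -> h1 s <= h2 s) -> bern n h1 u <= bern n h2 u.
Proof.
move=> /andP[u0 u1]; elim: n h1 h2 => [|n IH] h1 h2 h12 /=; first exact: h12.
rewrite lerD// ler_wpM2l ?subr_ge0//; apply: IH => s sn; apply: h12 => //.
exact: leqW.
Qed.

Lemma bern_quadratic n (a b c u : R) :
  bern n (fun s => a + b * (s%:R - c) ^+ 2) u = a + b * ((n%:R * u - c) ^+ 2 + n%:R * u * (1 - u)).
Proof.
elim: n c => [|n IH] c /=; first by ring.
have -> : (fun s => a + b * (s%:R - c) ^+ 2) \o S = fun s => a + b * (s%:R - (c - 1)) ^+ 2.
  by apply/funext => s /=; rewrite -[s.+1%:R]natr1; congr (_ + _ * _ ^+ 2); ring.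
by rewrite !IH -[n.+1%:R]natr1; ring.
Qed.

(** Chebyshev's argument: the operator is monotone, and the mean of the quadratic term is [B] times
    the variance [u * (1 - u) / n]. *)
Lemma bern_close n (h : nat -> R) (u y C B : R) : 0 <= u <= 1 -> (0 < n)%N -> 0 <= B ->
  (forall s, (s <= n)%N -> `|h s - y| <= C + B * (s%:R / n%:R - u) ^+ 2) ->
  `|bern n h u - y| <= C + B / n%:R.
Proof.
move=> u01 n0 B0 hy; have nR : 0 < n%:R :> R by rewrite ltr0n.
have nz := lt0r_neq0 nR; have /andP[u0 u1] := u01.
have hu : n%:R * u * (1 - u) <= n%:R.
  by rewrite -mulrA ler_piMr ?(ltW nR)//; nra.
have qE s : B * (s%:R / n%:R - u) ^+ 2 = B / n%:R ^+ 2 * (s%:R - n%:R * u) ^+ 2.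
  by field.
have bE (a b : R) : bern n (fun s => a + b * (s%:R - n%:R * u) ^+ 2) u = a + b * (n%:R * u * (1 - u)).
  by rewrite bern_quadratic subrr expr0n add0r.
have Bn : B / n%:R ^+ 2 * (n%:R * u * (1 - u)) <= B / n%:R.
  have -> : B / n%:R = B / n%:R ^+ 2 * n%:R by field.
  by rewrite ler_wpM2l// divr_ge0// exprn_ge0// ltW.
have up : bern n h u <= y + C + B / n%:R.
  apply: (le_trans (_ : _ <= bern n (fun s => y + C + B / n%:R ^+ 2 * (s%:R - n%:R * u) ^+ 2) u)).
    apply: bern_le => // s sn; have := hy s sn; rewrite qE => /ler_normlW; lra.
  by rewrite bE lerD2l.
have lo : y - C - B / n%:R <= bern n h u.
  apply: (@le_trans _ _ (bern n (fun s => y - C + (- (B / n%:R ^+ 2)) * (s%:R - n%:R * u) ^+ 2) u)).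
    by rewrite bE mulNr lerD2l lerN2.
  by apply: bern_le => // s sn; have := hy s sn; rewrite qE ler_norml => /andP[+ _]; lra.
by rewrite ler_norml; apply/andP; split; lra.
Qed.

Inductive polyfun : (R[i] -> R) -> Prop :=
| polyfun_mon (l : seq 'I_4) : polyfun (fun z => \prod_(i <- l) feat i z)
| polyfun_lin (a b : R) f h : polyfun f -> polyfun h -> polyfun (fun z => a * f z + b * h z).

Lemma bcont_polyfun f : polyfun f -> bcont f.
Proof.
elim=> {f} [l|a b f h _ bf _ bh]; last first.
  exact: bcontD (bcontZ a bf) (bcontZ b bh).
elim: l => [|i l IH]; first by under eq_fun do rewrite big_nil; exact: bcont_cst.
by under eq_fun do rewrite big_cons; apply: bcontM => //; exact: bcont_feat.
Qed.

Lemma polyfun_cst (c : R) : polyfun (fun=> c).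
Proof.
have := polyfun_lin c 0 (polyfun_mon [::]) (polyfun_mon [::]); congr polyfun.
by apply/funext => z; rewrite big_nil; ring.
Qed.

Lemma polyfun_feat i : polyfun (feat i).
Proof.
have := polyfun_mon [:: i]; congr polyfun.
by apply/funext => z; rewrite big_seq1.
Qed.

Lemma polyfunM_feat i h : polyfun h -> polyfun (fun z => feat i z * h z).
Proof.
elim=> {h} [l|a b f1 f2 _ p1 _ p2].
  have := polyfun_mon (i :: l); congr polyfun.
  by apply/funext => z; rewrite big_cons.
have := polyfun_lin a b p1 p2; congr polyfun.
by apply/funext => z; ring.
Qed.

Lemma polyfunM f h : polyfun f -> polyfun h -> polyfun (fun z => f z * h z).
Proof.
move=> pf ph; elim: pf => {f} [l|a b f1 f2 _ p1 _ p2]; last first.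
  have := polyfun_lin a b p1 p2; congr polyfun.
  by apply/funext => z; ring.
elim: l => [|i l IH].
  by rewrite (_ : (fun z => _) = h)//; apply/funext => z; rewrite big_nil mul1r.
have := polyfunM_feat i IH; congr polyfun.
by apply/funext => z; rewrite big_cons mulrA.
Qed.

Lemma polyfun_bern n (H : nat -> R[i] -> R) u : polyfun u -> (forall s, polyfun (H s)) ->
  polyfun (fun z => bern n (fun s => H s z) (u z)).
Proof.
move=> pu; elim: n H => [|n IH] H pH //=.
have p1 := IH (fun s => H s.+1) (fun s => pH s.+1); have p2 := IH H pH.
have pu1 : polyfun (fun z => 1 - u z).
  have := polyfun_lin 1 (-1) (polyfun_cst 1) pu; congr polyfun.
  by apply/funext => z; ring.
have := polyfun_lin 1 1 (polyfunM pu p1) (polyfunM pu1 p2); congr polyfun.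
by apply/funext => z; rewrite !mul1r.
Qed.

Lemma polyfun_equal_means (mu nu : probability R[i] R) :
  (forall k (v : {ffun 'I_k -> 'I_4}), mean mu (fmon v) = mean nu (fmon v)) ->
  forall f, polyfun f -> mean mu f = mean nu f.
Proof.
move=> E f; elim=> {f} [l|a b f h pf Ef ph Eh]; last first.
  have bZ (c : R) g : polyfun g -> bcont (fun z => c * g z).
    by move=> /bcont_polyfun; exact: bcontZ.
  by rewrite !meanD; try exact: bZ; rewrite !meanZ ?Ef ?Eh//; exact: bcont_polyfun.
have := E (size l) [ffun i : 'I_(size l) => nth ord0 l i].
rewrite (_ : fmon _ = fun z => \prod_(i <- l) feat i z)//.
apply/funext => z; rewrite (big_nth ord0) big_mkord /fmon.
by apply: eq_bigr => j _; rewrite ffunE.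
Qed.

Lemma supported_mean_le K (mu : probability R[i] R) (f h : R[i] -> R) : measurable K ->
  supported_in K mu -> bcont f -> bcont h -> (forall z, K z -> f z <= h z) ->
  mean mu f <= mean mu h.
Proof.
move=> mK sK bf bh fh; have [A fA] := proj2 bf; have [B hB] := proj2 bh.
pose c := `|A| + `|B|; have bc := bcont_cst (R := R) c.
have nnf z : 0 <= f z + c.
  by have := fA z; rewrite ler_norml => /andP[]; have := ler_norm A; have := normr_ge0 B; rewrite /c; lra.
have nnh z : 0 <= h z + c.
  by have := hB z; rewrite ler_norml => /andP[]; have := ler_norm B; have := normr_ge0 A; rewrite /c; lra.
have : mean mu (fun z => f z + c) <= mean mu (fun z => h z + c).
  rewrite -lee_fin -!meanE; try exact: bcontD.
  apply: (supported_le mK sK).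
  - exact: bcont_measurable (bcontD bf bc).
  - exact: bcont_measurable (bcontD bh bc).
  - by move=> z; rewrite lee_fin.
  - by move=> z; rewrite lee_fin.
  - by move=> z Kz; rewrite lee_fin lerD2r fh.
by rewrite (meanD mu bf bc) (meanD mu bh bc) lerD2r.
Qed.

End Bernstein.

(** * Energy minimizers have equal moments *)

Section Uniqueness.
Context {R : realType}.
Implicit Types (z w : R[i]).
Variables (K : set R[i]) (r V : R) (mu nu : probability R[i] R).
Hypotheses (cK : compact K) (r0 : 0 < r) (rK : forall z, K z -> cabs z <= r)
  (muK : supported_in K mu) (nuK : supported_in K nu)
  (muV : log_energy mu = V%:E) (nuV : log_energy nu = V%:E)
  (Vmin : forall la : probability R[i] R, supported_in K la -> (V%:E <= log_energy la)%E).

Let mK : measurable K. Proof. exact: compact_measurable_plane. Qed.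

(** Exceeds both [sqA] on [K] and the distances within [K], so one constant serves for [beta] and
    for [kapoo]. *)
Let M : R := 1 + r ^+ 2 + 2 * r.

Let M1 : 1 <= M.
Proof. by rewrite /M -addrA lerDl addr_ge0 ?sqr_ge0// mulr_ge0// ltW. Qed.

Let rM : 2 * r <= M.
Proof. by rewrite /M lerDr addr_ge0 ?sqr_ge0. Qed.

(** Chosen so that [M * exp (- j0) <= 1 <= sqA z]: the truncation in [beta] is inactive on [K], yet
    makes [beta] bounded on the plane. *)
Let j0 : nat := (Num.truncn M).+1.

Let beta z : R := 2^-1 * kap M j0 (sqA z).

Let bbeta : bcont beta.
Proof.
apply: bcontZ; split; last by exists j0%:R => z; rewrite ger0_norm ?kap_ge0 ?kap_le.
have M0 : 0 < M by exact: lt_le_trans M1.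
apply/continuous_cabsP => z e e0.
have E0 : 0 < expR j0%:R / M by rewrite divr_gt0 ?expR_gt0.
have /continuous_cabsP/(_ z _ (divr_gt0 e0 E0)) [d d0 dP] := @sqA_continuous R.
exists d => // y /dP h; apply: (le_lt_trans (kap_lip M1 _ _ _)).
by rewrite mulrC -ltr_pdivlMr.
Qed.

Let beta_ge0 z : 0 <= beta z.
Proof. by rewrite mulr_ge0 ?kap_ge0. Qed.

Let betaE z : K z -> beta z = 2^-1 * (ln M - ln (sqA z)).
Proof.
move=> Kz; rewrite /beta /kap min_l ?max_l//.
  apply: le_trans (sqA_ge1 z); rewrite -ler_pdivlMr ?expR_gt0// -expRN opprK mul1r.
  apply: (@le_trans _ _ (1 + j0%:R)); last exact: expR_ge1Dx.
  have M0 : 0 <= M by exact: le_trans M1.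
  have /andP[_ /ltW h] := truncn_itv M0; rewrite -/j0 in h.
  by apply: (le_trans h); rewrite lerDr.
rewrite /sqA /M -addrA lerD2l; apply: (@le_trans _ _ (r ^+ 2)).
  by rewrite ler_sqr ?nnegrE ?(ltW r0)// rK.
by rewrite lerDl mulr_ge0// ltW.
Qed.

Let I (k : nat) : finType := {ffun 'I_k.+1 -> 'I_4}.
Let c (k : nat) : R := Num.sqrt (2 * k.+1%:R)^-1.
Let g k (v : I k) z : R := c k * fmon v z.

Let c_gt0 k : 0 < c k.
Proof. by rewrite sqrtr_gt0 invr_gt0 mulr_gt0. Qed.

Let gE k z w : \sum_(v : I k) g v z * g v w = 2^-1 * (chord z w ^+ k.+1 / k.+1%:R).
Proof.
rewrite chordX mulr_suml mulr_sumr; apply: eq_bigr => v _; rewrite /g.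
have cc : c k * c k = 2^-1 / k.+1%:R.
  by rewrite -expr2 sqr_sqrtr ?invr_ge0 ?mulr_ge0// invfM.
by rewrite mulrACA cc; ring.
Qed.

(** On [K] the two values of [beta] cancel the factors [sqA] in [chordE] and leave exactly the
    shifted logarithmic kernel. *)
Let kappa z w : \bar R := (2^-1%:E * - lne (1 - chord z w)%:E + (beta z + beta w)%:E)%E.

Let psum_kappa z w : (psum g beta n z w)%:E @[n --> \oo] --> kappa z w.
Proof.
have -> : (fun n => (psum g beta n z w)%:E) =
    fun n => (2^-1%:E * (logsum n (chord z w))%:E + (beta z + beta w)%:E)%E.
  apply/funext => n; rewrite -EFinM -EFinD /psum /logsum mulr_sumr; congr (_ + _)%:E.
  by apply: eq_bigr => k _; rewrite gE.
apply: cvgeD; [|apply: cvgeZl => //; exact: logsum_cvg (chord01 z w)|exact: cvg_cst].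
by rewrite fin_num_adde_defl.
Qed.

Let kappaE z w : K z -> K w -> kappa z w = kapoo M (cabs (z - w)).
Proof.
move=> Kz Kw; rewrite /kappa chordE; have := cabs_ge0 (z - w).
rewrite le_eqVlt => /predU1P[<-|s0].
  rewrite expr0n mul0r le0_lneNy// /kapoo le0_lneNy ?lee_fin ?ge_min ?lexx//=.
  by rewrite gt0_muley ?lte_fin ?invr_gt0// addye.
have Az := sqA_gt0 z; have Aw := sqA_gt0 w.
rewrite lne_EFin ?divr_gt0 ?exprn_gt0 ?mulr_gt0// kapoo_pos//.
rewrite -EFinN -EFinM -EFinD !betaE// ln_div ?posrE ?exprn_gt0 ?mulr_gt0//.
rewrite lnM ?posrE// expr2 lnM ?posrE// min_l; last first.
  by have := cabsB z w; have := rK Kz; have := rK Kw; move: rM; lra.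
by congr EFin; field.
Qed.

Let bg k v : bcont (@g k v).
Proof. by apply: bcontZ; exact: bcont_fmon. Qed.

Let g_ge0 k z w : 0 <= \sum_(v : I k) g v z * g v w.
Proof.
rewrite gE; apply: mulr_ge0 => //; apply: divr_ge0 => //; apply: exprn_ge0.
by case/andP: (chord01 z w).
Qed.

Let kappa_en (la : probability R[i] R) : supported_in K la ->
  (\int[la]_z \int[la]_w kappa z w = en M la)%E.
Proof.
move=> laK; apply: (supported_integral mK laK).
- exact: (measurable_ppot bg bbeta beta_ge0 g_ge0 psum_kappa la).
- exact: measurable_pot.
move=> z Kz; apply: (supported_integral mK laK).
- exact: (measurable_kappa bg bbeta psum_kappa z).
- exact: measurable_kapoo.
by move=> w Kw; exact: kappaE.
Qed.

(** The mixture of the two minimizers cannot have smaller energy, so the parallelogram defect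
    vanishes in every degree. The logarithmic series starts in degree 1; degree 0 is the total
    mass. *)
Lemma equal_moments k (v : {ffun 'I_k -> 'I_4}) : mean mu (fmon v) = mean nu (fmon v).
Proof.
case: k v => [|k] v.
  have -> : fmon v = fun=> 1 :> R by apply/funext => z; rewrite /fmon big_ord0.
  by rewrite !mean_cst.
have [la [laK laE]] := mixture_exists mu nu.
have enE (m : probability R[i] R) : supported_in K m -> log_energy m = V%:E -> en M m = (V + ln M)%:E.
  move=> mK'; rewrite (log_energyE cK rK mK' M1 rM) => /(congr1 (fun x => x + (ln M)%:E)%E).
  by rewrite subeK// EFinD.
have := @minimizers_equal_means R I g beta bg bbeta beta_ge0 g_ge0 kappa psum_kappa mu nu la (V + ln M) laE.
rewrite !kappa_en//; last exact: laK.
rewrite (enE mu)// (enE nu)// => /(_ (lexx _) (lexx _)) h.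
have {}h := h _ k v; apply: (mulfI (lt0r_neq0 (c_gt0 k))).
rewrite -!meanZ; try exact: bcont_fmon; apply: h.
rewrite EFinD -leeBrDr//.
by have := Vmin (laK _ muK nuK); rewrite (log_energyE cK rK (laK _ muK nuK) M1 rM).
Qed.

End Uniqueness.

(** * Moments determine a compactly supported measure *)

Section MomentsDetermine.
Context {R : realType}.
Implicit Types (f : R[i] -> R).

Lemma frac_lip (a b m n s c : R) : 1 <= s -> 0 < c <= 1 -> c <= m -> c <= n -> `|b| <= 1 ->
  `|a / (s * m) - b / (s * n)| <= c ^- 2 * (`|a - b| + `|m - n|).
Proof.
move=> s1 /andP[c0 c1] cm cn b1.
have m0 : 0 < m by exact: lt_le_trans cm.
have n0 : 0 < n by exact: lt_le_trans cn.
have s0 : 0 < s by exact: lt_le_trans s1.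
have -> : a / (s * m) - b / (s * n) = s^-1 * (m^-1 * (a - b) + m^-1 * n^-1 * (b * (n - m))).
  by field; rewrite !lt0r_neq0.
have iN : 0 <= c^-1 by rewrite invr_ge0 ltW.
have im : 0 <= m^-1 <= c^-1 by rewrite invr_ge0 ltW//= lef_pV2.
have in_ : 0 <= n^-1 <= c^-1 by rewrite invr_ge0 ltW//= lef_pV2.
have cc : c^-1 <= c ^- 2.
  by rewrite -exprVn expr2 ler_peMr// invf_ge1.
rewrite normrM ger0_norm ?invr_ge0 ?(ltW s0)//.
apply: (@le_trans _ _ `|m^-1 * (a - b) + m^-1 * n^-1 * (b * (n - m))|).
  by rewrite ler_piMl// invf_le1.
apply: (le_trans (ler_normD _ _)); rewrite [leRHS]mulrDr.
case/andP: im => im0 im1; case/andP: in_ => in0 in1.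
rewrite !normrM !(ger0_norm im0) (ger0_norm in0). rewrite lerD//.
  by rewrite ler_wpM2r// (le_trans im1).
rewrite (distrC m) ler_pM ?mulr_ge0//.
  by rewrite -exprVn expr2 ler_pM.
by rewrite ler_piMl.
Qed.

(** Turns the Lipschitz estimates into the quadratic ones that [bern_close] can average. *)
Lemma amgm_bound (X e : R) : 0 < e -> X <= e + X ^+ 2 / (4 * e).
Proof.
move=> e0; rewrite -subr_ge0.
have -> : e + X ^+ 2 / (4 * e) - X = (X - 2 * e) ^+ 2 / (4 * e) by field; rewrite lt0r_neq0.
by rewrite divr_ge0 ?sqr_ge0// mulr_ge0// ltW.
Qed.

(* Recovers a point from [1 / sqA] and the two other features, rescaled to [0, 1];
   the truncation at [c] keeps this map Lipschitz. *)
Definition decode (c p0 p1 p2 : R) : R[i] :=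
  ((2 * p1 - 1) / (Num.sqrt 2 * Num.max p0 c)) +i* ((2 * p2 - 1) / (Num.sqrt 2 * Num.max p0 c)).

Lemma sqrt2_ge1 : 1 <= Num.sqrt 2 :> R.
Proof. by rewrite -[leLHS]sqrtr1 ler_wsqrtr// ler1n. Qed.

Lemma decode_bound (c p0 p1 p2 : R) : 0 < c -> 0 <= p1 <= 1 -> 0 <= p2 <= 1 ->
  cabs (decode c p0 p1 p2) <= 2 / c.
Proof.
move=> c0 p11 p21; apply: (le_trans (cabs_le_ReIm _)) => /=.
have s0 : 0 < Num.sqrt 2 :> R by exact: lt_le_trans sqrt2_ge1.
have mc : c <= Num.max p0 c by rewrite le_max lexx orbT.
have m0 : 0 < Num.max p0 c by exact: lt_le_trans mc.
have H (x : R) : 0 <= x <= 1 -> `|(2 * x - 1) / (Num.sqrt 2 * Num.max p0 c)| <= c^-1.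
  move=> x01; rewrite normrM (gtr0_norm (_ : 0 < _^-1)) ?invr_gt0 ?mulr_gt0//.
  rewrite ler_pdivrMr ?mulr_gt0//; apply: (@le_trans _ _ 1).
    by rewrite ler_norml; lra.
  rewrite mulrC -ler_pdivrMr ?invr_gt0// mul1r invrK (le_trans mc)// ler_peMl ?sqrt2_ge1//.
  exact: ltW.
by have := H _ p11; have := H _ p21; lra.
Qed.

Lemma decode_lip (c p0 p1 p2 q0 q1 q2 : R) : 0 < c <= 1 -> 0 <= q1 <= 1 -> 0 <= q2 <= 1 ->
  cabs (decode c p0 p1 p2 - decode c q0 q1 q2) <=
    2 * c ^- 2 * (`|p0 - q0| + `|p1 - q1| + `|p2 - q2|).
Proof.
move=> c01 q11 q21; have /andP[c0 c1] := c01.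
have cm x : c <= Num.max x c by rewrite le_max lexx orbT.
have H (x y : R) : 0 <= y <= 1 ->
    `|(2 * x - 1) / (Num.sqrt 2 * Num.max p0 c) - (2 * y - 1) / (Num.sqrt 2 * Num.max q0 c)|
    <= c ^- 2 * (2 * `|x - y| + `|p0 - q0|).
  move=> y01; apply: (le_trans (frac_lip _ sqrt2_ge1 c01 (cm _) (cm _) _)).
    by rewrite ler_norml; lra.
  rewrite ler_wpM2l ?invr_ge0 ?exprn_ge0 ?(ltW c0)// lerD ?max_lip//.
  have -> : 2 * x - 1 - (2 * y - 1) = 2 * (x - y) by ring.
  by rewrite normrM ger0_norm.
apply: (le_trans (cabs_le_ReIm _)) => /=.
by have := H p1 q1 q11; have := H p2 q2 q21; lra.
Qed.

(** On [K], [f] is the composite of [f] and [decode] evaluated at three features scaled to the unit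
    interval. Bernstein's operator in each of the three variables replaces this composite by its
    values on a grid, with coefficients polynomial in the features. *)
Lemma polyfun_dense (K : set R[i]) (r e : R) f : 0 < r -> (forall z, K z -> cabs z <= r) ->
  bcont f -> 0 < e -> exists2 P, polyfun P & forall z, K z -> `|P z - f z| <= e.
Proof.
(* A lower bound of the inverse of [sqA] on [K], so [decode] returns the point itself there. *)
move=> r0 rK bf e0; pose c : R := (1 + r ^+ 2)^-1.
have r21 : 1 <= 1 + r ^+ 2 by rewrite lerDl sqr_ge0.
have c01 : 0 < c <= 1 by rewrite invr_gt0 invf_le1 ?(lt_le_trans _ r21).
have /andP[c0 c1] := c01.
have e10 : 0 < e / 8 by rewrite divr_gt0.
have [A A0 HA] := bcont_modulus (r + 2 / c) bf e10.
pose L : R := 2 * c ^- 2; have L0 : 0 <= L by rewrite mulr_ge0// invr_ge0 exprn_ge0// ltW.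
pose B : R := (A * L) ^+ 2 / (4 * (e / 8)).
have B0 : 0 <= B by rewrite divr_ge0 ?sqr_ge0// mulr_ge0// ltW.
pose n := (Num.truncn (3 * B / (e / 2))).+1.
have n0 : (0 < n)%N by [].
have nR : 0 < n%:R :> R by rewrite ltr0n.
have nB : 3 * (B / n%:R) <= e / 2.
  rewrite mulrA ler_pdivrMr// [leRHS]mulrC -ler_pdivrMr ?divr_gt0//.
  have q0 : 0 <= 3 * B / (e / 2) by apply: divr_ge0; [apply: mulr_ge0|apply: ltW; rewrite divr_gt0].
  by have /andP[_ /ltW] := truncn_itv q0.
pose i0 : 'I_4 := inord 0; pose i2 : 'I_4 := inord 2; pose i3 : 'I_4 := inord 3.
have [f0 f2 f3] : [/\ forall z : R[i], feat i0 z = 1 / sqA z,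
    forall z : R[i], feat i2 z = Num.sqrt 2 * complex.Re z / sqA z &
    forall z : R[i], feat i3 z = Num.sqrt 2 * complex.Im z / sqA z].
  by split=> z; rewrite /feat inordK.
pose u1 (z : R[i]) : R := 2^-1 * feat i2 z + 2^-1 * 1; pose u2 (z : R[i]) : R := 2^-1 * feat i3 z + 2^-1 * 1.
have pu1 : polyfun u1 by apply: (polyfun_lin 2^-1 2^-1 (polyfun_feat i2) (polyfun_cst 1)).
have pu2 : polyfun u2 by apply: (polyfun_lin 2^-1 2^-1 (polyfun_feat i3) (polyfun_cst 1)).
have s2 : Num.sqrt 2 * Num.sqrt 2 = 2 :> R by rewrite -expr2 sqr_sqrtr.
have s0 : 0 < Num.sqrt 2 :> R by exact: lt_le_trans sqrt2_ge1.
pose h (a b d : nat) := f (decode c (a%:R / n%:R) (b%:R / n%:R) (d%:R / n%:R)).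
exists (fun z => bern n (fun a => bern n (fun b => bern n (fun d => h a b d) (u2 z)) (u1 z)) (feat i0 z)).
  apply: (@polyfun_bern R n (fun a z => bern n (fun b => bern n (fun d => h a b d) (u2 z)) (u1 z))).
    exact: polyfun_feat.
  move=> a; apply: (@polyfun_bern R n (fun b z => bern n (fun d => h a b d) (u2 z))) => // b.
  apply: (@polyfun_bern R n (fun d z => h a b d)) => // d; exact: polyfun_cst.
move=> z Kz; have Az := sqA_gt0 z; have A1 := sqA_ge1 z.
have u001 : 0 <= feat i0 z <= 1.
  by rewrite f0 divr_ge0 ?(ltW Az)//= ler_pdivrMr// mul1r.
have half (x : R) : `|x| <= cabs z -> 0 <= 2^-1 * (Num.sqrt 2 * x / sqA z) + 2^-1 * 1 <= 1.
  move=> xz; have : `|Num.sqrt 2 * x / sqA z| <= 1.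
    rewrite !normrM (gtr0_norm s0) (gtr0_norm (_ : 0 < _^-1)) ?invr_gt0// ler_pdivrMr// mul1r.
    have s22 : Num.sqrt 2 <= 2 :> R by rewrite -[leRHS]s2 ler_peMr ?sqrt2_ge1// ltW.
    apply: (@le_trans _ _ (2 * cabs z)); first by rewrite ler_pM// ltW.
    by rewrite /sqA -subr_ge0 (_ : _ - _ = (1 - cabs z) ^+ 2) ?sqr_ge0//; ring.
  by rewrite ler_norml; lra.
have u101 : 0 <= u1 z <= 1 by rewrite /u1 f2; apply: half; exact: cabs_ge_Re.
have u201 : 0 <= u2 z <= 1 by rewrite /u2 f3; apply: half; exact: cabs_ge_Im.
have zE : decode c (feat i0 z) (u1 z) (u2 z) = z.
  have mx : Num.max (feat i0 z) c = 1 / sqA z.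
    rewrite f0 max_l// /c mul1r lef_pV2 ?posrE ?(lt_le_trans _ r21)//.
    by rewrite /sqA lerD2l ler_sqr ?nnegrE ?(ltW r0)// rK.
  rewrite /decode mx /u1 /u2 f2 f3; clear - Az s0; case: z Az => x y /= Az.
  by congr (_ +i* _); field; rewrite !lt0r_neq0.
have node a : (a <= n)%N -> 0 <= (a%:R / n%:R : R) <= 1.
  by move=> an; rewrite divr_ge0//= ler_pdivrMr// mul1r ler_nat.
pose d0 (a : nat) : R := a%:R / n%:R - feat i0 z.
pose d1 (b : nat) : R := b%:R / n%:R - u1 z.
pose d2 (d : nat) : R := d%:R / n%:R - u2 z.
(* The share [e / 2] is [e / 8] from the modulus of [f] and [e / 8] from [amgm_bound] in each of the
   three variables. *)
have key a b d : (a <= n)%N -> (b <= n)%N -> (d <= n)%N ->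
    `|h a b d - f z| <= e / 2 + B * d0 a ^+ 2 + B * d1 b ^+ 2 + B * d2 d ^+ 2.
  move=> an bn dn; rewrite /h.
  have c1' : cabs (decode c (a%:R / n%:R) (b%:R / n%:R) (d%:R / n%:R)) <= r + 2 / c.
    by apply: (le_trans (decode_bound _ c0 (node _ bn) (node _ dn))); rewrite lerDr ltW.
  have c2' : cabs z <= r + 2 / c by rewrite (le_trans (rK _ Kz))// lerDl divr_ge0// ltW.
  apply: (le_trans (HA _ _ c1' c2')); rewrite -[X in cabs (_ - X)]zE.
  have := ler_wpM2l A0 (decode_lip (a%:R / n%:R) (b%:R / n%:R) (d%:R / n%:R) (feat i0 z) c01 u101 u201).
  rewrite -/L -/(d0 a) -/(d1 b) -/(d2 d).
  have am (x : R) : A * L * `|x| <= e / 8 + B * x ^+ 2.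
    apply: (le_trans (amgm_bound (A * L * `|x|) e10)); rewrite lerD2l.
    by rewrite exprMn real_normK ?num_real// mulrAC.
  have := am (d0 a); have := am (d1 b); have := am (d2 d); rewrite !mulrDr !mulrA; lra.
have l3 a b : (a <= n)%N -> (b <= n)%N ->
    `|bern n (fun d => h a b d) (u2 z) - f z| <= e / 2 + B * d0 a ^+ 2 + B / n%:R + B * d1 b ^+ 2.
  move=> an bn; rewrite -[X in _ <= X]addrAC; apply: bern_close => // d dn.
  exact: key.
have l2 a : (a <= n)%N ->
    `|bern n (fun b => bern n (fun d => h a b d) (u2 z)) (u1 z) - f z| <=
      e / 2 + B / n%:R + B / n%:R + B * d0 a ^+ 2.
  move=> an; have -> : e / 2 + B / n%:R + B / n%:R + B * d0 a ^+ 2 =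
    (e / 2 + B * d0 a ^+ 2 + B / n%:R) + B / n%:R by ring.
  by apply: bern_close => // b bn; exact: l3.
apply: (@le_trans _ _ (e / 2 + B / n%:R + B / n%:R + B / n%:R)); last by lra.
by apply: bern_close => // a an; exact: l2.
Qed.

Lemma moments_determine (K : set R[i]) (mu nu : probability R[i] R) : compact K ->
  supported_in K mu -> supported_in K nu ->
  (forall k (v : {ffun 'I_k -> 'I_4}), mean mu (fmon v) = mean nu (fmon v)) ->
  forall f, bcont f -> mean mu f = mean nu f.
Proof.
move=> cK muK nuK E f bf; have [r r0 rK] := compact_cabs_bounded cK.
have mK : measurable K by exact: compact_measurable_plane.
apply/eqP; rewrite -subr_eq0 -normr_le0; apply/ler_addgt0Pr => e e0; rewrite add0r.
have [P pP Pf] := polyfun_dense r0 rK bf (divr_gt0 e0 (ltr0n _ 2)).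
have bP := bcont_polyfun pP.
have H (m : probability R[i] R) : supported_in K m -> `|mean m P - mean m f| <= e / 2.
  move=> mKs; have bc := bcont_cst (R := R) (e / 2).
  have h1 : mean m f <= mean m (fun z => P z + e / 2).
    apply: (supported_mean_le mK mKs) => //; first exact: bcontD.
    by move=> z /Pf; rewrite ler_norml => /andP[]; lra.
  have h2 : mean m P <= mean m (fun z => f z + e / 2).
    apply: (supported_mean_le mK mKs) => //; first exact: bcontD.
    by move=> z /Pf; rewrite ler_norml => /andP[]; lra.
  rewrite meanD// mean_cst in h1; rewrite meanD// mean_cst in h2.
  by rewrite ler_norml; apply/andP; split; lra.
have := H mu muK; have := H nu nuK; rewrite (polyfun_equal_means E pP) !ler_norml => /andP[? ?] /andP[? ?].
by apply/andP; split; lra.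
Qed.

End MomentsDetermine.

(** * Algebraic integers of prescribed precision *)

Section Approximants.
Context {R : realType}.
Implicit Types (z y w : R[i]) (K : set R[i]).

(** [e] is both the distance of the near roots from [K] and the error in the exponents; [Y] is the
    radius of validity of the product bound. That bound is asked only at some [y] near [z], because
    [z] itself may be a root. *)
Definition approximant K (V e Y : R) (zeta : R[i]) (xs : seq R[i]) : Prop :=
  [/\ algebraic_integer zeta, alg_deg zeta = (size xs).+1,
      conjugates zeta = [set` zeta :: xs] /\ uniq (zeta :: xs),
      ln `|(lead_coef (int_minpoly zeta))%:~R| = 0 :> R &
      perm_eq (fset_set (conjugates zeta)) (zeta :: xs)] /\
  [/\ forall x, x \in xs -> exists2 k, K k & cabs (x - k) <= e,
      expR ((V + e) * (size xs)%:R) <= cabs zeta,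
      cabs zeta <= expR ((V + 2 * e) * (size xs)%:R) &
      forall z, cabs z + e <= Y -> exists2 y, cabs (y - z) <= e &
        expR (- ((V + 2 * e) * (size xs)%:R)) <= \prod_(x <- xs) cabs (y - x)].

(** The lemniscate has exponent [V + e], and the passage to integer coefficients loses another
    [e]. *)
Lemma approximant_exists K (V e Y : R) N0 : compact K -> [set z^* | z in K] = K -> 0 < V ->
  (forall e, 0 < e -> exists2 mu : probability R[i] R,
     supported_in K mu & (log_energy mu < (V + e)%:E)%E) ->
  0 < e <= 1 -> exists zeta xs, (N0 <= size xs)%N /\ approximant K V e Y zeta xs.
Proof.
move=> cK sK V0 HV /andP[e0 e1].
have [r r0 rK] := compact_cabs_bounded cK.
have [F [Zs [FZ Zs0 ZsK Fnear Ffar]]] :=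
  fekete_lemniscate cK sK (ltW V0) e0 (fekete_lower_bound cK HV).
have v0 : 0 < V + e by exact: addr_gt0.
have r1 : 1 <= r + 1 by rewrite lerDr ltW.
have Zr x : x \in Zs -> cabs x <= r + 1.
  by move=> xZ; rewrite (le_trans (rK _ (ZsK _ xZ)))// lerDl.
have Fr y : pabs F y <= expR (- ((V + e) * (size Zs)%:R)) -> cabs y <= r + 1.
  move=> /Fnear[x Kx yx]; have := cabs_triangle x y 0; rewrite !subr0.
  by have := rK _ Kx; lra.
have [P [zeta [xs [mP irrP PE N0xs [xsF zlo zhi far]]]]] :=
  algebraic_integers_from_lemniscate Y N0 FZ erefl Zs0 v0 e0 r1 Zr Fr.
have un := irreducible_uniq_roots irrP PE.
have [ai deg conj ld pe] := conjugates_data mP irrP PE un (mem_head _ _).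
exists zeta, xs; split=> //; split; first by split.
split=> // [x /xsF /Fnear//||].
  by have -> : V + 2 * e = V + e + e by ring.
move=> z zY; have [y yz /far h] := Ffar z; exists y => //.
have -> : V + 2 * e = V + e + e by ring.
by apply: h; have := cabs_triangle z y 0; rewrite !subr0; lra.
Qed.

End Approximants.

(** * The approximating sequence, and the distance to a compact set *)

Section Equidistribution.
Context {R : realType}.
Implicit Types (z y w : R[i]) (K : set R[i]).

(** Strictly growing degrees make the algebraic integers distinct and give at least [n] near roots
    at stage [n]. *)
Lemma approximating_sequence K (V : R) : compact K -> [set z^* | z in K] = K -> 0 < V ->
  (forall e, 0 < e -> exists2 mu : probability R[i] R,
     supported_in K mu & (log_energy mu < (V + e)%:E)%E) ->
  exists zeta xs, (forall n, size (xs n) < size (xs n.+1))%N /\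
    forall n, approximant K V n.+1%:R^-1 n.+2%:R (zeta n) (xs n).
Proof.
move=> cK sK V0 HV.
have /choice[G GP] : forall p : nat * nat, exists zx : R[i] * seq R[i],
    (p.2 <= size zx.2)%N /\ approximant K V p.1.+1%:R^-1 p.1.+2%:R zx.1 zx.2.
  move=> [n N0] /=; have [|zeta [xs h]] := @approximant_exists R K V n.+1%:R^-1 n.+2%:R N0 cK sK V0 HV.
    by rewrite invr_gt0 ltr0Sn invf_le1 ?ltr0Sn// ler1n.
  by exists (zeta, xs).
pose fix d n := if n is n'.+1 then G (n, (size (d n').2).+1) else G (0, 0)%N.
exists (fun n => (d n).1), (fun n => (d n).2); split=> n.
  by have [] := GP (n.+1, (size (d n).2).+1).
by case: n => [|n] /=; [have [] := GP (0, 0)%N | have [] := GP (n.+1, (size (d n).2).+1)].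
Qed.

Definition dist K z : R := inf [set cabs (z - k) | k in K].

Lemma dist_le K z k : K k -> dist K z <= cabs (z - k).
Proof.
move=> Kk; apply: ge_inf; last by exists k.
by exists 0 => _ [w _ <-]; exact: cabs_ge0.
Qed.

Lemma dist_ge0 K z : K !=set0 -> 0 <= dist K z.
Proof.
move=> [k Kk]; apply: lb_le_inf; first by exists (cabs (z - k)), k.
by move=> _ [w _ <-]; exact: cabs_ge0.
Qed.

Lemma dist_lip K z w : K !=set0 -> `|dist K z - dist K w| <= cabs (z - w).
Proof.
move=> K0; have H x y : dist K x - cabs (x - y) <= dist K y.
  have [k Kk] := K0; apply: lb_le_inf; first by exists (cabs (y - k)), k.
  move=> _ [v Kv <-]; have := dist_le x Kv; have := cabs_triangle y x v; lra.
have := H z w; have := H w z; rewrite (cabs_distC w) ler_norml => h1 h2.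
by apply/andP; split; lra.
Qed.

Lemma dist_gt0 K z : compact K -> K !=set0 -> ~ K z -> 0 < dist K z.
Proof.
move=> cK [k Kk] nKz; have oK : open (~` K) by apply: closed_openC; exact: compact_closed.
have /nbhs_cabs[e e0 eK] : nbhs z (~` K) by exact: open_nbhs_nbhs.
apply: (lt_le_trans e0); apply: lb_le_inf; first by exists (cabs (z - k)), k.
by move=> _ [w Kw <-]; rewrite leNgt; apply/negP => /eK.
Qed.

(** A bounded continuous function that, for compact nonempty [K], is positive exactly off [K]; its
    mean detects mass outside [K]. *)
Definition tent K z : R := Num.min 1 (dist K z).

Lemma bcont_tent K : K !=set0 -> bcont (tent K).
Proof.
move=> K0; have d0 z := dist_ge0 z K0; split; last first.
  by exists 1 => z; rewrite /tent ger0_norm ?ge_min ?lexx// le_min ler01 d0.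
apply: (@lipschitz_continuous _ _ 1) => z w; rewrite mul1r.
by apply: le_trans (dist_lip z w K0); rewrite /tent !(minC 1) min_lip.
Qed.

Lemma mean_tent_supported K (mu : probability R[i] R) : compact K -> K !=set0 ->
  mean mu (tent K) <= 0 -> supported_in K mu.
Proof.
move=> cK K0 m0; have bt := bcont_tent K0.
have t0 z : 0 <= tent K z by rewrite le_min ler01 dist_ge0.
have mt : measurable_fun setT (EFin \o tent K).
  exact: bcont_measurable bt.
have : (\int[mu]_z `|(tent K z)%:E| = 0)%E.
  rewrite (eq_integral (fun z => (tent K z)%:E)); last by move=> z _; rewrite /= ger0_norm.
  apply/eqP; rewrite eq_le integral_ge0 ?andbT; last by move=> z _; rewrite lee_fin.
  by rewrite meanE.
move/(ae_eq_integral_abs mu measurableT mt) => [N [mN N0 NP]].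
apply/eqP; rewrite eq_le measure_ge0 andbT /supported_in -N0; apply: le_measure.
- by rewrite inE; apply: measurableC; exact: compact_measurable_plane.
- by rewrite inE.
apply: subset_trans NP => z nKz /= /(_ I) [] h.
have : 0 < tent K z by rewrite lt_min ltr01 dist_gt0.
by rewrite h ltxx.
Qed.

End Equidistribution.

(** * Frostman's inequality and the limit of the near roots *)

Section LimitMeasure.
Context {R : realType}.
Implicit Types (z y w : R[i]).

Lemma kap_le_ln (M s : R) j : 1 <= M -> 0 < s <= M -> kap M j s <= ln M - ln s.
Proof.
move=> M1 /andP[s0 sM]; rewrite /kap lerD2l lerN2 ler_ln ?posrE//.
  by rewrite min_l// le_max lexx.
by rewrite lt_max min_l// s0.
Qed.

(** Truncation only lowers the kernel, so the sum is at most the logarithm of [M ^ size xs] over the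
    product of distances. *)
Lemma avg_kap_le (M W : R) j y (xs : seq R[i]) : 1 <= M -> (0 < size xs)%N ->
  (forall x, x \in xs -> cabs (y - x) <= M) ->
  expR (- (W * (size xs)%:R)) <= \prod_(x <- xs) cabs (y - x) ->
  avg (fun x => kap M j (cabs (y - x))) xs <= ln M + W.
Proof.
move=> M1 sx yM far; have sR : 0 < (size xs)%:R :> R by rewrite ltr0n.
have p0 : 0 < \prod_(x <- xs) cabs (y - x) by apply: lt_le_trans far; exact: expR_gt0.
have W' : - (W * (size xs)%:R) <= ln (\prod_(x <- xs) cabs (y - x)).
  by rewrite -ler_expR lnK ?posrE.
rewrite /avg ler_pdivrMr//.
suff : \sum_(x <- xs) kap M j (cabs (y - x)) <=
    (size xs)%:R * ln M - ln (\prod_(x <- xs) cabs (y - x)) by lra.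
elim: xs {sx sR far W'} yM p0 => [|x s IH] yM; first by rewrite !big_nil ln1 mul0r subr0.
rewrite !big_cons => p0.
have s0 : 0 < \prod_(x <- s) cabs (y - x).
  by move: p0; rewrite !lt_def mulf_eq0 negb_or => /andP[/andP[_ ->] _] /=; exact: prodr_ge0.
have c0 : 0 < cabs (y - x) by move: p0; rewrite pmulr_lgt0.
have h1 := IH (fun w ws => yM w (mem_behead (s := x :: s) ws)) s0.
have h2 := @kap_le_ln M (cabs (y - x)) j M1.
rewrite c0 yM ?mem_head// in h2; have {}h2 := h2 isT.
rewrite lnM ?posrE//= -[(size s).+1%:R]natr1; lra.
Qed.

Variables (K : set R[i]) (V r : R) (zeta : nat -> R[i]) (xs : nat -> seq R[i]).
Hypotheses (cK : compact K) (r0 : 0 < r) (rK : forall z, K z -> cabs z <= r)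
  (xs_mono : forall n, (size (xs n) < size (xs n.+1))%N)
  (xsP : forall n, approximant K V n.+1%:R^-1 n.+2%:R (zeta n) (xs n)).

Lemma size_xs n : (n <= size (xs n))%N.
Proof. by elim: n => // n IH; rewrite (leq_ltn_trans IH). Qed.

Let inv_le1 n : n.+1%:R^-1 <= 1 :> R.
Proof. by rewrite invf_le1 ?ltr0Sn// ler1n. Qed.

Lemma xs_near n x : x \in xs n -> exists2 k, K k & cabs (x - k) <= n.+1%:R^-1.
Proof. by have [_ [+ _ _ _]] := xsP n; exact. Qed.

Lemma xs_bounded n x : x \in xs n -> cabs x <= r + 1.
Proof.
move=> /xs_near[k Kk xk]; have := cabs_triangle k x 0; rewrite !subr0.
have := rK Kk; have := le_trans xk (inv_le1 n); lra.
Qed.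

Lemma approximants_nonempty : K !=set0.
Proof.
have := size_xs 1; case E : (xs 1%N) => [|x s] // _.
have [|k Kk _] := @xs_near 1%N x; first by rewrite E mem_head.
by exists k.
Qed.

Section Ultra.
Variables (U : set_system nat) (nu : probability R[i] R).
Hypotheses (UU : UltraFilter U) (ooU : \oo `<=` U)
  (nuP : forall f, bcont f -> avg f (xs n) @[n --> U] --> mean nu f).

Lemma limit_supported : supported_in K nu.
Proof.
have K0 := approximants_nonempty; have PU : ProperFilter U by exact: ultra_proper.
apply: mean_tent_supported => //.
have h : n.+1%:R^-1 @[n --> U] --> (0 : R) by move=> A A0; apply: ooU; exact: (cvg_harmonic A0).
apply: (ler_cvg_to (nuP (bcont_tent K0)) h); apply: ooU; exists 1%N => // n /= n1.
have s0 : 0 < (size (xs n))%:R :> R by rewrite ltr0n (leq_trans n1)// size_xs.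
rewrite /avg ler_pdivrMr//.
have -> : n.+1%:R^-1 * (size (xs n))%:R = \sum_(x <- xs n) n.+1%:R^-1 :> R.
  by rewrite sumr_const_seq.
rewrite !big_seq; apply: ler_sum => x /xs_near[k Kk xk].
by rewrite /tent ge_min (le_trans (dist_le x Kk) xk) orbT.
Qed.

(** The product bound controls the truncated potential at a point [y] close to [z], and the
    Lipschitz constant of the truncated kernel carries it to [z]. For fixed [j] this constant is
    harmless as [n] grows; afterwards [j] tends to infinity. *)
Lemma limit_frostman (M : R) z : 1 <= M -> cabs z + r + 2 <= M ->
  (pot M nu z <= (V + ln M)%:E)%E.
Proof.
move=> M1 zM; have M0 : 0 < M by exact: lt_le_trans M1.
apply: (@cvge_le nat \oo _ R _ _ _ _ (@pot_cvg _ _ M1 nu z)); apply: nearW => j; rewrite lee_fin.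
have PU : ProperFilter U by exact: ultra_proper.
have h0 : (V + ln M) + (2 + expR j%:R / M) * n.+1%:R^-1 @[n --> \oo] --> V + ln M.
  rewrite -[X in _ --> X]addr0 -(mulr0 (2 + expR j%:R / M)).
  by apply: cvgD; [exact: cvg_cst|apply: cvgMr; exact: cvg_harmonic].
have h : (V + ln M) + (2 + expR j%:R / M) * n.+1%:R^-1 @[n --> U] --> V + ln M.
  by move=> A A0; exact: (ooU (h0 A A0)).
apply: (ler_cvg_to (nuP (bcont_kap M1 j z)) h); apply: ooU.
exists (Num.truncn (cabs z)).+1 => // n /= zn.
have s0 : (0 < size (xs n))%N by rewrite (leq_trans _ (size_xs n))// (leq_trans _ zn).
have sR : 0 < (size (xs n))%:R :> R by rewrite ltr0n.
have [_ [_ _ _ far]] := xsP n.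
have en1 := inv_le1 n; set e := n.+1%:R^-1 in far en1 *.
have [|y yz yfar] := far z; clearbody e.
  have /andP[_ h1] := truncn_itv (cabs_ge0 z).
  have : (Num.truncn (cabs z)).+1%:R <= n%:R :> R by rewrite ler_nat.
  by rewrite -[n.+2%:R]natr1 -[n.+1%:R]natr1; lra.
have yM x : x \in xs n -> cabs (y - x) <= M.
  move=> /xs_bounded xr; have := cabsB y x; have := cabs_triangle z y 0; rewrite !subr0; lra.
have h1 := avg_kap_le j M1 s0 yM yfar.
have h2 : avg (fun x => kap M j (cabs (z - x))) (xs n) <=
    avg (fun x => kap M j (cabs (y - x))) (xs n) + expR j%:R / M * e.
  rewrite -lerBlDl /avg -mulrBl ler_pdivrMr// -sumrB.
  have -> : expR j%:R / M * e * (size (xs n))%:R =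
      \sum_(x <- xs n) expR j%:R / M * e :> R.
    by rewrite sumr_const_seq.
  apply: ler_sum => x _; apply: (le_trans (ler_norm _)).
  apply: (le_trans (kap_lip M1 _ _ _)); rewrite ler_wpM2l ?divr_ge0 ?expR_ge0 ?(ltW M0)//.
  apply: (le_trans (ler_cabs_dist _ _)).
  by rewrite (_ : z - x - (y - x) = z - y) 1?cabs_distC//; ring.
rewrite mulrDl; lra.
Qed.

Lemma limit_energy : (log_energy nu <= V%:E)%E.
Proof.
pose M := 2 * r + 2; have M1 : 1 <= M by rewrite /M; move: r0; lra.
have rM : 2 * r <= M by rewrite /M lerDl.
have sK := limit_supported.
rewrite (log_energyE cK rK sK M1 rM) leeBlDr// -EFinD.
rewrite -(integral_prob_cst nu (V + ln M)).
have VM : (0 <= (V + ln M)%:E)%E.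
  have [k Kk] := approximants_nonempty; apply: le_trans (limit_frostman (z := k) M1 _).
    exact: pot_ge0.
  by rewrite /M; have := rK Kk; lra.
apply: (supported_le (compact_measurable_plane cK) sK) => //.
- exact: measurable_pot.
- by move=> z; exact: pot_ge0.
by move=> z Kz; apply: limit_frostman => //; rewrite /M; have := rK Kz; lra.
Qed.

End Ultra.

Hypotheses (Vmin : forall la : probability R[i] R, supported_in K la -> (V%:E <= log_energy la)%E)
  (eqKP : forall mu : probability R[i] R, is_equilibrium K mu <-> supported_in K mu /\ log_energy mu = V%:E).

Lemma ultralimit_exists (U : set_system nat) : UltraFilter U -> \oo `<=` U ->
  exists2 nu : probability R[i] R, is_equilibrium K nu &
    forall f, bcont f -> avg f (xs n) @[n --> U] --> mean nu f.
Proof.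
move=> UU ooU; have [|||nu nuP] := @weak_limit R U xs (r + 1) UU ooU.
- exact: addr_gt0.
- exact: xs_bounded.
- by move=> k; apply: ooU; exists k => // n /= kn; rewrite (leq_trans kn)// size_xs.
exists nu => //; apply/eqKP; have sK := limit_supported UU ooU nuP; split=> //.
by apply/eqP; rewrite eq_le (limit_energy UU ooU nuP) Vmin.
Qed.

(** An ultralimit of the near roots witnesses existence, so the choice made by [equilibrium] is a
    genuine one. *)
Lemma equilibriumP : is_equilibrium K (equilibrium K).
Proof.
have [U [UU ooU]] := ultraFilterLemma (eventually_filter : ProperFilter \oo).
have [nu nuK _] := ultralimit_exists UU ooU.
by apply: getPex; exists nu.
Qed.

(** Every ultralimit is an equilibrium measure and, by uniqueness, integrates [f] as the chosen one
    does; hence the sequence itself converges. *)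
Lemma equidistribution f : bcont f -> avg f (xs n) @[n --> \oo] --> mean (equilibrium K) f.
Proof.
move=> bf; apply: cvg_ultra => U UU ooU.
have [nu /eqKP[nuK nuV] nuP] := ultralimit_exists UU ooU.
have /eqKP[muK muV] := equilibriumP.
have -> : mean (equilibrium K) f = mean nu f; last exact: nuP.
by apply: (moments_determine cK muK nuK) => // k v; exact: (equal_moments cK r0 rK muK nuK muV nuV Vmin).
Qed.

(** The chosen equilibrium measure is itself a weak limit of the near roots, so it inherits their
    bound. *)
Lemma equilibrium_frostman (M : R) z : 1 <= M -> cabs z + r + 2 <= M ->
  (pot M (equilibrium K) z <= (V + ln M)%:E)%E.
Proof.
move=> M1 zM.
have [U [UU ooU]] := ultraFilterLemma (eventually_filter : ProperFilter \oo).
apply: (limit_frostman UU ooU _ M1 zM) => f bf A A0.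
exact: (ooU _ (equidistribution bf A0)).
Qed.

End LimitMeasure.

(** * Integration against the counting measure of the conjugates *)

Section ConjugatesMeasure.
Context {R : realType}.

Lemma integral_conjugates_measure (alpha : R[i]) (s : seq R[i]) f :
  perm_eq (fset_set (conjugates alpha)) s -> alg_deg alpha = size s -> bcont f ->
  (\int[conjugates_measure alpha]_z (f z)%:E)%E = (avg f s)%:E.
Proof.
move=> ps sz bf; set t : seq R[i] := fset_set (conjugates alpha) in ps.
have mf : measurable_fun setT (fun z => (f z)%:E).
  exact: bcont_measurable bf.
have H (h : R[i] -> \bar R) : measurable_fun setT h -> (forall z, (0 <= h z)%E) ->
    (\int[conjugates_measure alpha]_z h z = ((size s)%:R^-1)%:E * \sum_(x <- t) h x)%E.
  move=> mh h0; rewrite /conjugates_measure ge0_integral_mscale//= sz; congr (_ * _)%E.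
  rewrite ge0_integral_measure_sum// -/t (big_nth 0) big_mkord; apply: eq_bigr => k _.
  by rewrite integral_dirac// diracT mul1e.
have p0 z : (0 <= (fun z => (f z)%:E)^\+ z)%E by rewrite funeposE le_max lexx orbT.
have n0 z : (0 <= (fun z => (f z)%:E)^\- z)%E by rewrite funenegE le_max lexx orbT.
rewrite integralE (H _ (measurable_funepos mf) p0) (H _ (measurable_funeneg mf) n0).
have -> : (\sum_(x <- t) (fun z => (f z)%:E)^\+ x = (\sum_(x <- t) Num.max (f x) 0)%:E)%E.
  by rewrite -sumEFin; apply: eq_bigr => x _; rewrite funeposE -EFin_max.
have -> : (\sum_(x <- t) (fun z => (f z)%:E)^\- x = (\sum_(x <- t) Num.max (- f x) 0)%:E)%E.
  by rewrite -sumEFin; apply: eq_bigr => x _; rewrite funenegE -EFinN -EFin_max.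
rewrite -!EFinM -EFinB -mulrBr -sumrB /avg mulrC (perm_big _ ps) /=; congr (_ * _)%:E.
by apply: eq_bigr => x _; rewrite /Num.max; case: ltP => ?; case: ltP => ?; lra.
Qed.

End ConjugatesMeasure.

(** * The Green function in terms of the shifted potential *)

Section Green.
Context {R : realType}.
Implicit Types (x z w : R[i]).

Lemma compact_neighborhood (K U : set R[i]) : compact K -> K !=set0 -> K `<=` U° ->
  exists2 d : R, 0 < d & forall k x, K k -> cabs (x - k) <= d -> U x.
Proof.
move=> cK K0 KU; have [r r0 rK] := compact_cabs_bounded cK.
apply: contrapT => noD.
have /choice[kx kxP] : forall n : nat, exists kx : R[i] * R[i],
    [/\ K kx.1, cabs (kx.2 - kx.1) <= n.+1%:R^-1 & ~ U kx.2].
  move=> n; apply: contrapT => H; apply: noD; exists n.+1%:R^-1; first by rewrite invr_gt0.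
  by move=> k x Kk xk; apply: contrapT => nU; apply: H; exists (k, x).
have [F [FF ooF]] := ultraFilterLemma (eventually_filter : ProperFilter \oo).
have PF : ProperFilter F by exact: ultra_proper.
have kr n : cabs (kx n).1 <= r by case: (kxP n) => /rK.
have [l lP] := ultra_bounded_cvgC FF kr.
have Kl : K l.
  apply: contrapT => /(dist_gt0 cK K0) d0.
  have [n /= ln] := filter_ex (lP _ d0); have [/(dist_le l) h _ _] := kxP n.
  by move: ln; rewrite ltNge h.
have /nbhs_cabs[e e0 eU] : nbhs l U by exact: KU.
have e2 : 0 < e / 2 by rewrite divr_gt0.
have big : F [set n : nat | n.+1%:R^-1 < e / 2].
  apply: ooF; have := @cvg_harmonic R; move/cvgrPdist_lt => /(_ _ e2).
  by apply: filterS => n /=; rewrite sub0r normrN ger0_norm.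
have [n [/= ln en]] := filter_ex (filterI (lP _ e2) big); have [_ xk nU] := kxP n.
apply: nU; apply: eU; have := cabs_triangle (kx n).1 l (kx n).2.
rewrite (cabs_distC (kx n).1) => h; apply: (le_lt_trans h).
move: ln (le_lt_trans xk en); lra.
Qed.

Variables (K : set R[i]) (V r : R).
Hypotheses (cK : compact K) (r0 : 0 < r) (rK : forall z, K z -> cabs z <= r)
  (capV : capacity K = expR (- V)) (muK : supported_in K (equilibrium K)).

Lemma green_pot (M : R) x : 1 <= M -> cabs x + r <= M -> (pot M (equilibrium K) x < +oo)%E ->
  green K x = (ln M + V - fine (pot M (equilibrium K) x))%:E.
Proof.
move=> M1 xM fin; set p := pot M _ x in fin *.
have pfin : p \is a fin_num by rewrite ge0_fin_numE// /p pot_ge0.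
have E := neg_log_potential cK rK muK M1 xM; rewrite -/p in E.
have Efin : (\int[equilibrium K]_w (- lne (cabs (x - w)%R)%:E))%E \is a fin_num.
  by rewrite E fin_numB pfin.
have fp := Efin; rewrite integralE fin_numB in fp.
rewrite /green capV expRK.
have -> : (\int[equilibrium K]_w lne (cabs (x - w)%R)%:E =
    - \int[equilibrium K]_w (- lne (cabs (x - w)%R)%:E))%E.
  rewrite -integralN; first by apply: eq_integral => w _; rewrite oppeK.
  by apply: fin_num_adde_defr; case/andP: fp.
by rewrite E -(fineK pfin) -!EFinB ?EFinN /=; congr EFin; ring.
Qed.

(** With [M = cabs x + r] and [cabs x >= 3 * r], all distances from [x] to [K] lie between [M / 2]
    and [M], so the shifted potential is between 0 and [ln 2]. *)
Lemma green_far x : 1 <= cabs x -> 3 * r <= cabs x -> exists2 g : R, green K x = g%:E &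
  ln (cabs x) + V - ln 2 <= g <= ln (cabs x) + V + ln 2.
Proof.
move=> x1 x3; pose M := cabs x + r.
have x0 : 0 < cabs x by exact: lt_le_trans x1.
have M1 : 1 <= M by rewrite /M; move: r0; lra.
have M0 : 0 < M by exact: lt_le_trans M1.
have ln2 : 0 <= ln 2 :> R by rewrite ln_ge0// ler1n.
have pot2 : (pot M (equilibrium K) x <= (ln 2)%:E)%E.
  rewrite -(integral_prob_cst (equilibrium K) (ln 2)).
  apply: (supported_le (compact_measurable_plane cK) muK) => //.
  - exact: measurable_kapoo.
  - by move=> w; apply: kapoo_ge0 => //; exact: cabs_ge0.
  move=> w Kw; have wr := rK Kw; have := cabs_triangle w x 0; rewrite !subr0 => tri.
  have M2 : M / 2 <= cabs (x - w) by rewrite /M; lra.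
  have s0 : 0 < cabs (x - w) by apply: lt_le_trans M2; rewrite divr_gt0.
  rewrite kapoo_pos// lee_fin lerBlDr -lerBlDl -ln_div ?posrE//.
  rewrite ler_ln ?posrE ?divr_gt0// ?lt_min ?s0//.
  by rewrite le_min M2 /= ler_pdivrMr// ler_peMr// ?ltW// ltr1n.
have := green_pot M1 (lexx _) (le_lt_trans pot2 (ltry _)).
set p := pot M _ x in pot2 * => gE.
have p0 : (0 <= p)%E by rewrite /p pot_ge0.
have pfin : p \is a fin_num by rewrite ge0_fin_numE// (le_lt_trans pot2)// ltry.
exists (ln M + V - fine p) => //.
move: p0 pot2; rewrite -(fineK pfin) !lee_fin /= => h1 h2.
have l1 : ln (cabs x) <= ln M by rewrite ler_ln ?posrE// /M lerDl ltW.
have l2 : ln M <= ln (cabs x) + ln 2.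
  by rewrite -lnM ?posrE// ler_ln ?posrE ?mulr_gt0// /M; move: r0; lra.
by apply/andP; split; lra.
Qed.

End Green.

(** * Asymptotics of heights, counts and measures *)

Section Asymptotics.
Context {R : realType}.
Implicit Types (x z w : R[i]).
Variables (K : set R[i]) (V r : R) (zeta : nat -> R[i]) (xs : nat -> seq R[i]).
Hypotheses (cK : compact K) (r0 : 0 < r) (rK : forall z, K z -> cabs z <= r) (V0 : 0 < V)
  (xs_mono : forall n, (size (xs n) < size (xs n.+1))%N)
  (xsP : forall n, approximant K V n.+1%:R^-1 n.+2%:R (zeta n) (xs n))
  (capV : capacity K = expR (- V)) (muK : supported_in K (equilibrium K))
  (muV : log_energy (equilibrium K) = V%:E)
  (equi : forall f, bcont f -> avg f (xs n) @[n --> \oo] --> mean (equilibrium K) f)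
  (frost : forall (M : R) z, 1 <= M -> cabs z + r + 2 <= M ->
     (pot M (equilibrium K) z <= (V + ln M)%:E)%E).

Let N n : R := (size (xs n)).+1%:R.

Let N0 n : 0 < N n. Proof. by rewrite ltr0n. Qed.

Let invN n : (N n)^-1 <= n.+1%:R^-1.
Proof. by rewrite lef_pV2 ?posrE ?ltr0n// ler_nat ltnS (size_xs xs_mono). Qed.

Let K0 : K !=set0. Proof. exact: approximants_nonempty xs_mono xsP. Qed.

Lemma alpha_injective : injective zeta.
Proof.
move=> m n mn; have [[_ dm _ _ _] _] := xsP m; have [[_ dn _ _ _] _] := xsP n.
have smono : {homo (fun n => size (xs n)) : i j / (i < j)%N} by exact: homo_ltn ltn_trans xs_mono.
move: dm; rewrite mn dn => -[] E.
by case: (ltngtP m n) => // /smono; rewrite E ltnn.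
Qed.

Lemma conjugates_weak_cvg : weak_cvg (fun n => conjugates_measure (zeta n)) (equilibrium K).
Proof.
move=> f cf bf; have bcf : bcont f by split.
have [B fB] := bf; have B0 : 0 <= B by apply: le_trans (fB 0).
rewrite meanE//.
have -> : (fun n => (\int[conjugates_measure (zeta n)]_z (f z)%:E)%E) =
    fun n => (avg f (zeta n :: xs n))%:E.
  apply/funext => n; have [[_ dn _ _ pn] _] := xsP n.
  by apply: integral_conjugates_measure.
apply/cvg_EFin; first by near=> n.
(* The far root is one point among [size (xs n) + 1]; adding it moves the average of [f] by at most
   [2 * B] over this number. *)
have h : (2 * B) * n.+1%:R^-1 @[n --> \oo] --> 0.
  by rewrite -(mulr0 (2 * B)); apply: cvgMr; exact: cvg_harmonic.
have d : avg f (zeta n :: xs n) - avg f (xs n) @[n --> \oo] --> (0 : R).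
  apply/cvgrPdist_le => e e0; move/cvgrPdist_le : h => /(_ e e0).
  have s1 : \forall n \near \oo, (0 < size (xs n))%N.
    by exists 1%N => // n /= n1; rewrite (leq_trans n1)// size_xs.
  apply: filterS2 s1 => n s1.
  have sR : 0 < (size (xs n))%:R :> R by rewrite ltr0n.
  move: (invN n); rewrite /N -natr1 => iN h.
  rewrite sub0r normrN; apply: le_trans h; rewrite sub0r normrN /=.
  rewrite [leRHS]ger0_norm ?mulr_ge0//.
  apply: (@le_trans _ _ (2 * B * ((size (xs n))%:R + 1)^-1)); last first.
    by rewrite ler_wpM2l// mulr_ge0.
  have aB : `|avg f (xs n)| <= B.
    rewrite /avg normrM (gtr0_norm (_ : 0 < _^-1)) ?invr_gt0// ler_pdivrMr//.
    apply: (le_trans (ler_norm_sum _ _ _)).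
    have -> : B * (size (xs n))%:R = \sum_(x <- xs n) B.
      by rewrite sumr_const_seq.
    exact: ler_sum.
  have -> : avg f (zeta n :: xs n) - avg f (xs n) =
      (f (zeta n) - avg f (xs n)) / ((size (xs n))%:R + 1).
    rewrite /avg big_cons /= -natr1; field.
    by rewrite !lt0r_neq0// addr_gt0.
  rewrite normrM (gtr0_norm (_ : 0 < _^-1)) ?invr_gt0 ?addr_gt0//.
  rewrite ler_wpM2r ?invr_ge0 ?addr_ge0//.
  apply: (le_trans (ler_normB _ _)); have := fB (zeta n); move: aB; lra.
have hh := cvgD d (equi bcf); rewrite add0r in hh.
refine (eq_ind_r (fun u : nat -> R => u @ \oo --> mean (equilibrium K) f) (hh _) _).
by apply/funext => n; rewrite fctE subrK.
Unshelve. all: by end_near. Qed.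

(** For large [n] every near root lies in [U]; only [zeta n] may be missing from the count. *)
Lemma conjugates_in_neighborhood (U : set R[i]) : K `<=` U° ->
  (#|` fset_set (conjugates (zeta n) `&` U)|%:R / (alg_deg (zeta n))%:R : R) @[n --> \oo] --> (1 : R).
Proof.
move=> KU; have [d d0 dP] := compact_neighborhood cK K0 KU.
have h1 : 1 - n.+1%:R^-1 @[n --> \oo] --> (1 : R).
  by rewrite -[X in _ --> X]subr0; apply: cvgB; [exact: cvg_cst|exact: cvg_harmonic].
apply: (@squeeze_cvgr _ _ _ _ (fun n => 1 - n.+1%:R^-1) (fun=> 1)) => //; last exact: cvg_cst.
have := @cvg_harmonic R; move/cvgrPdist_le => /(_ _ d0) hd.
apply: filterS hd => n /=; rewrite sub0r normrN ger0_norm// => nd.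
have [[_ dn [cn un] _ _] [near _ _ _]] := xsP n; rewrite dn cn.
have fin : finite_set ([set` zeta n :: xs n] `&` U : set R[i]).
  by apply: finite_setI; left; exact: finite_seq.
have inU x : x \in xs n -> U x.
  by move=> /near[k Kk xk]; apply: (dP k) => //; exact: le_trans xk nd.
have up : (#|` fset_set ([set` zeta n :: xs n] `&` U)| <= (size (xs n)).+1)%N.
  rewrite -[(size (xs n)).+1]/(size (zeta n :: xs n)).
  apply: (uniq_leq_size (fset_uniq _)) => x.
  by rewrite in_fset_set// inE => -[].
have lo : (size (xs n) <= #|` fset_set ([set` zeta n :: xs n] `&` U)|)%N.
  have /andP[_ uxs] := un; apply: (uniq_leq_size uxs) => x xx.
  rewrite in_fset_set// inE; split; last exact: inU.
  by rewrite /= inE xx orbT.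
rewrite -/(N n) ler_pdivrMr// ler_pdivlMr// mul1r ler_nat up andbT.
apply: (@le_trans _ _ (size (xs n))%:R); last by rewrite ler_nat.
rewrite mulrBl mul1r {1}/N -natr1 lerBlDr lerD2l.
by rewrite -ler_pdivrMr// mul1r invN.
Qed.

Let M : R := 2 * r + 3.

Let M1 : 1 <= M. Proof. by rewrite /M; move: r0; lra. Qed.

Let G x : R := ln M + V - fine (pot M (equilibrium K) x).

Let xsM n x : x \in xs n -> cabs x + r + 2 <= M.
Proof. by move=> /(xs_bounded rK xsP); rewrite /M; lra. Qed.

Let pot_fin n x : x \in xs n -> (pot M (equilibrium K) x < +oo)%E.
Proof. by move=> /xsM /(frost M1) h; exact: le_lt_trans h (ltry _). Qed.

Let pot_finE n x : x \in xs n ->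
  pot M (equilibrium K) x = (fine (pot M (equilibrium K) x))%:E.
Proof. by move=> xx; rewrite fineK// ge0_fin_numE ?pot_ge0// (pot_fin xx). Qed.

Let green_xs n x : x \in xs n -> green K x = (G x)%:E.
Proof.
move=> xx; apply: (green_pot cK rK capV muK M1 _ (pot_fin xx)).
have := xsM xx; lra.
Qed.

Let G_ge0 n x : x \in xs n -> 0 <= G x.
Proof.
move=> xx; have := frost M1 (xsM xx); rewrite (pot_finE xx) lee_fin /G /=; lra.
Qed.

(** From below [G] is nonnegative at the near roots by Frostman's inequality. From above the
    potential is replaced by a truncated one, to which equidistribution applies; its limit is the
    truncated energy, within [e / 2] of [V + ln M] for a suitable [j]. *)
Lemma avg_green_cvg0 : avg G (xs n) @[n --> \oo] --> (0 : R).
Proof.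
have enE : en M (equilibrium K) = (V + ln M)%:E.
  have rM : 2 * r <= M by rewrite /M; move: r0; lra.
  have := log_energyE cK rK muK M1 rM; rewrite muV => /(congr1 (fun t => t + (ln M)%:E)%E).
  by rewrite subeK// EFinD => ->.
apply/cvgrPdist_le => e e0; have e2 : 0 < e / 2 by rewrite divr_gt0.
have /fine_cvgP[_ ec] : (enj M (equilibrium K) j)%:E @[j --> \oo] --> (V + ln M)%:E.
  by rewrite -enE; exact: en_cvg.
move/cvgrPdist_le : ec => /(_ _ e2) [j _ /(_ j (leqnn j)) /= jP].
move/cvgrPdist_le : (equi (bcont_potj M1 (equilibrium K) j)) => /(_ _ e2).
have s1 : \forall n \near \oo, (0 < size (xs n))%N.
  by exists 1%N => // n /= n1; rewrite (leq_trans n1)// size_xs.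
apply: filterS2 s1 => n s1 hn; have sR : 0 < (size (xs n))%:R :> R by rewrite ltr0n.
have a0 : 0 <= avg G (xs n).
  by rewrite /avg divr_ge0// big_seq sumr_ge0// => x; exact: G_ge0.
rewrite sub0r normrN ger0_norm//.
have : avg G (xs n) <= ln M + V - avg (potj M (equilibrium K) j) (xs n).
  have -> : ln M + V = (\sum_(x <- xs n) (ln M + V)) / (size (xs n))%:R.
    by rewrite sumr_const_seq mulfK// lt0r_neq0.
  rewrite /avg -mulrBl -sumrB ler_wpM2r ?invr_ge0//.
  rewrite !big_seq; apply: ler_sum => x xx; rewrite /G lerD2l lerN2.
  by rewrite -lee_fin -(pot_finE xx); exact: potj_le_pot.
move: hn jP; rewrite -/(enj M (equilibrium K) j) !ler_norml => /andP[? ?] /andP[? ?]; lra.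
Qed.

(** The leading coefficient contributes 0 and the near roots contribute [avg G], up to a factor
    below 1; the limit comes entirely from the far root. *)
Lemma height_cvg : height K (zeta n) @[n --> \oo] --> V%:E.
Proof.
pose g n := fine (green K (zeta n)).
pose H n : R := (g n + \sum_(x <- xs n) G x) / N n.
have big : \forall n \near \oo, 1 <= cabs (zeta n) /\ 3 * r <= cabs (zeta n).
  exists (Num.truncn (3 * r / V)).+1 => // n /= rn.
  have [_ [_ lo _ _]] := xsP n.
  have lo' : 1 + V * n%:R <= cabs (zeta n).
    apply: le_trans lo; apply: (le_trans (expR_ge1Dx _)); rewrite ler_expR ler_pM ?(ltW V0)//.
      by rewrite lerDl.
    by rewrite ler_nat size_xs.
  split; first by apply: le_trans lo'; rewrite lerDl mulr_ge0// ltW.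
  apply: le_trans lo'; rewrite (@le_trans _ _ (V * n%:R))//; last by rewrite lerDr.
  have q0 : 0 <= 3 * r / V by rewrite divr_ge0 ?mulr_ge0// ltW.
  rewrite [leRHS]mulrC -ler_pdivrMr//; have /andP[_ /ltW h] := truncn_itv q0.
  by apply: (le_trans h); rewrite ler_nat.
have hE : \forall n \near \oo, (H n)%:E = height K (zeta n).
  apply: filterS big => n [z1 z3].
  have [[_ dn [cn un] ln0 pn] _] := xsP n.
  have [gz gE _] := green_far cK r0 rK capV muK z1 z3.
  have fin : finite_set (conjugates (zeta n)) by rewrite cn; exact: finite_seq.
  rewrite /height dn ln0 add0e fsbig_finite// (perm_big _ pn)/= big_cons.
  have -> : (\sum_(x <- xs n) green K x = (\sum_(x <- xs n) G x)%:E)%E.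
    rewrite -sumEFin !big_seq; apply: eq_bigr => x xx; exact: green_xs xx.
  by rewrite /H /g gE /= -EFinD -EFinM mulrC.
apply: cvg_trans (near_eq_cvg hE) _; apply/cvg_EFin; first by near=> n.
have h : (2 + ln 2) * n.+1%:R^-1 + avg G (xs n) @[n --> \oo] --> 0.
  rewrite -[X in _ --> X]addr0 -{1}(mulr0 (2 + ln 2)).
  by apply: cvgD; [apply: cvgMr; exact: cvg_harmonic|exact: avg_green_cvg0].
apply/cvgrPdist_le => e e0; move/cvgrPdist_le : h => /(_ e e0).
apply: filterS2 big => n [z1 z3]; rewrite /= sub0r normrN.
have [_ [_ lo hi _]] := xsP n; have iN := invN n.
have [gz gE gb] := green_far cK r0 rK capV muK z1 z3.
have ln20 : 0 <= ln 2 :> R by rewrite ln_ge0// ler1n.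
set a := n.+1%:R^-1 in lo hi iN *.
have a0 : 0 <= a by rewrite invr_ge0.
have z0 : 0 < cabs (zeta n) by exact: lt_le_trans z1.
have S0 : 0 <= \sum_(x <- xs n) G x by rewrite big_seq sumr_ge0// => x; exact: G_ge0.
have A0 : 0 <= avg G (xs n) by rewrite /avg divr_ge0.
move=> h; apply: le_trans h; rewrite distrC [leRHS]ger0_norm ?addr_ge0 ?mulr_ge0// ?addr_ge0//.
have SA : \sum_(x <- xs n) G x <= avg G (xs n) * N n.
  have [s0|s0] := posnP (size (xs n)).
    by rewrite {1}(size0nil s0) big_nil; apply: mulr_ge0 => //; exact: ltW.
  have -> : \sum_(x <- xs n) G x = avg G (xs n) * (size (xs n))%:R.
    by rewrite /avg divfK// lt0r_neq0// ltr0n.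
  by rewrite ler_wpM2l// /N ler_nat.
have {}lo : (V + a) * (size (xs n))%:R <= ln (cabs (zeta n)) by rewrite -ler_expR lnK ?posrE.
have {}hi : ln (cabs (zeta n)) <= (V + 2 * a) * (size (xs n))%:R by rewrite -ler_expR lnK ?posrE.
have NE : N n = (size (xs n))%:R + 1 by rewrite /N natr1.
have sz0 : 0 <= (size (xs n))%:R :> R by [].
have aN : 1 <= a * N n by rewrite -ler_pdivrMr// mul1r.
have HE : H n - V = (gz + \sum_(x <- xs n) G x - V * N n) / N n.
  by rewrite /H /g gE /=; field; exact: lt0r_neq0.
rewrite HE normrM (gtr0_norm (_ : 0 < (N n)^-1)) ?invr_gt0// ler_pdivrMr//.
move: gb => /andP[gb1 gb2].
have l2 : ln 2 <= ln 2 * (a * N n) by rewrite ler_peMr.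
have am : a * (size (xs n))%:R <= a * N n by rewrite ler_wpM2l// NE lerDl.
have am0 : 0 <= a * (size (xs n))%:R by rewrite mulr_ge0.
(* The summand [V] in the Green function at [zeta n], which stems from the capacity, completes
   [V * size (xs n)] to exactly [V * N n]. *)
have VN : V * N n = V * (size (xs n))%:R + V by rewrite NE mulrDr mulr1.
have AN0 : 0 <= avg G (xs n) * N n by rewrite mulr_ge0// ltW.
have aux (p q vn vs l S An u lz c d : R) : c <= lz -> lz <= d -> c = vs + p -> d = vs + 2 * p ->
    lz + V - l <= u -> u <= lz + V + l -> 0 <= p -> p <= q -> l <= l * q -> vn = vs + V ->
    0 <= l -> 0 <= S -> S <= An -> 0 <= An -> `|u + S - vn| <= 2 * q + l * q + An.
  by move=> *; rewrite ler_norml; apply/andP; split; lra.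
have -> : ((2 + ln 2) * a + avg G (xs n)) * N n =
    2 * (a * N n) + ln 2 * (a * N n) + avg G (xs n) * N n by ring.
apply: (aux (a * (size (xs n))%:R) _ _ (V * (size (xs n))%:R) (ln 2) _ _ gz _ _ _ lo hi) => //.
- by rewrite mulrDl.
- by rewrite mulrDl mulrA.
Unshelve. all: by end_near. Qed.

End Asymptotics.

Theorem mainTheorem4 (R : realType) (Sigma : set R[i])
    (cptSigma : compact Sigma)
    (symSigma : [set z^* | z in Sigma] = Sigma)
    (capSigma : 0 < capacity Sigma < 1) :
  exists alpha : nat -> R[i],
    [/\ injective alpha,
        forall n, algebraic_integer (alpha n),
        height Sigma (alpha n) @[n --> \oo] --> (- ln (capacity Sigma))%:E,
        forall U : set R[i], Sigma `<=` U° ->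
          (#|` fset_set (conjugates (alpha n) `&` U)|%:R
             / (alg_deg (alpha n))%:R : R) @[n --> \oo] --> (1 : R) &
        weak_cvg (fun n => conjugates_measure (alpha n)) (equilibrium Sigma)].
Proof.
have [V [V0 capV Vmin Vnear eqV]] := capacity_energy capSigma.
have [r r0 rS] := compact_cabs_bounded cptSigma.
have [alpha [xs [xs_mono xsP]]] := approximating_sequence cptSigma symSigma V0 Vnear.
have /eqV[muS muV] := equilibriumP cptSigma r0 rS xs_mono xsP Vmin eqV.
have equi := equidistribution cptSigma r0 rS xs_mono xsP Vmin eqV.
have frost := equilibrium_frostman cptSigma r0 rS xs_mono xsP Vmin eqV.
exists alpha; split.
- exact: alpha_injective xs_mono xsP.
- by move=> n; have [[]] := xsP n.
- rewrite capV expRK opprK.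
  exact: height_cvg cptSigma r0 rS V0 xs_mono xsP capV muS muV equi frost.
- exact: conjugates_in_neighborhood cptSigma xs_mono xsP.
- exact: conjugates_weak_cvg xs_mono xsP equi.
Qed.
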